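(* Let the uplink (UL) satellite network share spectrum with the uplink (UL) terrestrial network. For $R_{\min}^{\mathrm{u_s|s}}\le r\le R_{\max}^{\mathrm{u_s|s}}$ and $\|\mathbf u_1^{\mathrm s}-\mathbf x_1\|=r$, define the aggregated interference plus noise power $$I_{\mathrm{up}}^{\mathrm{up}}(r)=\sum_{\mathbf u_\ell^{\mathrm s}\in\Phi_{\mathrm{u_s}}\cap(\mathcal A_{\mathrm{u_s|s}}\setminus\mathcal A_{\mathrm{u_s|s}}(r))}G_\ell^{\mathrm{u_s|s}}P_{\mathrm{u_s}}H_\ell^{\mathrm s}\|\mathbf u_\ell^{\mathrm s}-\mathbf x_1\|^{-\alpha_{\mathrm s}}+\sum_{\mathbf u_k^{\mathrm t}\in\Phi_{\mathrm{u_t}}\cap\mathcal A_{\mathrm{u_t|s}}}G^{\mathrm{u_t|s}}P_{\mathrm{u_t}}H_k^{\mathrm s}\|\mathbf u_k^{\mathrm t}-\mathbf x_1\|^{-\alpha_{\mathrm s}}+\sigma^2 .$$ Then, for $s\ge0$, its conditional Laplace transform $\mathbb E\bigl[e^{-sI_{\mathrm{up}}^{\mathrm{up}}(r)}\,\big|\,\|\mathbf u_1^{\mathrm s}-\mathbf x_1\|=r,\ \Phi_{\mathrm{u_s}}(\mathcal A_{\mathrm{u_s|s}})\ge1\bigr]$ equals $$\exp\Biggl(-s\sigma^2-2\pi\tilde\lambda_{\mathrm{u_s|s}}\int_r^{R_{\max}^{\mathrm{u_s|s}}}\Bigl[1-\sum_{z=0}^{m_{\mathrm s}-1}\frac{\zeta(z)\Gamma(z+1)}{(\beta-c+sG_\ell^{\mathrm{u_s|s}}P_{\mathrm{u_s}}v^{-\alpha_{\mathrm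 s}})^{z+1}}\Bigr]v\,\mathrm dv-2\pi\tilde\lambda_{\mathrm{u_t|s}}\int_{R_{\min}^{\mathrm{u_t|s}}}^{R_{\max}^{\mathrm{u_t|s}}}\Bigl[1-\sum_{i=0}^{m_{\mathrm s}-1}\frac{\zeta(i)\Gamma(i+1)}{(\beta-c+sG^{\mathrm{u_t|s}}P_{\mathrm{u_t}}w^{-\alpha_{\mathrm s}})^{i+1}}\Bigr]w\,\mathrm dw\Biggr),$$ where $G_\ell^{\mathrm{u_s|s}}$ denotes the common (side-lobe) gain of all interfering satellite users ($\ell\neq1$).
   Context: Geometry. All nodes lie on spheres centered at the origin of $\mathbb{R}^3$. Satellites lie on the sphere of radius $R_{\mathrm s}$; satellite users and terrestrial users lie on spheres of radii $R_{\mathrm{u_s}},R_{\mathrm{u_t}}<R_{\mathrm s}$. $\Phi_{\mathrm{u_s}}=\{\mathbf u_\ell^{\mathrm s}\}$ and $\Phi_{\mathrm{u_t}}=\{\mathbf u_k^{\mathrm t}\}$ are independent homogeneous Poisson point processes on the respective spheres with densities $\lambda_{\mathrm{u_s}},\lambda_{\mathrm{u_t}}>0$ (per unit area). The typical satellite is fixed at $\mathbf x_1=(0,0,R_{\mathrm s})$. The visible angle is $\theta_{\mathrm s}\in(0,\pi/2)$ with $R_{\mathrm s}\sin\theta_{\mathrm s}\le R_o$ for $o\in\{\mathrm{u_s},\mathrm{u_t}\}$. For such $o$ put $$R_{\min}^{o|\mathrm s}=R_{\mathrm s}-R_o,\quad R_{\max}^{o|\mathrm s}=R_{\mathrm s}\cos\theta_{\mathrm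 s}-\sqrt{R_o^2-R_{\mathrm s}^2\sin^2\theta_{\mathrm s}},\quad\tilde\lambda_{o|\mathrm s}=\lambda_o\frac{R_o}{R_{\mathrm s}}.$$ The visible cap $\mathcal A_{o|\mathrm s}$ is the set of points of the sphere of radius $R_o$ at distance at most $R_{\max}^{o|\mathrm s}$ from $\mathbf x_1$; $\mathcal A_{o|\mathrm s}(r)$ is the set of those at distance at most $r$. $\mathbf u_1^{\mathrm s}$ is the visible satellite user nearest to $\mathbf x_1$. Gains. With carrier frequency $f_c$, speed of light $c_0$ and positive lobe gains: $G_\ell^{\mathrm{u_s|s}}=G_{\mathrm s}^{\mathrm{side}}G_{\mathrm{u_s}}^{\mathrm{side}}(c_0/4\pi f_c)^2$ for $\ell\ne1$; $G^{\mathrm{u_t|s}}=G_{\mathrm s}^{\mathrm{side}}G_{\mathrm{u_t}}^{\mathrm{side}}(c_0/4\pi f_c)^2$. Fading. All fading powers $H^{\mathrm s}$ (for satellite users and terrestrial users) are i.i.d. and independent of the point processes; $\sqrt{H^{\mathrm s}}$ is Shadowed-Rician with density $$\Bigl(\tfrac{2bm_{\mathrm s}}{2bm_{\mathrm s}+\Omega}\Bigr)^{m_{\mathrm s}}\tfrac{x}{b}\,e^{-x^2/(2b)}\,{}_1F_1\Bigl(m_{\mathrm s};1;\tfrac{\Omega x^2}{2b(2bm_{\mathrm s}+\Omega)}\Bigr),\quad x>0,$$ with $b,\Omega>0$, $m_{\mathrm s}$ a positive integer, ${}_1F_1$ the confluent hypergeometric function. Constants: $\beta=\frac1{2b}$,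 $c=\frac{\Omega}{2b(2bm_{\mathrm s}+\Omega)}$, $\zeta(z)=\bigl(\frac{2bm_{\mathrm s}}{2bm_{\mathrm s}+\Omega}\bigr)^{m_{\mathrm s}}\frac{\beta(-1)^z(1-m_{\mathrm s})_z c^z}{(z!)^2}$, with $(x)_z=x(x+1)\cdots(x+z-1)$ and $(x)_0=1$. $P_{\mathrm{u_s}},P_{\mathrm{u_t}}>0$ are transmit powers, $\sigma^2>0$ the noise power, $\alpha_{\mathrm s}>0$ the path-loss exponent. *)

(* Defs.v *)
From HB Require Import structures.
From mathcomp Require Import all_boot all_order all_algebra.
From mathcomp Require Import all_classical all_reals all_analysis.

Set Implicit Arguments.
Unset Strict Implicit.
Unset Printing Implicit Defensive.
Import Order.TTheory GRing.Theory Num.Theory.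
Import numFieldNormedType.Exports.
Local Open Scope classical_set_scope.
Local Open Scope ring_scope.

Section geometry.
Context {R : realType}.
Implicit Types (x y : R * R * R) (Rs rho r theta lam : R).

Definition dist3 x y : R :=
  Num.sqrt ((x.1.1 - y.1.1) ^+ 2 + (x.1.2 - y.1.2) ^+ 2 + (x.2 - y.2) ^+ 2).

Definition sphere3 rho : set (R * R * R) := [set x | dist3 x (0, 0, 0) = rho].

Definition spherical rho (t p : R) : R * R * R :=
  (rho * sin t * cos p, rho * sin t * sin p, rho * cos t).

(* Surface area of [B `&` sphere3 rho], from the area element
   rho^2 sin t dp dt of spherical coordinates. *)
Definition sphere_area rho (B : set (R * R * R)) : \bar R :=
  (\int[lebesgue_measure]_(t in `[0%R, pi])
     \int[lebesgue_measure]_(p in `[0%R, (2 * pi)%R])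
       (rho ^+ 2 * sin t * \1_B (spherical rho t p))%:E)%E.

Definition typical_sat Rs : R * R * R := (0, 0, Rs).

Definition cap Rs rho r : set (R * R * R) :=
  [set x | sphere3 rho x /\ dist3 x (typical_sat Rs) <= r].

Definition Rmin Rs rho : R := Rs - rho.

Definition Rmax Rs rho theta : R :=
  Rs * cos theta - Num.sqrt (rho ^+ 2 - Rs ^+ 2 * sin theta ^+ 2).

Definition visible_cap Rs rho theta := cap Rs rho (Rmax Rs rho theta).

Definition lam_tilde Rs rho lam : R := lam * (rho / Rs).

End geometry.

Section probability_notions.
Context {R : realType} d (T : measurableType d) (P : probability T R).

Definition mutually_independent (I : choiceType) (F : I -> set (set T)) : Prop :=
  forall (J : seq I) (E : I -> set T), uniq J ->
    (forall i, i \in J -> F i (E i)) ->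
    P (\bigcap_(i in [set` J]) E i) = (\prod_(i <- J) fine (P (E i)))%:E.

Definition independent2 (F G : set (set T)) : Prop :=
  forall A B, F A -> G B -> P (A `&` B) = (P A * P B)%E.

(* A finite point process is given as a random labelled list of points, so
   that marks can be attached to labels; its configuration is the multiset of
   the listed points. *)
Implicit Types (Phi : T -> seq (R * R * R)).

Definition label_events Phi : set (set T) :=
  [set E | exists (i : nat) (B : set (R * R * R)), measurable B /\
     E = [set w | (i < size (Phi w))%N /\ B (Phi w)`_i]].

Definition count_pts Phi (B : set (R * R * R)) (w : T) : nat :=
  count [in B] (Phi w).

Definition count_events Phi : set (set T) :=
  [set E | exists (B : set (R * R * R)) (n : nat), measurable B /\
     E = [set w | count_pts Phi B w = n]].

(* [poisson_pmf] is not used since its value for rate 0 is 1 at every n;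
   sets of area 0 are allowed here, with the convention 0 ^+ 0 = 1. *)
Definition poisson_weight (a : R) (n : nat) : R :=
  a ^+ n / n`!%:R * expR (- a).

Record poisson_process_on_sphere Phi (rho lam : R) : Prop := {
  ppp_measurable : forall E, label_events Phi E -> measurable E ;
  ppp_on_sphere : forall w x, x \in Phi w -> sphere3 rho x ;
  ppp_law : forall (k : nat) (B : 'I_k -> set (R * R * R)) (n : 'I_k -> nat),
    (forall j, measurable (B j)) -> trivIset setT B ->
    P [set w | forall j, count_pts Phi (B j) w = n j] =
    (\prod_j poisson_weight (lam * fine (sphere_area rho (B j))) (n j))%:E }.

(* Conditioning on [D = r] and on an event [A], for a family [X r] of random
   variables.  As [X r] is only considered on [D = r], it is evaluated as
   [X (D w) w]. *)

(* [g] is a version, on [J], of r |-> E[X r | D = r, A]: the defining identity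
   of the conditional expectation given [D] under P( . | A), multiplied by
   P A. *)
Definition cond_expectation_version (A : set T) (D : T -> R) (X : R -> T -> R)
    (J : set R) (g : R -> R) : Prop :=
  [/\ P.-integrable A (fun w => (X (D w) w)%:E),
      measurable_fun J g &
      forall B : set R, measurable B -> B `<=` J ->
        (\int[P]_(w in A `&` D @^-1` B) (X (D w) w)%:E =
         \int[P]_(w in A `&` D @^-1` B) (g (D w))%:E)%E].

(* [v] is the value at the single point [r] of E[X r | D = r, A], as the limit
   of the elementary conditional expectations given |D - r| <= e and A. *)
Definition cond_expectation_at (A : set T) (D : T -> R) (X : R -> T -> R)
    (r v : R) : Prop :=
  let E (e : R) := A `&` [set w | `|D w - r| <= e] in
  (forall e : R, 0 < e -> (0 < P (E e))%E) /\
  (\int[P]_(w in E e) X (D w) w) / fine (P (E e)) @[e --> 0^'+] --> v.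

End probability_notions.

Section shadowed_rician.
Context {R : realType}.
Implicit Types (b Omega x : R) (m z : nat).

Definition pochhammer x z : R := \prod_(i < z) (x + i%:R).

Definition hyp1F1 (a c x : R) : R :=
  limn (series (fun n =>
    pochhammer a n / pochhammer c n * x ^+ n / n`!%:R)).

Definition Gamma_fun (a : R) : R :=
  \int[lebesgue_measure]_(t in `]0%R, +oo[) (t `^ (a - 1) * expR (- t)).

Definition sr_ratio b m Omega : R := (2 * b * m%:R) / (2 * b * m%:R + Omega).

Definition sr_beta b : R := (2 * b)^-1.

Definition sr_c b m Omega : R := Omega / (2 * b * (2 * b * m%:R + Omega)).

Definition sr_density b m Omega x : R :=
  sr_ratio b m Omega ^+ m * (x / b) * expR (- (x ^+ 2 / (2 * b))) *
  hyp1F1 m%:R 1 (Omega * x ^+ 2 / (2 * b * (2 * b * m%:R + Omega))).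

Definition sr_zeta b m Omega z : R :=
  sr_ratio b m Omega ^+ m *
  (sr_beta b * (-1) ^+ z * pochhammer (1 - m%:R) z * sr_c b m Omega ^+ z
     / (z`!%:R) ^+ 2).

(* [Num.sqrt] is 0 on negative reals, so this forces H > 0 almost surely. *)
Definition shadowed_rician_power d (T : measurableType d) (P : probability T R)
    (H : T -> R) b m Omega : Prop :=
  forall B : set R, measurable B ->
    P [set w | B (Num.sqrt (H w))] =
    (\int[lebesgue_measure]_(x in B `&` `]0%R, +oo[)
       (sr_density b m Omega x)%:E)%E.

(* At [a >= 0], the value of E[exp (- a H)] for a shadowed-Rician power H. *)
Definition sr_laplace_sum b m Omega (a : R) : R :=
  \sum_(z < m) sr_zeta b m Omega z * Gamma_fun (z%:R + 1) /
    (sr_beta b - sr_c b m Omega + a) ^+ z.+1.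

End shadowed_rician.

Section interference.
Context {R : realType} d (T : measurableType d).
Implicit Types (Rs rho theta : R).

Definition side_gain (Gs Gu c0 fc : R) : R :=
  Gs * Gu * (c0 / (4 * pi * fc)) ^+ 2.

(* Power received at the typical satellite from the users located in [A], the
   user with label l having fading power [H l]. *)
Definition received_power Rs (alpha G p : R) (Phi : T -> seq (R * R * R))
    (H : nat -> T -> R) (A : set (R * R * R)) (w : T) : R :=
  \sum_(l < size (Phi w) | (Phi w)`_l \in A)
     G * p * H l w * dist3 (Phi w)`_l (typical_sat Rs) `^ (- alpha).

(* Distance from the typical satellite to its nearest visible user; every
   visible user is within [Rmax], which is the value when there is none. *)
Definition nearest_dist Rs rho theta (Phi : T -> seq (R * R * R)) (w : T) : R :=
  \big[Num.min/Rmax Rs rho theta]_(x <- Phi w | x \in visible_cap Rs rho theta)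
     dist3 x (typical_sat Rs).

Definition some_visible Rs rho theta (Phi : T -> seq (R * R * R)) : set T :=
  [set w | (1 <= count_pts Phi (visible_cap Rs rho theta) w)%N].

(* Labels of the satellite users need not be ordered by distance: the nearest
   visible user is excluded because only distances exceeding [r] count. *)
Definition I_up_up Rs Rus Rut theta (alpha sigma2 Gus Gut Pus Put : R)
    (Phi_us Phi_ut : T -> seq (R * R * R)) (Hs Ht : nat -> T -> R)
    (r : R) (w : T) : R :=
  received_power Rs alpha Gus Pus Phi_us Hs
    (visible_cap Rs Rus theta `\` cap Rs Rus r) w +
  received_power Rs alpha Gut Put Phi_ut Ht (visible_cap Rs Rut theta) w +
  sigma2.

(* Index [None] carries both labelled point processes, [inl l] and [inr k] the
   fading powers of the satellite user l and of the terrestrial user k. *)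
Definition network_sigma (Phi_us Phi_ut : T -> seq (R * R * R))
    (Hs Ht : nat -> T -> R) (i : option (nat + nat)) : set (set T) :=
  match i with
  | None => <<s label_events Phi_us `|` label_events Phi_ut >>
  | Some (inl l) => preimage_set_system setT (Hs l) measurable
  | Some (inr k) => preimage_set_system setT (Ht k) measurable
  end.

End interference.

Definition laplace_formula {R : realType} (Rs Rus Rut theta lam_us lam_ut : R)
    (alpha sigma2 Gus Gut Pus Put b : R) (m : nat) (Omega s r : R) : R :=
  expR (- (s * sigma2)
    - 2 * pi * lam_tilde Rs Rus lam_us *
        \int[lebesgue_measure]_(v in `[r, Rmax Rs Rus theta])
          ((1 - sr_laplace_sum b m Omega (s * Gus * Pus * v `^ (- alpha))) * v)
    - 2 * pi * lam_tilde Rs Rut lam_ut *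
        \int[lebesgue_measure]_(u in `[Rmin Rs Rut, Rmax Rs Rut theta])
          ((1 - sr_laplace_sum b m Omega (s * Gut * Put * u `^ (- alpha))) * u)).

(* Main.v *)
Require Import Defs.
From HB Require Import structures.
From mathcomp Require Import all_boot all_order all_algebra.
From mathcomp Require Import all_classical all_reals all_analysis.
From mathcomp Require Import ring lra.
From mathcomp Require Import finmap measurable_realfun.
Import Order.TTheory GRing.Theory Num.Theory.
Import numFieldNormedType.Exports.
Local Open Scope classical_set_scope.
Local Open Scope ring_scope.

Set Implicit Arguments.
Unset Strict Implicit.
Unset Printing Implicit Defensive.

(* Kummer's transformation makes the shadowed-Rician density a finite mixture,
   whose Laplace transform is [sr_laplace_sum].  Since the shell of the sphere
   of radius rho at distances ]u, v] from the satellite has area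
   pi * rho / Rs * (v ^+ 2 - u ^+ 2), the distances form a Poisson process of
   intensity proportional to v dv.  Split the range of distances into n cells
   and replace every distance by one representative of its cell, chosen by the
   mean value theorem so that the contribution of the cell to the exponent is
   exactly the integral over the cell.  The cell counts are then independent
   Poisson variables, and on the event that the nearest user lies in a given
   cell only the counts of the farther cells enter: the formula holds exactly
   for the discretized network.  Dominated convergence for n to infinity gives
   the integrals over {D < t}, a pi-lambda argument those over all Borel sets of
   distances, and continuity of the formula in r the pointwise version. *)

(** The processes are known through the joint law of finitely many counts, and their mutual
    independence is stated for count events, whereas fading is attached to labels and independent of
    the labelled lists. This dictates the order of integration: the fading is averaged first, with
    the lists of cell indices frozen, which leaves a function of the cell counts; only then is the
    law of the counts used. Neither the law of the nearest distance nor the conditional law of the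
    other users is computed: the probability that the nearest user is in a given cell stays symbolic
    on both sides. Since the exponent is exact for every n, no Riemann sum has to be estimated; only
    the integrands have to converge pointwise. Finally, the fading law speaks of [Num.sqrt H], so
    the whole computation uses its square, which is exchanged for [H] at the end by an almost sure
    equality. *)

Section simple_approximation.
Import HBNNSimple.

Lemma integral_weighted_comp_limit d1 (T1 : measurableType d1)
    d2 (S : measurableType d2) (R : realType) (mu : {measure set T1 -> \bar R})
    (Y : T1 -> S) (W : T1 -> R) (f : S -> R)
    (mf : measurable_fun [set: S] (EFin \o f)) :
  measurable_fun [set: T1] Y -> measurable_fun [set: T1] W ->
  (forall x, 0 <= W x) -> (forall y, 0 <= f y) ->
  (\int[mu]_x (W x * f (Y x))%:E = limn (fun n =>
    \int[mu]_x (W x * nnsfun_approx measurableT mf n (Y x))%:E))%E.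
Proof.
move=> mY mW W0 f0.
rewrite -monotone_convergence//.
- apply: eq_integral => x _; apply/esym/cvg_lim => //.
  have /= h := @cvg_nnsfun_approx _ _ _ _ measurableT _ mf
    (fun y _ => f0 y) (Y x) I.
  under eq_fun do rewrite EFinM.
  by rewrite EFinM; apply: cvgeZl.
- move=> n; apply/measurable_EFinP; apply: measurable_funM => //.
  by apply: measurableT_comp => //.
- by move=> n x _; rewrite lee_fin mulr_ge0.
- move=> x _ m n mn; rewrite lee_fin ler_wpM2l//.
  exact/lefP/nd_nnsfun_approx.
Qed.

Lemma nnsfun_sum_indic d (S : measurableType d) (R : realType)
    (f : {nnsfun S >-> R}) : exists (a : seq R) (B : nat -> set S),
  [/\ forall i, 0 <= a`_i, forall i, measurable (B i) &
      forall y, f y = \sum_(i < size a) a`_i * \1_(B i) y].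
Proof.
exists (enum_fset (fset_set (range f))),
  (fun i => f @^-1` [set (enum_fset (fset_set (range f)))`_i]).
split=> [i|i|y]; last exact: fimfunEord.
- have [ilt|ige] := ltnP i (size (enum_fset (fset_set (range f)))).
    have : (enum_fset (fset_set (range f)))`_i \in fset_set (range f).
      exact: mem_nth.
    by rewrite in_fset_set// => /set_mem[y _ <-].
  by rewrite nth_default.
- by rewrite -[X in measurable X]setTI; exact: measurable_funP.
Qed.

Lemma integral_weighted_comp_simple d1 (T1 : measurableType d1)
    d2 (S : measurableType d2) (R : realType) (mu : {measure set T1 -> \bar R})
    (Y : T1 -> S) (W : T1 -> R) (a : seq R) (B : nat -> set S) :
  measurable_fun [set: T1] Y -> measurable_fun [set: T1] W ->
  (forall x, 0 <= W x) -> (forall i, 0 <= a`_i) ->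
  (forall i, measurable (B i)) ->
  (\int[mu]_x (W x * (\sum_(i < size a) a`_i * \1_(B i) (Y x)))%:E =
   \sum_(i < size a) (a`_i)%:E * \int[mu]_(x in Y @^-1` B i) (W x)%:E)%E.
Proof.
move=> mY mW W0 a0 mB.
have mYB i : measurable (Y @^-1` B i).
  by rewrite -[X in measurable X]setTI; exact: mY.
have mg i : measurable_fun [set: T1] (fun x => (W x * \1_(B i) (Y x))%:E).
  apply/measurable_EFinP; apply: measurable_funM => //.
  exact: (measurable_indic (mYB i)).
transitivity (\int[mu]_x (\sum_(i < size a) (a`_i)%:E *
    (W x * \1_(B i) (Y x))%:E))%E.
  apply: eq_integral => x _; rewrite mulr_sumr -sumEFin.
  by apply: eq_bigr => i _; rewrite -EFinM mulrCA.
rewrite ge0_integral_sum//; last 2 first.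
- by move=> i; exact: measurable_funeM.
- by move=> i x _; rewrite -EFinM lee_fin !mulr_ge0.
apply: eq_bigr => i _.
rewrite ge0_integralZl//; last 2 first.
- by move=> x _; rewrite lee_fin mulr_ge0.
- by rewrite lee_fin.
congr (_ * _)%E; rewrite [RHS]integral_mkcond; apply: eq_integral => x _.
rewrite patchE indicE (_ : (x \in _) = (Y x \in B i)); last first.
  by apply/idP/idP => /set_mem ?; exact/mem_set.
by case: ifPn => _; rewrite ?mulr1 ?mulr0.
Qed.

(** Two different measure spaces are allowed because of the two uses: the law of [Num.sqrt (H w)] is
    compared with a density on the line, and, with both spaces and maps equal, a factorization is
    extended from indicators to bounded functions. *)
Lemma integral_weighted_comp d1 (T1 : measurableType d1)
    d2 (T2 : measurableType d2) d3 (S : measurableType d3) (R : realType)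
    (mu1 : {measure set T1 -> \bar R}) (mu2 : {measure set T2 -> \bar R})
    (Y1 : T1 -> S) (Y2 : T2 -> S) (W1 : T1 -> R) (W2 : T2 -> R) (f : S -> R) :
  measurable_fun [set: T1] Y1 -> measurable_fun [set: T2] Y2 ->
  measurable_fun [set: T1] W1 -> measurable_fun [set: T2] W2 ->
  (forall x, 0 <= W1 x) -> (forall x, 0 <= W2 x) ->
  measurable_fun [set: S] f -> (forall y, 0 <= f y) ->
  (forall B, measurable B -> \int[mu1]_(x in Y1 @^-1` B) (W1 x)%:E =
                             \int[mu2]_(x in Y2 @^-1` B) (W2 x)%:E)%E ->
  (\int[mu1]_x (W1 x * f (Y1 x))%:E = \int[mu2]_x (W2 x * f (Y2 x))%:E)%E.
Proof.
move=> mY1 mY2 mW1 mW2 W10 W20 mf f0 E.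
have mf' : measurable_fun [set: S] (EFin \o f) by exact/measurable_EFinP.
rewrite (integral_weighted_comp_limit mu1 mf' mY1 mW1)//.
rewrite (integral_weighted_comp_limit mu2 mf' mY2 mW2)//.
congr (limn _); apply/funext => n.
have [a [B [a0 mB fE]]] := nnsfun_sum_indic (nnsfun_approx measurableT mf' n).
under eq_integral do rewrite fE.
under [RHS]eq_integral do rewrite fE.
rewrite !integral_weighted_comp_simple//.
by apply: eq_bigr => i _; rewrite E.
Qed.
End simple_approximation.

Lemma eq_integral_fibres d (T : measurableType d) (R : realType)
    (mu : {measure set T -> \bar R}) (K : countType) (c : T -> K)
    (f g : T -> \bar R) :
  measurable_fun [set: T] f -> measurable_fun [set: T] g ->
  (forall x, 0 <= f x)%E -> (forall x, 0 <= g x)%E ->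
  (forall k, measurable (c @^-1` [set k])) ->
  (forall k, \int[mu]_(x in c @^-1` [set k]) f x =
             \int[mu]_(x in c @^-1` [set k]) g x)%E ->
  (\int[mu]_x f x = \int[mu]_x g x)%E.
Proof.
move=> mf mg f0 g0 mc E.
pose F n := [set x | choice.pickle (c x) = n].
have FE n : F n = set0 \/ exists k, F n = c @^-1` [set k].
  have [->|/set0P[x <-]] := eqVneq (F n) set0; first by left.
  right; exists (c x); apply/seteqP; split=> y /= [].
    by move/(pcan_inj choice.pickleK).
  by rewrite /F /= => ->.
have mF n : measurable (F n) by case: (FE n) => [->|[k ->]].
have UF : \bigcup_n F n = setT.
  by apply/seteqP; split=> // x _; exists (choice.pickle (c x)).
have tF : trivIset setT F.
  apply/trivIsetP => i j _ _ /eqP ij; apply/seteqP; split=> // x [/= xi xj].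
  by apply: ij; rewrite -xi -xj.
rewrite -UF !ge0_integral_bigcup//; rewrite ?UF//.
apply: eq_eseriesr => n _; case: (FE n) => [->|[k ->]//].
by rewrite !integral_set0.
Qed.

(** * Extension of product formulas for expectations from indicators to functions *)

Section product_formula.
Local Open Scope ereal_scope.
Context d (T : measurableType d) (R : realType) (P : probability T R).
Local Notation unitfun f :=
  (measurable_fun [set: T] (f : T -> R) /\ forall w, (0 <= f w <= 1)%R).
Implicit Types (U V : set (T -> R)) (W : T -> R).

(** The weight [W] stands for the rest of a product and [c] for its expectation: factorization
    against the rest passes from the test functions [U] to the test functions [V]. *)
Definition product_extension U V := forall W (c : R),
  unitfun W -> (0 <= c)%R ->
  (forall u, U u -> \int[P]_w (W w * u w)%:E = c%:E * \int[P]_w (u w)%:E) ->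
  (forall v, V v -> \int[P]_w (W w * v w)%:E = c%:E * \int[P]_w (v w)%:E).

Lemma unitfun_integral W : unitfun W ->
  exists2 c : R, (0 <= c)%R & \int[P]_w (W w)%:E = c%:E.
Proof.
move=> [mW W01].
have I0 : 0 <= \int[P]_w (W w)%:E.
  by apply: integral_ge0 => w _; rewrite lee_fin; case/andP: (W01 w).
have I1 : \int[P]_w (W w)%:E <= 1.
  rewrite -(probability_setT P) -[leRHS]mul1e -(integral_cst P measurableT 1).
  apply: ge0_le_integral => //.
  - by move=> w _; rewrite lee_fin; case/andP: (W01 w).
  - exact/measurable_EFinP.
  - by move=> w _; rewrite lee_fin; case/andP: (W01 w).
exists (fine (\int[P]_w (W w)%:E)); first exact: fine_ge0.
by rewrite fineK// ge0_fin_numE// (le_lt_trans I1)// ltry.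
Qed.

(** Factors are exchanged one at a time. The current one is extended while the others, still in [U],
    are multiplied into the weight; afterwards it stays in the weight and its integral in the
    constant, which is why the induction generalizes [W] and [c]. *)
Lemma product_formula_extension (I : eqType) (J : seq I)
    (U V : I -> set (T -> R)) W (c : R) :
  uniq J -> unitfun W -> (0 <= c)%R ->
  (forall i, i \in J -> product_extension (U i) (V i)) ->
  (forall i u, i \in J -> U i u -> unitfun u) ->
  (forall i v, i \in J -> V i v -> unitfun v) ->
  (forall u, (forall i, i \in J -> U i (u i)) ->
    \int[P]_w (W w * \prod_(i <- J) u i w)%:E =
    c%:E * \prod_(i <- J) \int[P]_w (u i w)%:E) ->
  (forall v, (forall i, i \in J -> V i (v i)) ->
    \int[P]_w (W w * \prod_(i <- J) v i w)%:E =
    c%:E * \prod_(i <- J) \int[P]_w (v i w)%:E).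
Proof.
elim: J W c => [W c _ _ _ _ _ _ E v _|j J IH W c /= /andP[jJ uJ] uW c0 ext UU VU E v Vv].
  by have := E v; rewrite !big_nil; apply.
have mj : j \in j :: J by rewrite mem_head.
have mJ i : i \in J -> i \in j :: J by rewrite inE orbC => ->.
have [vj vj0 vjE] := unitfun_integral (VU j _ mj (Vv j mj)).
rewrite big_cons vjE muleA -EFinM.
transitivity (\int[P]_w ((W w * v j w) * \prod_(i <- J) v i w)%:E).
  by apply: eq_integral => w _; rewrite big_cons mulrA.
apply: IH => //.
- have [mv v01] := VU j _ mj (Vv j mj); have [mW W01] := uW; split.
    exact: measurable_funM.
  move=> w; have /andP[? ?] := v01 w; have /andP[? ?] := W01 w.
  by rewrite mulr_ge0// mulr_ile1.
- exact: mulr_ge0.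
- by move=> i iJ; apply: ext; exact: mJ.
- by move=> i u iJ; apply: UU; exact: mJ.
- by move=> i u iJ; apply: VU; exact: mJ.
- move=> u Uu.
  have uu i : i \in J -> unitfun (u i) by move=> iJ; apply: (UU i); [exact: mJ|exact: Uu].
  have mprod : unitfun (fun w => \prod_(i <- J) u i w)%R.
    clear -uu; elim: J uu => [_|i J IH uu].
      under eq_fun do rewrite big_nil; split; first exact: measurable_cst.
      by move=> w; rewrite big_nil ler01 lexx.
    have [mi ui01] := uu i (mem_head _ _).
    have [|mJ uJ01] := IH; first by move=> k kJ; apply: uu; rewrite inE kJ orbT.
    under eq_fun do rewrite big_cons; split; first exact: measurable_funM.
    move=> w; have /andP[? ?] := ui01 w; have /andP[? ?] := uJ01 w.
    by rewrite big_cons mulr_ge0// mulr_ile1.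
  have cprod : exists2 r : R, (0 <= r)%R &
      \prod_(i <- J) \int[P]_w (u i w)%:E = r%:E.
    clear -uu; elim: J uu => [_|i J IH uu].
      by exists 1%R => //; rewrite big_nil.
    have [r1 r10 r1E] := unitfun_integral (uu i (mem_head _ _)).
    have [|r r0 rE] := IH; first by move=> k kJ; apply: uu; rewrite inE kJ orbT.
    by exists (r1 * r)%R; [exact: mulr_ge0|rewrite big_cons r1E rE EFinM].
  have [r r0 rE] := cprod.
  transitivity (\int[P]_w ((W w * \prod_(i <- J) u i w) * v j w)%:E).
    by apply: eq_integral => w _; rewrite mulrAC.
  rewrite rE -EFinM mulrAC EFinM -vjE.
  apply: (ext j mj) (Vv j mj).
  + have [mp p01] := mprod; have [mW W01] := uW; split.
      exact: measurable_funM.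
    move=> w; have /andP[? ?] := p01 w; have /andP[? ?] := W01 w.
    by rewrite mulr_ge0// mulr_ile1.
  + exact: mulr_ge0.
  + move=> uj Uuj.
    (* The product hypothesis is used for the family equal to [uj] at [j] and to [u] on [J]; [uniq]
       guarantees that [j] does not recur in [J]. *)
    have /= := E (fun i => if i == j then uj else u i).
    rewrite !big_cons eqxx.
    have nj i : i \in J -> (i == j) = false.
      by move=> iJ; apply/negbTE; apply: contra jJ => /eqP <-.
    rewrite [X in _ * X](_ : _ = \int[P]_w (uj w)%:E * r%:E); last first.
      rewrite -rE; congr (_ * _); apply: eq_big_seq => i /nj ->.
      by [].
    move=> E'; rewrite -[LHS](_ : \int[P]_w (W w * \prod_(i <- j :: J)
      (if i == j then uj else u i) w)%:E = _); last first.
      apply: eq_integral => w _; rewrite big_cons eqxx -mulrA [in RHS](mulrC _ (uj w)).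
      congr (_ * (_ * _))%:E; apply: eq_big_seq => i /nj -> //.
    rewrite E' ?EFinM; first by rewrite -muleA (muleC r%:E).
    move=> i; rewrite inE => /predU1P[->|iJ]; first by rewrite eqxx.
    by rewrite nj//; exact: Uu.
- by move=> i iJ; apply: Vv; exact: mJ.
Qed.

Lemma integral_indicM (W : T -> R) (B : set T) :
  \int[P]_w (W w * \1_B w)%:E = \int[P]_(w in B) (W w)%:E.
Proof.
rewrite [RHS]integral_mkcond; apply: eq_integral => w _.
by rewrite patchE indicE; case: ifPn => _; rewrite ?mulr1 ?mulr0.
Qed.

(** Both sides are weighted integrals over the same [Y], with weights [W] and the constant [c]; the
    assumption on indicators says that the two weighted image measures agree. *)
Lemma product_extension_measurable d' (S : measurableType d') (Y : T -> S) :
  measurable_fun [set: T] Y ->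
  product_extension
    [set u | exists2 B, measurable B & u = \1_(Y @^-1` B)]
    [set v | exists2 f : S -> R, (measurable_fun [set: S] f /\ forall y, (0 <= f y <= 1)%R) & v = f \o Y].
Proof.
move=> mY W c [mW W01] c0 E v [f [mf f01] ->].
transitivity (\int[P]_w (c * f (Y w))%:E); last first.
  under eq_integral do rewrite EFinM.
  rewrite ge0_integralZl//.
  - exact/measurable_EFinP/(measurableT_comp mf).
  - by move=> w _; rewrite lee_fin; case/andP: (f01 (Y w)).
apply: (@integral_weighted_comp _ _ _ _ _ _ _ _ _ Y Y W (cst c)) => //.
- by move=> w; case/andP: (W01 w).
- by move=> y; case/andP: (f01 y).
- move=> B mB.
  have := E _ (ex_intro2 _ _ B mB erefl).
  rewrite integral_indicM => ->.
  have mYB : measurable (Y @^-1` B).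
    by rewrite -[X in measurable X]setTI; exact: mY.
  rewrite integral_indic// setIT.
  exact: (esym (integral_cst P mYB c%:E)).
Qed.

Lemma measurable_fun_fibres (K : countType) (Y : T -> K) d' (S : measurableType d')
    (f : K -> S) :
  (forall k, measurable (Y @^-1` [set k])) -> measurable_fun [set: T] (f \o Y).
Proof.
move=> mY _ B mB; rewrite setTI.
rewrite (_ : _ @^-1` _ =
    \bigcup_k (Y @^-1` [set k] `&` [set _ | B (f k)])).
  apply: countable_bigcupT_measurable => // k; apply: measurableI => //.
  by have [Bk|nBk] := pselect (B (f k));
    [rewrite (_ : [set _ | _] = setT)|rewrite (_ : [set _ | _] = set0)]; rewrite ?measurableT//;
    apply/seteqP; split.
by apply/seteqP; split=> [w /= Bw|w [k _ [/= -> ]]//]; exists (Y w).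
Qed.

(** Countability replaces a sigma-algebra on [K]: every function of [Y] is constant on countably
    many measurable level sets, so [f] is an arbitrary bounded function. *)
Lemma product_extension_countable (K : countType) (Y : T -> K) :
  (forall k, measurable (Y @^-1` [set k])) ->
  product_extension
    [set u | exists k, u = \1_(Y @^-1` [set k])]
    [set v | exists2 f : K -> R, (forall k, 0 <= f k <= 1)%R & v = f \o Y].
Proof.
move=> mY W c [mW W01] c0 E v [f f01 ->].
have mf : measurable_fun [set: T] (f \o Y) by exact: measurable_fun_fibres.
have W0 w : (0 <= W w)%R by case/andP: (W01 w).
have f0 k : (0 <= f k)%R by case/andP: (f01 k).
transitivity (\int[P]_w (c * f (Y w))%:E); last first.
  under eq_integral do rewrite EFinM.
  rewrite ge0_integralZl//; first exact/measurable_EFinP.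
  by move=> w _; rewrite lee_fin.
apply: (eq_integral_fibres (c := Y)) => //.
- exact/measurable_EFinP/measurable_funM.
- exact/measurable_EFinP/measurable_funM.
- by move=> w; rewrite lee_fin; apply: mulr_ge0; [exact: W0|exact: f0].
- by move=> w; rewrite lee_fin mulr_ge0.
- move=> k.
  transitivity (\int[P]_(w in Y @^-1` [set k]) ((f k)%:E * (W w)%:E)).
    by apply: eq_integral => w /set_mem /= ->; rewrite EFinM muleC.
  rewrite ge0_integralZl//; last 3 first.
  - by apply/measurable_EFinP; apply: measurable_funTS.
  - by move=> w _; rewrite lee_fin.
  - by rewrite lee_fin.
  transitivity (\int[P]_(w in Y @^-1` [set k]) (c * f k)%:E); last first.
    by apply: eq_integral => w /set_mem /= ->.
  rewrite (integral_cst P (mY k) (c * f k)%:E) -integral_indicM (E _ (ex_intro _ k erefl)).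
  by rewrite integral_indic// setIT EFinM muleA (muleC c%:E).
Qed.
End product_formula.

(** * Kummer's transformation for a positive integer first parameter *)

Section kummer.
Context {R : realType}.
Implicit Types (x : R) (m n k z : nat).

Lemma pochhammer1 n : pochhammer (1 : R) n = n`!%:R.
Proof.
rewrite /pochhammer; elim: n => [|n IH]; first by rewrite big_ord0.
by rewrite big_ord_recr/= IH factS natrM mulrC -natr1 addrC.
Qed.

Lemma pochhammer_nat m n :
  pochhammer (m.+1%:R : R) n = n`!%:R * 'C(m + n, n)%:R.
Proof.
have : pochhammer (m.+1%:R : R) n * m`!%:R = (m + n)`!%:R.
  rewrite /pochhammer; elim: n => [|n IH]; first by rewrite big_ord0 addn0 mul1r.
  by rewrite big_ord_recr/= mulrAC IH addnS factS natrM mulrC -natrD addSn.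
have /= := bin_fact (leq_addl m n); rewrite addnK => <-.
rewrite !natrM => E; apply: (@mulIf _ m`!%:R).
  by rewrite pnatr_eq0 -lt0n fact_gt0.
by rewrite E [LHS]mulrA (mulrC _ n`!%:R).
Qed.

(** The signs turn the rising factorial of [- m] into the falling factorial m (m - 1) ... (m - z +
    1), which also vanishes for z > m. *)
Lemma pochhammer_opp_nat m z :
  (-1) ^+ z * pochhammer (- m%:R : R) z = z`!%:R * 'C(m, z)%:R.
Proof.
rewrite mulrC -[RHS]mulrC -natrM bin_ffact /pochhammer.
elim: z => [|z IH]; first by rewrite big_ord0 ffactn0 mul1r.
rewrite big_ord_recr/= exprSr mulrACA IH ffactnSr natrM.
have [zm|mz] := leqP z m; last by rewrite ffact_small// !mul0r.
by rewrite natrB// mulrN1 opprD opprK.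
Qed.

Lemma sum_ord_trunc n1 n2 (F : nat -> nat) : (n1 <= n2)%N ->
  (forall k, (n1 <= k)%N -> F k = 0%N) ->
  (\sum_(k < n2) F k = \sum_(k < n1) F k)%N.
Proof.
move=> n12 F0; rewrite [RHS](big_ord_widen _ _ n12) big_mkcond/= [RHS]big_mkcond.
by apply: eq_bigr => k _; case: ltnP => // /F0.
Qed.

(** Vandermonde's identity with C(n, n - k) read as C(n, k). The terms vanish beyond min(m, n), so
    the range of summation can be changed from [n.+1] to [m.+1]. *)
Lemma sum_bin_vandermonde m n :
  'C(m + n, n) = (\sum_(k < m.+1) 'C(m, k) * 'C(n, k))%N.
Proof.
rewrite -binomial.Vandermonde.
transitivity (\sum_(k < n.+1) 'C(m, k) * 'C(n, k))%N.
  by apply: eq_bigr => k _; rewrite bin_sub// -ltnS.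
pose F k := ('C(m, k) * 'C(n, k))%N.
rewrite -(@sum_ord_trunc n.+1 (maxn m n).+1 F) ?ltnS ?leq_maxr//.
  rewrite -(@sum_ord_trunc m.+1 (maxn m n).+1 F) ?ltnS ?leq_maxl//.
  by move=> k mk; rewrite /F bin_small// mul0n.
by move=> k nk; rewrite /F (bin_small nk) muln0.
Qed.

Lemma cvg_sumr (I T : Type) (F : set_system T) (r : seq I) (Q : pred I)
    (f : I -> T -> R) (l : I -> R) : Filter F ->
  (forall i, Q i -> f i x @[x --> F] --> l i) ->
  \sum_(i <- r | Q i) f i x @[x --> F] --> \sum_(i <- r | Q i) l i.
Proof. by move=> FF; apply: cvg_big; exact: add_continuous. Qed.

Lemma cvg_series_delayed (u : R ^nat) (l : R) k : series u @ \oo --> l ->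
  series (fun n => if (n < k)%N then 0 else u (n - k)%N) @ \oo --> l.
Proof.
move=> ul; rewrite -(cvg_shiftn k).
rewrite (_ : (fun n => _) = series u)//; apply/funext => n.
rewrite /series/= addnC (big_cat_nat (n := k))//= ?leq_addr//.
rewrite big_nat big1 ?add0r; last by move=> i /andP[_ ->].
rewrite -{1}[k]add0n [(k + n)%N]addnC big_addn addnK.
by apply: eq_bigr => i _; rewrite ltnNge leq_addl/= addnK.
Qed.

(* The finite sum is [1F1 (- m; 1; - x)]. *)
Lemma hyp1F1_kummer m x : hyp1F1 m.+1%:R 1 x =
  expR x * \sum_(k < m.+1) 'C(m, k)%:R * x ^+ k / k`!%:R.
Proof.
have e k : series (fun n => if (n < k)%N then 0 else exp_coeff x (n - k)%N) @ \oo
    --> expR x.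
  by apply: cvg_series_delayed; exact: is_cvg_series_exp_coeff.
rewrite /hyp1F1; apply/cvg_lim => //.
(* The coefficient of x^n is C(m + n, n) / n!. Vandermonde expands it, and C(n, k) / n! = 1 / (k! (n
   - k)!) exhibits m + 1 exponential series, the k-th one delayed by k. *)
rewrite [X in series X](_ : _ = fun n => \sum_(k < m.+1)
    ('C(m, k)%:R * x ^+ k / k`!%:R *
     if (n < k)%N then 0 else exp_coeff x (n - k)%N)); last first.
  apply/funext => n.
  rewrite pochhammer1 pochhammer_nat (mulrC n`!%:R) mulfK; last first.
    by rewrite pnatr_eq0 -lt0n fact_gt0.
  rewrite sum_bin_vandermonde natr_sum mulr_suml mulr_suml.
  apply: eq_bigr => k _; rewrite natrM; case: ltnP => nk.
    by rewrite (bin_small nk) !(mulr0, mul0r).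
  rewrite /exp_coeff /= (_ : x ^+ n = x ^+ k * x ^+ (n - k)); last first.
    by rewrite -exprD subnKC.
  rewrite -(bin_fact nk).
  rewrite !natrM; have nz j : (j`!%:R : R) != 0.
    by rewrite pnatr_eq0 -lt0n fact_gt0.
  have bz : 'C(n, k)%:R != 0 :> R by rewrite pnatr_eq0 -lt0n bin_gt0.
  by field; rewrite !nz bz.
rewrite mulr_sumr.
rewrite [X in X @ _](_ : _ = fun N => \sum_(k < m.+1) 'C(m, k)%:R * x ^+ k / k`!%:R *
   series (fun n => if (n < k)%N then 0 else exp_coeff x (n - k)%N) N); last first.
  apply/funext => N; rewrite /series/= exchange_big/=.
  by apply: eq_bigr => k _; rewrite mulr_sumr.
rewrite [X in _ --> X](_ : _ = \sum_(k < m.+1) 'C(m, k)%:R * x ^+ k / k`!%:R * expR x); last first.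
  by apply: eq_bigr => k _; rewrite mulrC.
apply: cvg_sumr => k _.
by apply: cvgMl_tmp; exact: e.
Qed.

End kummer.

(** * Incomplete gamma antiderivatives and the integrals they give *)

Section gamma_integrals.
Context {R : realType}.
Implicit Types (u x dl : R) (k : nat).

Lemma integral_is_derive_y (f F : R -> R) (a l : R) :
  (forall x, a <= x -> 0 <= f x) -> continuous f ->
  (forall x, is_derive x 1 F (f x)) -> F x @[x --> +oo] --> l ->
  (\int[lebesgue_measure]_(x in `]a, +oo[) (f x)%:E = (l - F a)%:E)%E.
Proof.
move=> f0 cf dF Fl.
have cF : continuous F.
  move=> x; apply/differentiable_continuous/derivable1_diffP.
  by have [] := dF x.
rewrite integral_itv_obnd_cbnd; last first.
  by apply: measurable_funTS; apply/measurable_EFinP; exact: continuous_measurable_fun.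
rewrite EFinB; apply: ge0_continuous_FTC2y => //.
- exact: continuous_subspaceT.
- exact/cvg_at_right_filter/cF.
- by move=> x _; rewrite derive1E; have [_ ->] := dF x.
Qed.

Definition exp_trunc k u : R := \sum_(j < k.+1) u ^+ j / j`!%:R.

Lemma is_derive_exp_trunc k u :
  is_derive u 1 (fun v : R => - (expR (- v) * exp_trunc k v))
    (expR (- u) * (u ^+ k / k`!%:R)).
Proof.
elim: k => [|k IH].
  rewrite (_ : (fun _ => _) = \- (expR \o -%R)); last first.
    by apply/funext => v; rewrite /exp_trunc big_ord1 expr0 fact0 divr1 mulr1.
  apply: is_derive_eq.
  by rewrite expr0 fact0 divr1 mulr1 mulrN1 opprK.
rewrite (_ : (fun _ => _) = (fun v : R => - (expR (- v) * exp_trunc k v)) -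
   ((k.+1`!%:R)^-1 \*: ((expR \o -%R) * (id ^+ k.+1)))); last first.
  apply/funext => v; rewrite /exp_trunc big_ord_recr/= mulrDr opprD; congr (_ - _).
  rewrite /= !fctE/=.
  by rewrite mulrA mulrC.
apply: is_derive_eq.
rewrite /= !fctE factS natrM /GRing.scale/= .
have k1 : k.+1%:R != 0 :> R by rewrite pnatr_eq0.
have kf : k`!%:R != 0 :> R by rewrite pnatr_eq0 -lt0n fact_gt0.
rewrite exprS. field.
by rewrite kf addrC natr1 k1.
Qed.

Lemma cvg_expRN_exprn k : expR (- u) * u ^+ k @[u --> +oo] --> (0 : R).
Proof.
have k1 : 0 < (k.+1)`!%:R :> R by rewrite ltr0n fact_gt0.
apply: (@squeeze_cvgr _ _ _ _ (cst 0) (fun u => (k.+1)`!%:R * u^-1)).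
- near=> u; have u0 : 0 < u by near: u; exact: nbhs_pinfty_gt.
  rewrite mulr_ge0 ?expR_ge0 ?exprn_ge0 ?(ltW u0)//=.
  rewrite expRN mulrC ler_pdivrMr ?expR_gt0// mulrAC ler_pdivlMr// -exprSr.
  rewrite -ler_pdivrMl// mulrC.
  by apply: le_trans (expR_ge1Dxn k (ltW u0)); rewrite lerDr.
- exact: cvg_cst.
- rewrite -[X in _ --> X](mulr0 (k.+1)`!%:R); apply: cvgMl_tmp.
  apply/gtr0_cvgV0; last by apply: cvg_id.
  by near=> u; near: u; exact: nbhs_pinfty_gt.
Unshelve. all: by end_near. Qed.

Lemma cvg_exp_trunc k : - (expR (- u) * exp_trunc k u) @[u --> +oo] --> (0 : R).
Proof.
have S : \sum_(j < k.+1) (expR (- u) * u ^+ j / j`!%:R) @[u --> +oo] -->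
    \sum_(j < k.+1) (0 / j`!%:R : R).
  by apply: cvg_sumr => j _; apply: cvgMr_tmp; exact: cvg_expRN_exprn.
rewrite -[X in _ --> X]oppr0; apply: cvgN.
rewrite big1 in S; last by move=> j _; rewrite mul0r.
apply: cvg_trans S; apply: near_eq_cvg; near=> u.
by rewrite /exp_trunc mulr_sumr; apply: eq_bigr => j _; rewrite mulrA.
Unshelve. all: by end_near. Qed.

Lemma exp_trunc0 k : exp_trunc k 0 = 1 :> R.
Proof.
rewrite /exp_trunc big_ord_recl/= expr0 fact0 divr1 big1 ?addr0// => i _.
by rewrite expr0n/= mul0r.
Qed.

Lemma Gamma_fun_nat k : Gamma_fun (k%:R + 1) = k`!%:R :> R.
Proof.
rewrite /Gamma_fun /Rintegral.
transitivity (fine (\int[lebesgue_measure]_(t in `]0%R, +oo[)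
    (k`!%:R * (expR (- t) * (t ^+ k / k`!%:R)) : R)%:E)%E).
  congr fine; apply: eq_integral => t /set_mem/=; rewrite in_itv/= andbT => t0.
  rewrite addrK powR_mulrn ?(ltW t0)//.
  by congr EFin; field; rewrite pnatr_eq0 -lt0n fact_gt0.
pose F (v : R) := k`!%:R * - (expR (- v) * exp_trunc k v).
transitivity (0 - F 0); last first.
  by rewrite /F exp_trunc0 oppr0 expR0 mulr1 sub0r mulrN1 opprK.
rewrite -[RHS]/(fine (0 - F 0)%:E); congr fine; apply: integral_is_derive_y.
- by move=> x x0; rewrite !mulr_ge0 ?expR_ge0 ?exprn_ge0.
- move=> x; apply: cvgM; first exact: cvg_cst.
  apply: cvgM; first by apply: continuous_comp; [exact: opp_continuous|exact: continuous_expR].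
  by apply: cvgM; [exact: exprn_continuous|exact: cvg_cst].
- move=> x; exact: (is_deriveZ k`!%:R (is_derive_exp_trunc k x)).
- rewrite -[X in _ --> X](mulr0 k`!%:R); apply: cvgMl_tmp; exact: cvg_exp_trunc.
Qed.

(** The substitution v = dl x^2 reduces this to an Erlang density; it is carried out on the
    antiderivative, by the chain rule. These are the components of the shadowed-Rician mixture. *)
Lemma integral_rayleigh_moment k dl : 0 < dl ->
  (\int[lebesgue_measure]_(x in `]0%R, +oo[)
     (expR (- (dl * x ^+ 2)) * ((dl * x ^+ 2) ^+ k / k`!%:R) * (dl * (2 * x)))%:E
   = 1%:E)%E.
Proof.
move=> dl0.
have dsq (x : R) : is_derive x 1 (fun y => dl * y ^+ 2) (dl * (2 * x)).
  apply: (is_deriveZ dl).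
  by apply: is_derive_eq; rewrite /GRing.scale/= mulr1 mulr2n mulrDl mul1r.
have cf : continuous (fun x => dl * x ^+ 2).
  move=> x; apply/differentiable_continuous/derivable1_diffP.
  by have [] := dsq x.
pose F := (fun v => - (expR (- v) * exp_trunc k v)) \o (fun x => dl * x ^+ 2).
transitivity ((0 - F 0)%:E); last first.
  by rewrite /F/= expr0n/= mulr0 exp_trunc0 oppr0 expR0 mulr1 sub0r opprK.
apply: integral_is_derive_y.
- move=> x x0; rewrite !mulr_ge0 ?expR_ge0 ?exprn_ge0 ?(ltW dl0)//.
  by rewrite mulr_ge0 ?exprn_ge0 ?(ltW dl0)//.
- move=> x; apply: cvgM.
    apply: cvgM.
      apply: (@continuous_comp _ _ _ (fun x => - (dl * x ^+ 2)) expR).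
        by apply: cvgN; exact: cf.
      exact: continuous_expR.
    apply: cvgM; last exact: cvg_cst.
    apply: (@continuous_comp _ _ _ (fun x => dl * x ^+ 2) (fun v => v ^+ k)).
      exact: cf.
    exact: exprn_continuous.
  apply: (@cvgMl_tmp _ _ _ _ (fun x : R => 2 * x)).
  by apply: (@cvgMl_tmp _ _ _ _ id); exact: cvg_id.
- move=> x; exact: (@is_derive1_comp _ _ _ _ _ _ (is_derive_exp_trunc k _) (dsq x)).
- suff G : dl * x ^+ 2 @[x --> +oo] --> +oo by exact: cvg_comp G (cvg_exp_trunc k).
  apply/cvgryPge => A; near=> x.
  have x1 : 1 <= x by near: x; exact: nbhs_pinfty_ge.
  apply: (@le_trans _ _ (dl * x)).
    by rewrite -ler_pdivrMl//; near: x; exact: nbhs_pinfty_ge.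
  rewrite ler_pM2l// expr2 ler_peMr// (le_trans ler01 x1)//.
Unshelve. all: by end_near. Qed.
End gamma_integrals.

(** * Laplace transform of a shadowed-Rician power *)

Section shadowed_rician_laplace.
Context {R : realType} (b Omega : R) (m : nat).
Hypotheses (b0 : 0 < b) (Omega0 : 0 < Omega) (m0 : (0 < m)%N).
Implicit Types (a x : R) (k : nat).

Let rate a := sr_beta b - sr_c b m Omega + a.

Let den_gt0 : 0 < 2 * b * m%:R + Omega.
Proof. by rewrite addr_gt0// !mulr_gt0// ltr0n. Qed.

Lemma sr_rate_gt0 a : 0 <= a -> 0 < sr_beta b - sr_c b m Omega + a.
Proof.
move=> a0; apply: ltr_pwDl => //; rewrite /sr_beta /sr_c.
rewrite (_ : _ - _ = m%:R / (2 * b * m%:R + Omega)).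
  by rewrite divr_gt0// ltr0n.
by field; rewrite !gt_eqF.
Qed.

(** Weight of the k-th component of exp(- a x^2) times the density, each component having integral
    1. The binomial comes from Kummer's finite sum and the power of the rate from normalizing the
    component. *)
Definition sr_weight a k : R :=
  sr_ratio b m Omega ^+ m * 'C(m.-1, k)%:R * sr_c b m Omega ^+ k / (2 * b) /
  (sr_beta b - sr_c b m Omega + a) ^+ k.+1.

(** The alternating signs in [sr_zeta] are only apparent: (-1)^k times the rising factorial of 1 - m
    is k! C(m - 1, k). *)
Lemma sr_laplace_sumE a : sr_laplace_sum b m Omega a = \sum_(k < m) sr_weight a k.
Proof.
apply: eq_bigr => k _; rewrite /sr_weight /sr_zeta Gamma_fun_nat.
have -> : 1 - m%:R = - (m.-1)%:R :> R.
  by rewrite -[in LHS](prednK m0) -natr1 opprD addrCA subrr addr0.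
have kf : k`!%:R != 0 :> R by rewrite pnatr_eq0 -lt0n fact_gt0.
congr (_ / _); rewrite -!mulrA; congr (_ * _); rewrite /sr_beta.
transitivity (((-1) ^+ k * pochhammer (- (m.-1)%:R) k) *
    (sr_c b m Omega ^+ k / (2 * b) / k`!%:R)).
  by field; rewrite kf gt_eqF.
by rewrite pochhammer_opp_nat; field; rewrite kf gt_eqF.
Qed.

(** The exponential split off by Kummer's transformation merges with the Gaussian factor and with
    exp(- a x^2) into a single exponential of rate beta - c + a. *)
Lemma sr_density_mixture a x : 0 <= a ->
  expR (- (a * x ^+ 2)) * sr_density b m Omega x =
  \sum_(k < m) sr_weight a k *
    (expR (- (rate a * x ^+ 2)) * ((rate a * x ^+ 2) ^+ k / k`!%:R) *
     (rate a * (2 * x))).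
Proof.
move=> a0; have dl0 := sr_rate_gt0 a0; rewrite -/(rate a) in dl0.
rewrite /sr_density -[in hyp1F1 _](prednK m0) hyp1F1_kummer prednK//.
have -> : expR (- (rate a * x ^+ 2)) =
    expR (- (a * x ^+ 2)) * expR (- (x ^+ 2 / (2 * b))) *
    expR (Omega * x ^+ 2 / (2 * b * (2 * b * m%:R + Omega))).
  rewrite -!expRD; congr expR; rewrite /rate /sr_beta /sr_c.
  by field; rewrite !gt_eqF.
rewrite !mulr_sumr; apply: eq_bigr => k _; rewrite /sr_weight -/(rate a).
have kf : k`!%:R != 0 :> R by rewrite pnatr_eq0 -lt0n fact_gt0.
have -> : Omega * x ^+ 2 / (2 * b * (2 * b * m%:R + Omega)) =
    sr_c b m Omega * x ^+ 2 by rewrite /sr_c; field; rewrite !gt_eqF.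
rewrite !exprMn [rate a ^+ k.+1]exprS.
by field; rewrite kf expf_neq0 ?gt_eqF.
Qed.

Lemma sr_weight_ge0 a k : 0 <= a -> 0 <= sr_weight a k.
Proof.
move=> a0; have dl0 := sr_rate_gt0 a0.
rewrite /sr_weight !mulr_ge0 ?exprn_ge0 ?invr_ge0 ?exprn_ge0 ?(ltW dl0)//.
- by rewrite /sr_ratio divr_ge0 ?(ltW den_gt0)// !mulr_ge0// ltW.
- by rewrite /sr_c divr_ge0 ?(ltW Omega0)// !mulr_ge0 ?(ltW den_gt0)// ltW.
- by rewrite mulr_ge0// ltW.
Qed.

(** Read off the mixture at [a = 0], a finite sum of nonnegative terms, rather than off the limit
    that defines [hyp1F1]; measurability below is obtained in the same way. *)
Lemma sr_density_ge0 x : 0 <= x -> 0 <= sr_density b m Omega x.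
Proof.
move=> x0; have := @sr_density_mixture 0 x (lexx 0).
rewrite mul0r oppr0 expR0 mul1r => ->; apply: sumr_ge0 => k _.
have dl0 : 0 <= rate 0 by apply/ltW/sr_rate_gt0.
apply: mulr_ge0; first exact: sr_weight_ge0.
by rewrite !mulr_ge0 ?expR_ge0 ?exprn_ge0 ?mulr_ge0 ?exprn_ge0.
Qed.

Lemma measurable_sr_density : measurable_fun [set: R] (sr_density b m Omega).
Proof.
rewrite (_ : sr_density b m Omega = fun x => \sum_(k < m) sr_weight 0 k *
    (expR (- (rate 0 * x ^+ 2)) * ((rate 0 * x ^+ 2) ^+ k / k`!%:R) *
     (rate 0 * (2 * x)))); last first.
  apply/funext => x; rewrite -sr_density_mixture//.
  by rewrite mul0r oppr0 expR0 mul1r.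
have msq : measurable_fun [set: R] (fun x => rate 0 * x ^+ 2).
  by apply: measurable_funM => //; exact: exprn_measurable.
apply: measurable_sum => k; apply: measurable_funM => //.
apply: measurable_funM; last first.
  by apply: measurable_funM => //; exact: measurable_funM.
apply: measurable_funM.
  by apply: measurableT_comp => //; exact: measurableT_comp.
by apply: measurable_funM => //; exact: measurable_funX.
Qed.

Lemma integral_sr_density a : 0 <= a ->
  (\int[lebesgue_measure]_(x in `]0%R, +oo[)
     (expR (- (a * x ^+ 2)) * sr_density b m Omega x)%:E =
   (sr_laplace_sum b m Omega a)%:E)%E.
Proof.
move=> a0; have dl0 := sr_rate_gt0 a0.
under eq_integral do rewrite sr_density_mixture// -sumEFin.
have msq : measurable_fun [set: R] (fun x => rate a * x ^+ 2).
  by apply: measurable_funM => //; exact: exprn_measurable.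
have mk k : measurable_fun (`]0%R, +oo[ : set R) (fun x : R =>
    (expR (- (rate a * x ^+ 2)) * ((rate a * x ^+ 2) ^+ k / k`!%:R) *
     (rate a * (2 * x)))%:E).
  apply: measurable_funTS; apply/measurable_EFinP; apply: measurable_funM.
    apply: measurable_funM.
      by apply: measurableT_comp => //; exact: measurableT_comp.
    by apply: measurable_funM => //; exact: measurable_funX.
  by apply: measurable_funM => //; exact: measurable_funM.
have pk k (x : R) : `]0%R, +oo[%classic x -> (0%:E <=
    (expR (- (rate a * x ^+ 2)) * ((rate a * x ^+ 2) ^+ k / k`!%:R) *
     (rate a * (2 * x)))%:E)%E.
  rewrite /= in_itv/= andbT => x0; rewrite lee_fin.
  by rewrite !mulr_ge0 ?expR_ge0 ?exprn_ge0 ?mulr_ge0 ?exprn_ge0 ?ltW.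
rewrite ge0_integral_sum//; last 2 first.
- move=> k; apply/measurable_EFinP; apply: measurable_funM => //.
  by have := mk k; move=> /measurable_EFinP.
- by move=> k x x0; rewrite EFinM mule_ge0 ?pk// lee_fin sr_weight_ge0.
rewrite sr_laplace_sumE -sumEFin; apply: eq_bigr => k _.
under eq_integral do rewrite EFinM.
rewrite ge0_integralZl//; last 3 first.
- exact: mk.
- exact: pk.
- by rewrite lee_fin sr_weight_ge0.
by rewrite integral_rayleigh_moment// mule1.
Qed.

Context d (T : measurableType d) (P : probability T R) (H : T -> R).
Hypotheses (mH : measurable_fun [set: T] H)
  (lawH : shadowed_rician_power P H b m Omega).

Lemma laplace_shadowed_rician a : 0 <= a ->
  (\int[P]_w (expR (- (a * Num.sqrt (H w) ^+ 2)))%:E =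
   (sr_laplace_sum b m Omega a)%:E)%E.
Proof.
move=> a0; rewrite -integral_sr_density//.
have mI : measurable (`]0%R, +oo[ : set R) by [].
(* The law becomes an integral against a weight on the whole line; cutting the density off makes the
   weight nonnegative everywhere. *)
pose W2 (x : R) := sr_density b m Omega x * \1_`]0%R, +oo[%classic x.
have mS : measurable_fun [set: T] (fun w => Num.sqrt (H w)).
  apply: measurableT_comp mH.
  by apply: continuous_measurable_fun; exact: sqrt_continuous.
have mf : measurable_fun [set: R] (fun x : R => expR (- (a * x ^+ 2))).
  apply: measurableT_comp => //; apply: measurableT_comp => //.
  by apply: measurable_funM => //; exact: exprn_measurable.
have W2E (B : set R) (g : R -> R) :
    (\int[lebesgue_measure]_(x in B) (W2 x * g x)%:E =
    \int[lebesgue_measure]_(x in B `&` `]0%R, +oo[) (g x * sr_density b m Omega x)%:E)%E.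
  rewrite integral_mkcond [RHS]integral_mkcond; apply: eq_integral => x _.
  rewrite !patchE in_setI /W2 indicE.
  by case: (x \in B) => //=; case: (x \in _); rewrite ?mulr1 ?mulr0 ?mul0r// mulrC.
transitivity (\int[P]_w (cst 1 w * expR (- (a * Num.sqrt (H w) ^+ 2)))%:E)%E.
  by apply: eq_integral => w _; rewrite mul1r.
rewrite (@integral_weighted_comp _ T _ _ _ (measurableTypeR R) R P (@lebesgue_measure R)
  (fun w => Num.sqrt (H w)) id (cst 1) W2 (fun x => expR (- (a * x ^+ 2))))//.
- by rewrite W2E setTI.
- apply: measurable_funM; first exact: measurable_sr_density.
  exact: measurable_indic.
- move=> x; rewrite /W2 indicE.
  have [/set_mem/=|_] := boolP (x \in _); last by rewrite mulr0.
  by rewrite in_itv/= andbT mulr1 => x0; exact/sr_density_ge0/ltW.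
- move=> B mB; rewrite (integral_cst P _ 1%:E) ?mul1e; last first.
    by rewrite -[X in measurable X]setTI; exact: mS.
  rewrite [LHS](lawH mB) preimage_id.
  transitivity (\int[lebesgue_measure]_(x in B) (W2 x * cst 1 x)%:E)%E.
    by rewrite W2E; apply: eq_integral => x _; rewrite /= mul1r.
  by apply: eq_integral => x _; rewrite /= mulr1.
Qed.

(** If H <= 0 then its root is 0, and the law gives no mass to ]-oo, 0]. *)
Lemma shadowed_rician_ae_gt0 : {ae P, forall w, 0 < H w}.
Proof.
exists [set w | `]-oo, 0%R]%classic (Num.sqrt (H w))]; split.
- have mS : measurable_fun [set: T] (fun w => Num.sqrt (H w)).
    apply: measurableT_comp mH.
    by apply: continuous_measurable_fun; exact: sqrt_continuous.
  rewrite -[X in measurable X]setTI; exact: mS.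
- rewrite lawH// (_ : _ `&` _ = set0) ?integral_set0//.
  apply/seteqP; split=> // x [] /=; rewrite !in_itv/= andbT => /le_lt_trans h /h.
  by rewrite ltxx.
- move=> w /= /negP; rewrite -leNgt in_itv/= => H0.
  by rewrite ler0_sqrtr.
Qed.
End shadowed_rician_laplace.

(** * Areas of spherical shells around the satellite *)

Section sphere_shells.
Context {R : realType}.
Implicit Types (Rs rho a b t p : R).

Lemma integral_itv_is_derive (f F : R -> R) a b : a < b -> continuous f ->
  (forall x : R, is_derive x 1 F (f x)) ->
  (\int[lebesgue_measure]_(x in `[a, b]) (f x)%:E = (F b - F a)%:E)%E.
Proof.
move=> ab cf dF.
have cF : continuous F.
  move=> x; apply/differentiable_continuous/derivable1_diffP.
  by have [] := dF x.
rewrite EFinB; apply: continuous_FTC2 => //.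
- exact: continuous_subspaceT.
- split.
  + by move=> x _; have [] := dF x.
  + exact/cvg_at_right_filter/cF.
  + exact/cvg_at_left_filter/cF.
- by move=> x _; rewrite derive1E; have [_ ->] := dF x.
Qed.

Lemma dist3_ge0 (x y : R * R * R) : 0 <= dist3 x y.
Proof. exact: sqrtr_ge0. Qed.

Lemma dist3_spherical_sat Rs rho t p :
  dist3 (spherical rho t p) (typical_sat Rs) ^+ 2 =
  rho ^+ 2 + Rs ^+ 2 - 2 * rho * Rs * cos t.
Proof.
have E : (rho * sin t * cos p - 0) ^+ 2 + (rho * sin t * sin p - 0) ^+ 2 +
    (rho * cos t - Rs) ^+ 2 = rho ^+ 2 + Rs ^+ 2 - 2 * rho * Rs * cos t.
  have -> : rho ^+ 2 = rho ^+ 2 * (cos t ^+ 2 + sin t ^+ 2 * (cos p ^+ 2 + sin p ^+ 2)).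
    by rewrite !cos2Dsin2 mulr1 cos2Dsin2 mulr1.
  by ring.
rewrite /dist3 /spherical/= sqr_sqrtr ?E// -E.
by rewrite !addr_ge0// sqr_ge0.
Qed.

(** By axial symmetry the inner integrand does not depend on the azimuth, which contributes the
    factor 2 pi. *)
Lemma sphere_area_axial rho (B : set (R * R * R)) (S : set R) :
  0 <= rho ->
  (forall t p, 0 <= t <= pi -> B (spherical rho t p) <-> S t) ->
  (sphere_area rho B =
   \int[lebesgue_measure]_(t in `[0%R, pi] `&` S)
      (2 * pi * rho ^+ 2 * sin t)%:E)%E.
Proof.
move=> rho0 BS; rewrite /sphere_area [RHS]integral_mkcondr.
apply: eq_integral => t /set_mem; rewrite /= in_itv/= => t0pi.
transitivity (\int[lebesgue_measure]_(p in `[0%R, (2 * pi)%R])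
    cst (rho ^+ 2 * sin t * \1_S t)%:E p)%E.
  apply: eq_integral => p _ /=; congr (_ * _)%:E; rewrite !indicE.
  by congr (nat_of_bool _)%:R; apply/idP/idP => /set_mem /(BS t p t0pi) ?; exact/mem_set.
rewrite integral_cst//= lebesgue_measure_itv/= lte_fin mulr_gt0 ?pi_gt0//.
rewrite -EFinB subr0 -EFinM patchE indicE.
by case: (t \in S) => /=; rewrite ?mulr1 ?mulr0 ?mul0r//; congr EFin; ring.
Qed.

(** Not intersected with a sphere, since [sphere_area] only looks at points of its own sphere.
    Half-open, so that consecutive grid shells are disjoint. *)
Definition shell Rs a b : set (R * R * R) :=
  [set x | a < dist3 x (typical_sat Rs) <= b].

Section area.
Variables (Rs rho : R).
Hypotheses (rho0 : 0 < rho) (rhoRs : rho < Rs).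

Let Rs0 : 0 < Rs. Proof. exact: lt_trans rhoRs. Qed.

(** Law of cosines: the cosine of the polar angle of the points of the sphere at distance [a] from
    the satellite. *)
Let cosof a : R := (rho ^+ 2 + Rs ^+ 2 - a ^+ 2) / (2 * rho * Rs).

Let cosof_itv a : Rs - rho <= a <= Rs + rho -> -1 <= cosof a <= 1.
Proof.
move=> /andP[ra ar]; have den : 0 < 2 * rho * Rs by rewrite !mulr_gt0.
have a0 : 0 <= a by rewrite (le_trans _ ra)// subr_ge0 ltW.
rewrite ler_pdivlMr// ler_pdivrMr// mul1r mulN1r; apply/andP; split.
  have : a ^+ 2 <= (Rs + rho) ^+ 2 by rewrite lerXn2r// nnegrE// addr_ge0// ltW.
  by rewrite sqrrD; lra.
have : (Rs - rho) ^+ 2 <= a ^+ 2 by rewrite lerXn2r// nnegrE// subr_ge0 ltW.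
by rewrite sqrrB; lra.
Qed.

Let dist_gt a t p : 0 <= a ->
  (a < dist3 (spherical rho t p) (typical_sat Rs)) = (cos t < cosof a).
Proof.
move=> a0; rewrite -(@ltr_pXn2r _ 2) ?nnegrE ?dist3_ge0// dist3_spherical_sat.
rewrite /cosof ltr_pdivlMr ?mulr_gt0//.
by apply/idP/idP; lra.
Qed.

(** Archimedes: the area of a zone is 2 pi rho^2 times the difference of the cosines of its polar
    angles, and the law of cosines makes that cosine an affine function of the squared distance. *)
Lemma sphere_area_shell a b : Rs - rho <= a -> a < b -> b <= Rs + rho ->
  sphere_area rho (shell Rs a b) =
  (pi * (rho / Rs) * (b ^+ 2 - a ^+ 2))%:E.
Proof.
move=> ra ab br.
have a0 : 0 <= a by rewrite (le_trans _ ra)// subr_ge0 ltW.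
have b0 : 0 < b by exact: le_lt_trans ab.
have ca : -1 <= cosof a <= 1 by rewrite cosof_itv// ra (le_trans (ltW ab)).
have cb : -1 <= cosof b <= 1 by rewrite cosof_itv// br (le_trans ra (ltW ab)).
have den : 0 < 2 * rho * Rs by rewrite !mulr_gt0.
have cab : cosof b < cosof a.
  rewrite /cosof ltr_pM2r ?invr_gt0// ltrD2l ltrN2 ltrXn2r// nnegrE// ltW//.
have [/andP[a1 a2] aK] := acos_def ca.
have [/andP[b1 b2] bK] := acos_def cb.
have acosab : acos (cosof a) < acos (cosof b).
  by rewrite -ltr_cos ?aK ?bK// in_itv/= ?a1 ?b1.
rewrite (@sphere_area_axial rho _ `]acos (cosof a), acos (cosof b)]%classic) ?(ltW rho0)//; last first.
  move=> t p t0pi; rewrite /shell/= in_itv/=.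
  rewrite leNgt !dist_gt ?(ltW b0)// -leNgt.
  rewrite -[in cos t < _]aK -[in _ <= cos t]bK ltr_cos ?in_itv/= ?a1//.
  rewrite leNgt ltr_cos ?in_itv/= ?b1// -leNgt.
  by [].
rewrite (_ : _ `&` _ = `]acos (cosof a), acos (cosof b)]%classic); last first.
  apply/seteqP; split=> [t []//|t /= tab]; split=> //=; move: tab; rewrite !in_itv/=.
  by move=> /andP[at_ tb]; rewrite (le_trans tb b2) (le_trans a1 (ltW at_)).
have csin : continuous (fun t : R => 2 * pi * rho ^+ 2 * sin t).
  by move=> t; apply: cvgMl_tmp; exact: continuous_sin.
rewrite integral_itv_obnd_cbnd; last first.
  by apply: measurable_funTS; apply/measurable_EFinP; exact: continuous_measurable_fun.
pose F t : R := - (2 * pi * rho ^+ 2) * cos t.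
transitivity (F (acos (cosof b)) - F (acos (cosof a)))%:E.
  apply: integral_itv_is_derive => // t.
  have := is_deriveZ (- (2 * pi * rho ^+ 2)) (is_derive_cos t).
  by rewrite /GRing.scale/= mulrNN.
rewrite /F aK bK; congr EFin; rewrite /cosof; field.
by rewrite !gt_eqF.
Qed.

(** Only the pole [t = 0] can be that close to the satellite, and one polar angle is a null set. *)
Lemma sphere_area_pole a : 0 <= a <= Rs - rho ->
  sphere_area rho [set x | dist3 x (typical_sat Rs) <= a] = 0%E.
Proof.
move=> /andP[a0 ar].
rewrite (@sphere_area_axial rho _ [set t | cosof a <= cos t]) ?(ltW rho0)//; last first.
  move=> t p _; by rewrite /= leNgt dist_gt// -leNgt.
apply: (@integral_Sset1 _ _ _ 0) => t [/=]; rewrite in_itv/= => t0pi.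
have den : 0 < 2 * rho * Rs by rewrite !mulr_gt0.
have c1 : 1 <= cosof a.
  rewrite /cosof ler_pdivlMr// mul1r.
  have : a ^+ 2 <= (Rs - rho) ^+ 2 by rewrite lerXn2r// nnegrE// subr_ge0 ltW.
  by rewrite sqrrB; lra.
move=> /(le_trans c1) ct.
apply: cos_inj; rewrite ?in_itv/= ?lexx ?pi_ge0//.
by rewrite cos0; apply/eqP; rewrite eq_le cos_le1.
Qed.
End area.
End sphere_shells.

Lemma measurable_nat_fibre d (T : measurableType d) (c : T -> nat) :
  (forall i, measurable [set w | (i < c w)%N]) ->
  forall k, measurable (c @^-1` [set k]).
Proof.
move=> mc n.
rewrite (_ : _ @^-1` _ = (if n is n'.+1 then [set w | (n' < c w)%N]
    else setT) `\` [set w | (n < c w)%N]); last first.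
  apply/seteqP; split=> w /=.
    by move=> E; rewrite E ltnn; split=> //; case: n E => [|n] //= ->.
  by case: n => [|n] [/= h /negP]; rewrite -leqNgt => h2;
    apply/eqP; rewrite eqn_leq h2 ?h.
by case: n => [|n]; exact: measurableD.
Qed.

(** * Measurability of cell configurations *)

Section configurations.
Context {R : realType} d (T : measurableType d).
Implicit Types (Phi : T -> seq (R * R * R)).

(** The sigma-algebra on [T] is arbitrary, provided that it contains the label events; below the
    lemma is also applied to the one that they generate. *)
Lemma measurable_config Phi (K : countType) (code : R * R * R -> K) (s : seq K) :
  (forall E, label_events Phi E -> measurable E) ->
  (forall k, measurable (code @^-1` [set k])) ->
  measurable [set w | map code (Phi w) = s].
Proof.
move=> mPhi mcode.
have msz i : measurable [set w | (i < size (Phi w))%N].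
  apply: mPhi; exists i, setT; split=> //.
  by apply/seteqP; split=> [w /= ?|w /= []].
have mszE n : measurable [set w | size (Phi w) = n] by exact: measurable_nat_fibre.
case: s => [|k0 s].
  rewrite (_ : [set w | _] = [set w | size (Phi w) = 0%N])//.
  by apply/seteqP; split=> w /=; case: (Phi w).
(* The empty list is treated apart because [k0] serves as the default entry of [nth] in a type
   without a distinguished element. *)
set s' := k0 :: s.
pose F i := [set w | (i < size (Phi w))%N /\ (code @^-1` [set nth k0 s' i]) (Phi w)`_i].
rewrite (_ : [set w | _] = [set w | size (Phi w) = size s'] `&`
   \big[setI/setT]_(i < size s') F i).
  apply: measurableI => //; apply: bigsetI_measurable => i _.
  by apply: mPhi; exists i, (code @^-1` [set nth k0 s' i]); split.
apply/seteqP; split=> w /=.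
  move=> E; have sz : size (Phi w) = size s' by rewrite -E size_map.
  split=> //; rewrite -(bigcap_mkord _ F) => i /= ilt; split; first by rewrite sz.
  by rewrite -E (nth_map 0)// sz.
move=> [sz]; rewrite -(bigcap_mkord _ F) => h.
apply: (@eq_from_nth _ k0); rewrite size_map// => i ilt.
rewrite (nth_map 0)//; have := h i; rewrite /= -sz => /(_ ilt)[_ ->]//.
Qed.

End configurations.

Lemma integral_prod_indic d (T : measurableType d) (R : realType)
    (P : probability T R) (I : eqType) (J : seq I) (F : set T) (u : I -> T -> R)
    (B : I -> set T) :
  measurable F -> (forall i, i \in J -> measurable (B i)) ->
  (forall i, i \in J -> u i = \1_(B i)) ->
  (\int[P]_w (\1_F w * \prod_(i <- J) u i w)%:E =
   P (F `&` \big[setI/setT]_(i <- J) B i))%E.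
Proof.
move=> mF mB uB.
have mJ : measurable (F `&` \big[setI/setT]_(i <- J) B i).
  apply: measurableI => //; rewrite big_seq.
  by apply: bigsetI_measurable => i /mB.
transitivity (\int[P]_w (\1_(F `&` \big[setI/setT]_(i <- J) B i) w)%:E)%E; last first.
  by rewrite integral_indic// setIT.
apply: eq_integral => w _; congr EFin.
elim: J {mJ mB} uB => [|i J IH] uB.
  by rewrite !big_nil mulr1 setIT.
rewrite !big_cons setICA indicI/= -IH; last first.
  by move=> k kJ; apply: uB; rewrite inE kJ orbT.
by rewrite mulrCA uB ?mem_head.
Qed.

(** * Generating function of a Poisson variable *)

Section poisson_pgf.
Context {R : realType} d (T : measurableType d) (P : probability T R).

Lemma pgf_poisson (N : T -> nat) (a q : R) :
  (forall n, measurable (N @^-1` [set n])) ->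
  (forall n, P (N @^-1` [set n]) = (poisson_weight a n)%:E) -> 0 <= q ->
  (\int[P]_w (q ^+ N w)%:E = (expR (- (a * (1 - q))))%:E)%E.
Proof.
move=> mN PN q0.
have mq : measurable_fun [set: T] (fun w => (q ^+ N w)%:E).
  by apply/measurable_EFinP; exact: (@measurable_fun_fibres _ T _ N _ _ (fun n => q ^+ n)).
have U : \bigcup_n (N @^-1` [set n]) = setT.
  by apply/seteqP; split=> // w _; exists (N w).
rewrite -U ge0_integral_bigcup//; last 3 first.
- by rewrite U.
- by move=> w _; rewrite lee_fin exprn_ge0.
- apply/trivIsetP => i j _ _ /eqP ij; apply/seteqP; split=> // w [/= Ni Nj].
  by apply: ij; rewrite -Ni -Nj.
transitivity (\sum_(0 <= n <oo) (expR (- a) * exp_coeff (a * q) n)%:E)%E.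
  apply: eq_eseriesr => n _.
  transitivity (\int[P]_(w in N @^-1` [set n]) cst (q ^+ n)%:E w)%E.
    by apply: eq_integral => w /set_mem /= ->.
  rewrite (integral_cst P (mN n) (q ^+ n)%:E) [X in (_ * X)%E](PN n) -EFinM.
  by congr EFin; rewrite /poisson_weight /exp_coeff/= exprMn; ring.
rewrite (_ : expR (- (a * (1 - q))) = expR (- a) * expR (a * q)); last first.
  by rewrite -expRD; congr expR; ring.
apply/cvg_lim => //.
rewrite (_ : (fun n => _) = EFin \o (fun n => expR (- a) * series (exp_coeff (a * q)) n)).
  apply: cvg_EFin; first exact: nearW.
  apply: cvgMl_tmp; exact: is_cvg_series_exp_coeff.
by apply/funext => n; rewrite /= sumEFin mulr_sumr.
Qed.
End poisson_pgf.

Lemma measurable_fun_on_fibres d (T : measurableType d) d' (S : measurableType d')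
    (K : countType) (c : T -> K) (f : T -> S) :
  (forall k, measurable (c @^-1` [set k])) ->
  (forall k, measurable_fun (c @^-1` [set k]) f) -> measurable_fun [set: T] f.
Proof.
move=> mc mf _ B mB; rewrite setTI.
rewrite (_ : _ @^-1` _ = \bigcup_k (c @^-1` [set k] `&` f @^-1` B)).
  by apply: countable_bigcupT_measurable => // k; exact: mf.
by apply/seteqP; split=> [w /= Bw|w [k _ [/= _ ]]//]; exists (c w).
Qed.

Definition nat_sum_seq n1 n2 : seq (nat + nat) :=
  map inl (iota 0 n1) ++ map inr (iota 0 n2).

Lemma nat_sum_seq_uniq n1 n2 : uniq (nat_sum_seq n1 n2).
Proof.
rewrite cat_uniq !map_inj_uniq ?iota_uniq//=; try by move=> ? ? [].
by rewrite andbT; apply/hasPn => x /mapP[i _ ->]; apply/mapP => -[].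
Qed.

Lemma big_nat_sum_seq (S : Type) (idx : S) (op : Monoid.law idx) n1 n2
    (F : nat + nat -> S) :
  \big[op/idx]_(i <- nat_sum_seq n1 n2) F i =
  op (\big[op/idx]_(l < n1) F (inl (l : nat)))
     (\big[op/idx]_(l < n2) F (inr (l : nat))).
Proof.
rewrite big_cat !big_map/= -[in iota 0 n1](subn0 n1) -[in iota 0 n2](subn0 n2).
by rewrite -/(index_iota 0 n1) -/(index_iota 0 n2) !big_mkord.
Qed.

(** * Averaging over the fading with the configuration frozen *)

Section fading.
Context {R : realType} d (T : measurableType d) (P : probability T R).
Variables (Phi1 Phi2 : T -> seq (R * R * R)) (H1 H2 : nat -> {RV P >-> R}).
Variables (b Omega : R) (m : nat).
Hypotheses (b0 : 0 < b) (Omega0 : 0 < Omega) (m0 : (0 < m)%N).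
Hypotheses (lawH1 : forall l, shadowed_rician_power P (H1 l) b m Omega)
  (lawH2 : forall l, shadowed_rician_power P (H2 l) b m Omega)
  (indep : mutually_independent P (network_sigma Phi1 Phi2 H1 H2))
  (mPhi1 : forall E, label_events Phi1 E -> measurable E)
  (mPhi2 : forall E, label_events Phi2 E -> measurable E).

Local Notation psi := (sr_laplace_sum b m Omega).

Lemma sr_laplace_sum_ge0 a : 0 <= a -> 0 <= psi a.
Proof.
by move=> a0; rewrite sr_laplace_sumE// sumr_ge0// => k _; exact: sr_weight_ge0.
Qed.

Let fade (i : nat + nat) : T -> R :=
  match i with inl l => H1 l | inr l => H2 l end.

Let mfade i : measurable_fun [set: T] (fade i).
Proof. by case: i => l; exact: measurable_funP. Qed.

Let law_fade i : shadowed_rician_power P (fade i) b m Omega.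
Proof. by case: i. Qed.

Let measurable_fade_preimage i B : measurable B -> measurable (fade i @^-1` B).
Proof. by move=> mB; rewrite -[X in measurable X]setTI; exact: mfade. Qed.

(** The point processes enter through one event [F], which occupies the index [None] of the mutual
    independence. The identity is that independence for indicators of fading events, extended to
    exponentials. *)
Lemma integral_prod_fading (F : set T) (J : seq (nat + nat)) (a : nat + nat -> R) :
  measurable F -> <<s label_events Phi1 `|` label_events Phi2 >> F -> uniq J ->
  (forall i, 0 <= a i) ->
  (\int[P]_w (\1_F w * \prod_(i <- J) expR (- (a i * Num.sqrt (fade i w) ^+ 2)))%:E
   = P F * (\prod_(i <- J) psi (a i))%:E)%E.
Proof.
move=> mF sF uJ a0.
rewrite -prodEFin.
rewrite [X in (_ * X)%E](eq_bigr (fun i => \int[P]_w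
    (expR (- (a i * Num.sqrt (fade i w) ^+ 2)))%:E)%E); last first.
  move=> i _; apply/esym.
  exact: (laplace_shadowed_rician b0 Omega0 m0 (mfade i) (law_fade i) (a0 i)).
have PF : P F = (fine (P F))%:E by rewrite fineK// fin_num_measure.
rewrite PF.
apply: (@product_formula_extension _ _ _ P _ J
  (fun i => [set u | exists2 B, measurable B & u = \1_(fade i @^-1` B)])
  (fun i => [set v | exists2 f : R -> R, (measurable_fun [set: R] f /\
     forall y, (0 <= f y <= 1)%R) & v = f \o fade i])
  (\1_F) (fine (P F)) uJ _ _ _ _ _ _
  (fun i w => expR (- (a i * Num.sqrt (fade i w) ^+ 2)))).
- split; first exact: measurable_indic.
  by move=> w; rewrite indicE; case: (w \in F); rewrite ?ler01 ?lexx.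
- exact: fine_ge0.
- by move=> i iJ; exact: product_extension_measurable.
- move=> i u iJ [B mB ->]; split.
    by apply: measurable_indic; exact: measurable_fade_preimage.
  by move=> w; rewrite indicE; case: (w \in _); rewrite ?ler01 ?lexx.
- move=> i v iJ [f [mf f01] ->]; split; last by move=> w; exact: f01.
  exact: measurableT_comp.
- move=> u Uu.
  (* Each [u i] is an indicator; recovering its event as the set where it equals 1 avoids choosing a
     Borel set for every index. *)
  have uE i : i \in J -> u i = \1_([set w | u i w = 1]).
    move=> /Uu[B mB ->]; apply/funext => w; rewrite !indicE; congr (nat_of_bool _)%:R.
    apply/idP/idP => [h|/set_mem/=]; first by apply/mem_set; rewrite /= indicE h.
    by rewrite indicE; case: (w \in _) => //= /eqP; rewrite eq_sym oner_eq0.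
  have uB i : i \in J -> exists2 B, measurable B & [set w | u i w = 1] = fade i @^-1` B.
    move=> /Uu[B mB ->]; exists B => //; apply/seteqP; split=> w /=; rewrite indicE.
      have [/set_mem//|_ /eqP] := boolP (w \in _).
      by rewrite eq_sym oner_eq0.
    by move=> Bw; rewrite mem_set.
  have mu i : i \in J -> measurable [set w | u i w = 1].
    by move=> /uB[B mB ->]; exact: measurable_fade_preimage.
  rewrite (@integral_prod_indic _ _ _ P _ J F u (fun i => [set w | u i w = 1]))//.
  pose E (o : option (nat + nat)) := if o is Some i then [set w | u i w = 1] else F.
  have := indep (J := None :: map Some J) (E := E).
  rewrite bigcap_seq !big_cons !big_map /= => ->.
  + rewrite EFinM -prodEFin; congr (_ * _)%E; apply: eq_big_seq => i iJ.
    rewrite fineK; last by apply: fin_num_measure; exact: mu.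
    by rewrite [in RHS]uE// integral_indic ?setIT//; exact: mu.
  + by rewrite map_inj_uniq ?uJ ?andbT; [apply/mapP => -[]|move=> ? ? []].
  + move=> o; rewrite inE => /predU1P[->//|/mapP[i /uB[B mB uBE] ->]] /=.
    by case: i uBE => l uBE; exists B => //; rewrite uBE setTI.
- move=> i iJ; exists (fun x : R => expR (- (a i * Num.sqrt x ^+ 2))) => //; split.
    apply: measurableT_comp => //; apply: measurableT_comp => //.
    apply: measurable_funM => //; apply: measurable_funX.
    by apply: continuous_measurable_fun; exact: sqrt_continuous.
  move=> y; rewrite expR_ge0/= expR_le1 oppr_le0 mulr_ge0 ?a0//.
Qed.

Variables (code1 code2 : R * R * R -> nat).
Hypotheses (mcode1 : forall k, measurable (code1 @^-1` [set k]))
  (mcode2 : forall k, measurable (code2 @^-1` [set k])).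

Let config w : seq nat * seq nat := (map code1 (Phi1 w), map code2 (Phi2 w)).

Let config_fibre k : config @^-1` [set k] =
  [set w | map code1 (Phi1 w) = k.1] `&` [set w | map code2 (Phi2 w) = k.2].
Proof.
by apply/seteqP; split=> w /=; case: k => s1 s2 /=; [move=> [<- <-]|move=> [<- <-]].
Qed.

Let measurable_config_fibre k : measurable (config @^-1` [set k]).
Proof.
by rewrite config_fibre; apply: measurableI; exact: measurable_config.
Qed.

(** Mutual independence asks for membership in the generated sigma-algebra, which is measurability
    over that structure, so [measurable_config] is instantiated there. *)
Let sigma_config_fibre k :
  <<s label_events Phi1 `|` label_events Phi2 >> (config @^-1` [set k]).
Proof.
rewrite config_fibre.
pose G := label_events Phi1 `|` label_events Phi2.
suff : @measurable _ (g_sigma_algebraType G)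
  ([set w | map code1 (Phi1 w) = k.1] `&` [set w | map code2 (Phi2 w) = k.2]) by [].
apply: measurableI.
- apply: (@measurable_config _ _ (g_sigma_algebraType G)) => // E LE.
  by apply: sub_sigma_algebra; left.
- apply: (@measurable_config _ _ (g_sigma_algebraType G)) => // E LE.
  by apply: sub_sigma_algebra; right.
Qed.

Lemma measurable_fading_prod (a1 a2 : nat -> R) :
  measurable_fun [set: T] (fun w =>
     \prod_(l < size (Phi1 w))
        expR (- (a1 (code1 (Phi1 w)`_l) * Num.sqrt (H1 l w) ^+ 2)) *
     \prod_(l < size (Phi2 w))
        expR (- (a2 (code2 (Phi2 w)`_l) * Num.sqrt (H2 l w) ^+ 2))).
Proof.
apply: (measurable_fun_on_fibres (c := config)) => // s.
pose F (a : nat -> R) (s' : seq nat) (H : nat -> {RV P >-> R}) w :=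
  \prod_(l < size s') expR (- (a (nth 0%N s' l) * Num.sqrt (H l w) ^+ 2)).
have mF a s' H : measurable_fun [set: T] (F a s' H).
  apply: measurable_prod => l _.
  apply: measurableT_comp => //; apply: measurableT_comp => //.
  apply: measurable_funM => //; apply: measurable_funX.
  by apply: measurableT_comp => //; apply: continuous_measurable_fun; exact: sqrt_continuous.
apply: (eq_measurable_fun (fun w => F a1 s.1 H1 w * F a2 s.2 H2 w)).
  move=> w /set_mem /= <-; rewrite /F /config/= !size_map.
  by congr (_ * _); apply: eq_bigr => l _; rewrite (nth_map 0).
by apply: measurable_funTS; exact: measurable_funM.
Qed.

(** On a fibre of [config] the numbers of users and all coefficients are constant, so a product of
    random length becomes one over fixed labels and independence applies. The factor [g] carries
    along any condition on the cells, such as the location of the nearest user. *)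
Lemma integral_fading (g : seq nat * seq nat -> R) (a1 a2 : nat -> R) :
  (forall k, 0 <= g k) -> (forall k, 0 <= a1 k) -> (forall k, 0 <= a2 k) ->
  (\int[P]_w (g (map code1 (Phi1 w), map code2 (Phi2 w)) *
     (\prod_(l < size (Phi1 w))
        expR (- (a1 (code1 (Phi1 w)`_l) * Num.sqrt (H1 l w) ^+ 2)) *
      \prod_(l < size (Phi2 w))
        expR (- (a2 (code2 (Phi2 w)`_l) * Num.sqrt (H2 l w) ^+ 2))))%:E
   = \int[P]_w (g (map code1 (Phi1 w), map code2 (Phi2 w)) *
     (\prod_(x <- Phi1 w) psi (a1 (code1 x)) *
      \prod_(x <- Phi2 w) psi (a2 (code2 x))))%:E)%E.
Proof.
move=> g0 a10 a20.
pose J := nat_sum_seq.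
pose a (s : seq nat * seq nat) (i : nat + nat) :=
  match i with inl l => a1 (nth 0%N s.1 l) | inr l => a2 (nth 0%N s.2 l) end.
have a0 s i : 0 <= a s i by case: i => l /=.
have uJ := nat_sum_seq_uniq.
pose X w := \prod_(i <- J (size (config w).1) (size (config w).2))
   expR (- (a (config w) i * Num.sqrt (fade i w) ^+ 2)).
pose Y s : R := \prod_(i <- J (size s.1) (size s.2)) psi (a s i).
transitivity (\int[P]_w (g (config w) * X w)%:E)%E.
  apply: eq_integral => w _; rewrite /X big_nat_sum_seq /config/= !size_map.
  congr (_ * (_ * _))%:E; apply: eq_bigr => l _; by rewrite (nth_map 0).
transitivity (\int[P]_w (g (config w) * Y (config w))%:E)%E; last first.
  apply: eq_integral => w _; rewrite /Y big_nat_sum_seq /config/= !size_map.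
  congr (_ * (_ * _))%:E; rewrite (big_nth 0) big_mkord;
    apply: eq_bigr => l _; by rewrite (nth_map 0).
have mX : measurable_fun [set: T] X.
  apply: eq_measurable_fun (measurable_fading_prod a1 a2) => w _.
  rewrite /X big_nat_sum_seq /config/= !size_map.
  by congr (_ * _); apply: eq_bigr => l _; rewrite (nth_map 0).
have Y0 s : 0 <= Y s.
  by apply: prodr_ge0 => i _; exact: sr_laplace_sum_ge0.
apply: (@eq_integral_fibres _ _ _ P _ config) => //.
- apply/measurable_EFinP; apply: measurable_funM => //.
  exact: measurable_fun_fibres.
- apply/measurable_EFinP.
  exact: (@measurable_fun_fibres _ T _ config _ _ (fun s => g s * Y s)).
- move=> w; rewrite lee_fin mulr_ge0//; apply: prodr_ge0 => i _; exact: expR_ge0.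
- by move=> w; rewrite lee_fin mulr_ge0.
- move=> s; set F := config @^-1` [set s].
  have mF : measurable F by exact: measurable_config_fibre.
  transitivity ((g s)%:E * \int[P]_w (\1_F w * \prod_(i <- J (size s.1) (size s.2))
     expR (- (a s i * Num.sqrt (fade i w) ^+ 2)))%:E)%E.
    rewrite -ge0_integralZl//; last 3 first.
    + apply/measurable_EFinP; apply: measurable_funM; first exact: measurable_indic.
      apply: measurable_prod => i _.
      apply: measurableT_comp => //; apply: measurableT_comp => //.
      apply: measurable_funM => //; apply: measurable_funX.
      by apply: measurableT_comp => //; apply: continuous_measurable_fun; exact: sqrt_continuous.
    + move=> w _; rewrite lee_fin mulr_ge0//.
      by apply: prodr_ge0 => i _; exact: expR_ge0.
    + by rewrite lee_fin.
    rewrite integral_mkcond; apply: eq_integral => w _.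
    rewrite patchE indicE; have [/set_mem wF|_] := boolP (w \in F).
      by rewrite mul1r -EFinM /X (wF : config w = s).
    by rewrite mul0r mule0.
  rewrite integral_prod_fading//; last exact: sigma_config_fibre.
  transitivity (\int[P]_(w in F) cst (g s * Y s)%:E w)%E; last first.
    by apply: eq_integral => w /set_mem wF; rewrite (wF : config w = s).
  by rewrite integral_cst// EFinM -muleA; congr (_ * _)%E; rewrite muleC.
Qed.
End fading.

(** * Independence of the cell counts *)

Section counts.
Context {R : realType} d (T : measurableType d) (P : probability T R).
Implicit Types (Phi : T -> seq (R * R * R)).

Lemma measurable_count_pts Phi (B : set (R * R * R)) n :
  (forall E, label_events Phi E -> measurable E) -> measurable B ->
  measurable (count_pts Phi B @^-1` [set n]).
Proof.
move=> mPhi mB.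
have mc (k : bool) : measurable ((fun x => x \in B) @^-1` [set k]).
  case: k; first by rewrite (_ : _ @^-1` _ = B)//; apply/seteqP; split=> x /=;
    [exact: set_mem|exact: mem_set].
  rewrite (_ : _ @^-1` _ = ~` B); first exact: measurableC.
  by apply/seteqP; split=> x /= => [/negbT/negP xB Bx|nBx]; [exact/xB/mem_set|exact: memNset].
(* Membership in [B] is a two-valued code, and the count is a function of the list of codes. *)
have mf s : measurable [set w | map (fun x => x \in B) (Phi w) = s].
  exact: measurable_config.
have := @measurable_fun_fibres _ T _ (fun w => map (fun x => x \in B) (Phi w))
  _ nat (fun s => count id s) mf measurableT [set n] I.
rewrite setTI (_ : _ @^-1` [set n] = count_pts Phi B @^-1` [set n])//.
by apply/seteqP; split=> w; rewrite /count_pts/= count_map.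
Qed.

Lemma ppp_count_law Phi rho lam (B : set (R * R * R)) n :
  poisson_process_on_sphere P Phi rho lam -> measurable B ->
  P (count_pts Phi B @^-1` [set n]) =
  (poisson_weight (lam * fine (sphere_area rho B)) n)%:E.
Proof.
move=> ppp mB; have := @ppp_law _ _ _ _ _ _ _ ppp 1 (fun=> B) (fun=> n).
rewrite big_ord1 => <-//; last first.
  by apply/trivIsetP => i j _ _; rewrite (ord1 i) (ord1 j) eqxx.
by congr (P _); apply/seteqP; split=> w /= h; [move=> _|exact: h ord0].
Qed.

Variables (Phi1 Phi2 : T -> seq (R * R * R)) (rho1 rho2 lam1 lam2 : R).
Hypotheses (ppp1 : poisson_process_on_sphere P Phi1 rho1 lam1)
  (ppp2 : poisson_process_on_sphere P Phi2 rho2 lam2)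
  (indep : independent2 P <<s count_events Phi1 >> <<s count_events Phi2 >>).
Variables (C1 C2 : nat -> set (R * R * R)).
Hypotheses (mC1 : forall j, measurable (C1 j)) (mC2 : forall j, measurable (C2 j))
  (tC1 : trivIset setT C1) (tC2 : trivIset setT C2).

Let cnt (i : nat + nat) : T -> nat :=
  match i with inl j => count_pts Phi1 (C1 j) | inr j => count_pts Phi2 (C2 j) end.

Let rate (i : nat + nat) : R :=
  match i with
  | inl j => lam1 * fine (sphere_area rho1 (C1 j))
  | inr j => lam2 * fine (sphere_area rho2 (C2 j))
  end.

Let mcnt i k : measurable (cnt i @^-1` [set k]).
Proof.
case: i => j /=; apply: measurable_count_pts => //.
  exact: (ppp_measurable ppp1).
exact: (ppp_measurable ppp2).
Qed.

Let law_cnt i k : P (cnt i @^-1` [set k]) = (poisson_weight (rate i) k)%:E.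
Proof. by case: i => j; exact: ppp_count_law. Qed.

Let sigma_count Phi (C : nat -> set (R * R * R)) n (k : nat -> nat) :
  (forall j, measurable (C j)) ->
  <<s count_events Phi >> (\big[setI/setT]_(j < n) count_pts Phi (C j) @^-1` [set k j]).
Proof.
move=> mC; suff : @measurable _ (g_sigma_algebraType (count_events Phi))
  (\big[setI/setT]_(j < n) count_pts Phi (C j) @^-1` [set k j]) by [].
apply: bigsetI_measurable => j _; apply: sub_sigma_algebra.
by exists (C j), (k j); split.
Qed.

Let joint_law Phi rho lam (C : nat -> set (R * R * R)) n (k : nat -> nat) :
  poisson_process_on_sphere P Phi rho lam ->
  (forall j, measurable (C j)) -> trivIset setT C ->
  P (\big[setI/setT]_(j < n) count_pts Phi (C j) @^-1` [set k j]) =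
  (\prod_(j < n) poisson_weight (lam * fine (sphere_area rho (C j))) (k j))%:E.
Proof.
move=> ppp mC tC.
have := @ppp_law _ _ _ _ _ _ _ ppp n (fun j => C j) (fun j => k j).
move=> <- //; last first.
  apply/trivIsetP => i j _ _ ij; move/trivIsetP : tC; apply => //.
congr (P _); rewrite -(bigcap_mkord _ (fun j => count_pts Phi (C j) @^-1` [set k j])).
apply/seteqP; split=> w /= h; first by move=> j; exact: (h j (ltn_ord j)).
by move=> j jn; exact: (h (Ordinal jn)).
Qed.

(** For point masses, the joint law on disjoint regions handles each process and independence of the
    count events joins the two; bounded [phi] follow by extension. Taking [n2 = 0] gives the first
    process alone. *)
Lemma integral_prod_counts n1 n2 (phi : nat + nat -> nat -> R) :
  (forall i k, 0 <= phi i k <= 1) ->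
  (\int[P]_w (\prod_(j < n1) phi (inl (j : nat)) (count_pts Phi1 (C1 j) w) *
              \prod_(j < n2) phi (inr (j : nat)) (count_pts Phi2 (C2 j) w))%:E =
   \prod_(j < n1) \int[P]_w (phi (inl (j : nat)) (count_pts Phi1 (C1 j) w))%:E *
   \prod_(j < n2) \int[P]_w (phi (inr (j : nat)) (count_pts Phi2 (C2 j) w))%:E)%E.
Proof.
move=> phi01.
pose J := nat_sum_seq n1 n2.
transitivity (\int[P]_w (cst 1 w * \prod_(i <- J) phi i (cnt i w))%:E)%E.
  by apply: eq_integral => w _; rewrite big_nat_sum_seq/= mul1r.
transitivity (1%:E * \prod_(i <- J) \int[P]_w (phi i (cnt i w))%:E)%E; last first.
  by rewrite mul1e (big_nat_sum_seq (S := \bar R)).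
apply: (@product_formula_extension _ _ _ P _ J
  (fun i => [set u | exists k, u = \1_(cnt i @^-1` [set k])])
  (fun i => [set v | exists2 f : nat -> R, (forall k, (0 <= f k <= 1)%R) & v = f \o cnt i])
  (cst 1) 1 (nat_sum_seq_uniq n1 n2) _ _ _ _ _ _ (fun i w => phi i (cnt i w))).
- by split; [exact: measurable_cst|move=> w /=; rewrite ler01 lexx].
- exact: ler01.
- by move=> i iJ; exact: product_extension_countable.
- move=> i u iJ [k ->]; split; first exact: measurable_indic.
  by move=> w; rewrite indicE; case: (w \in _); rewrite ?ler01 ?lexx.
- move=> i v iJ [f f01 ->]; split; last by move=> w; exact: f01.
  exact: measurable_fun_fibres.
- move=> u Uu.
  have /choice[k uE] : forall i, exists k, i \in J -> u i = \1_(cnt i @^-1` [set k]).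
    move=> i; have [/Uu[k ->]|/negP nJ] := boolP (i \in J); first by exists k.
    by exists 0%N.
  rewrite mul1e.
  transitivity (\int[P]_w (\1_setT w * \prod_(i <- J) u i w)%:E)%E.
    by apply: eq_integral => w _; rewrite indicT.
  rewrite (@integral_prod_indic _ _ _ P _ J setT u (fun i => cnt i @^-1` [set k i]))//.
  rewrite setTI big_nat_sum_seq/=.
  rewrite (indep (@sigma_count Phi1 C1 n1 (fun j => k (inl j)) mC1)
                 (@sigma_count Phi2 C2 n2 (fun j => k (inr j)) mC2)).
  rewrite (@joint_law Phi1 rho1 lam1 C1 n1 (fun j => k (inl j)))//.
  rewrite (@joint_law Phi2 rho2 lam2 C2 n2 (fun j => k (inr j)))//.
  transitivity (\prod_(i <- J) (poisson_weight (rate i) (k i))%:E)%E; last first.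
    apply: eq_big_seq => i iJ; rewrite (uE _ iJ) integral_indic// setIT.
    by rewrite -law_cnt.
  by rewrite big_nat_sum_seq/= -!prodEFin.
- by move=> i iJ; exists (phi i).
Qed.

End counts.

(** * Antiderivatives and the representative distance of a cell *)

Section antiderivative.
Context {R : realType}.
Implicit Types (f K : R -> R) (a b lo hi x v : R).

Lemma antiderivative_exists f lo hi : 0 < lo -> lo < hi ->
  (forall x, 0 < x -> {for x, continuous f}) ->
  exists K : R -> R, (forall x, lo <= x <= hi -> is_derive x 1 K (f x)) /\
    forall a, lo <= a <= hi ->
      \int[lebesgue_measure]_(x in `[a, hi]) f x = K hi - K a.
Proof.
move=> lo0 lohi cf.
(* Starting at [lo / 2], and allowing [hi + 1] as upper end below, makes [lo] and [hi] interior
   points, so that [K] has two-sided derivatives at both. *)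
pose K x := \int[lebesgue_measure]_(t in `[lo / 2, x]) f t.
have lo2 : 0 < lo / 2 by rewrite divr_gt0.
have lo2lo : lo / 2 < lo by rewrite ltr_pdivrMr// ltr_pMr// ltr1n.
have cfw a b : 0 < a -> {within `[a, b], continuous f}.
  move=> a0; apply: continuous_in_subspaceT => x /set_mem/=.
  by rewrite in_itv/= => /andP[ax _]; apply: cf; exact: lt_le_trans ax.
have dK x : lo <= x <= hi -> is_derive x 1 K (f x).
  move=> /andP[lox xhi].
  have [||||dKx K'x] := @continuous_FTC1_closed _ f (lo / 2) x (hi + 1).
  - by rewrite (le_lt_trans xhi)// ltrDl.
  - by apply: continuous_compact_integrable; [exact: segment_compact|exact: cfw].
  - exact: lt_le_trans lox.
  - by apply: cf; exact: lt_le_trans lox.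
  - by apply: DeriveDef => //; rewrite -derive1E.
exists K; split=> // a /andP[loa]; rewrite le_eqVlt => /predU1P[->|ahi].
  by rewrite set_itv1 Rintegral_set1 subrr.
have cK x : lo <= x <= hi -> {for x, continuous K}.
  move=> xl; apply/differentiable_continuous/derivable1_diffP.
  by have [] := dK x xl.
rewrite /Rintegral (@continuous_FTC2 _ f K a hi)//.
- by apply: cfw; exact: lt_le_trans loa.
- split.
  + move=> x; rewrite in_itv/= => /andP[ax xhi].
    by have [] := dK x; rewrite // (le_trans loa (ltW ax)) ltW.
  + by apply: cvg_at_right_filter; apply: cK; rewrite loa ltW.
  + by apply: cvg_at_left_filter; apply: cK; rewrite lexx ltW.
- move=> x; rewrite in_itv/= => /andP[ax xhi]; rewrite derive1E.
  by have [] := dK x; rewrite // (le_trans loa (ltW ax)) ltW.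
Qed.

(* Cauchy's mean value theorem for [K] and [x ^+ 2]. *)
Lemma radial_mean_value (h K : R -> R) a b : 0 < a -> a < b ->
  (forall x, a <= x <= b -> is_derive x 1 K ((1 - h x) * x)) ->
  exists2 c, a < c < b & (b ^+ 2 - a ^+ 2) / 2 * (1 - h c) = K b - K a.
Proof.
move=> a0 ab dK.
(* This combination takes the same value at [a] and [b], so its derivative vanishes at some [c];
   division by [2 * c] gives the claim. *)
pose phi x := (b ^+ 2 - a ^+ 2) * K x - (K b - K a) * x ^+ 2.
have dphi x : a <= x <= b -> is_derive x 1 phi
    ((b ^+ 2 - a ^+ 2) * ((1 - h x) * x) - (K b - K a) * (2 * x)).
  move=> xab; have dKx := dK x xab.
  have dsq : is_derive x 1 (fun y : R => y ^+ 2) (2 * x).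
    by apply: is_derive_eq; rewrite /GRing.scale/= mulr1 mulr2n mulrDl mul1r.
  exact: (is_deriveB (is_deriveZ (b ^+ 2 - a ^+ 2) dKx) (is_deriveZ (K b - K a) dsq)).
have dphi' x : x \in `]a, b[ -> is_derive x 1 phi
    ((b ^+ 2 - a ^+ 2) * ((1 - h x) * x) - (K b - K a) * (2 * x)).
  by rewrite in_itv/= => /andP[ax xb]; apply: dphi; rewrite !ltW.
have cphi : {within `[a, b], continuous phi}.
  apply: continuous_in_subspaceT => x /set_mem/=; rewrite in_itv/= => xab.
  apply/differentiable_continuous/derivable1_diffP.
  by have [] := dphi x xab.
have [c] := MVT ab dphi' cphi.
rewrite in_itv/= => cab E; exists c => //.
have phiE : phi b - phi a = 0 by rewrite /phi; ring.
have c0 : 0 < c by case/andP: cab => ac _; exact: lt_trans ac.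
move: E; rewrite phiE => /esym/eqP.
rewrite mulf_eq0 (gt_eqF (_ : 0 < b - a)) ?subr_gt0// orbF => /eqP E.
apply: (@mulfI _ (2 * c)); first by rewrite mulf_neq0// gt_eqF.
apply/eqP; rewrite -subr_eq0; apply/eqP.
by rewrite -[RHS]E; field.
Qed.
End antiderivative.

(** * Uniform grid of distances *)

Section uniform_grid.
Context {R : realType}.
Implicit Types (v lo hi : R) (e : nat -> R).

Definition grid_step lo hi n : R := (hi - lo) / n.+1%:R.

Definition grid lo hi n j : R := lo + j%:R * grid_step lo hi n.

(* Cell [0] is [v <= lo], cell [j.+1] is ]grid j, grid j.+1] and cell [n.+2]
   is [hi < v]. *)
Definition grid_cell lo hi n v : nat :=
  (\sum_(j < n.+2) (grid lo hi n j < v)%R)%N.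

(** As [e] increases, the indices with [e j < v] form an initial segment, whose length is the
    count. *)
Lemma ltn_count_below e N v i : {homo e : i j / (i < j)%N >-> i < j} ->
  (i < N)%N -> (i < \sum_(j < N) (e j < v)%R)%N = (e i < v).
Proof.
move=> he; elim: N i => // N IH i; rewrite ltnS big_ord_recr/=.
have le : (\sum_(j < N) (e j < v)%R <= N)%N.
  rewrite -[leqRHS](card_ord N) -sum1_card; apply: leq_sum => j _.
  exact: leq_b1.
rewrite leq_eqVlt => /predU1P[->|iN].
  have [eNv|_] := boolP (e N < v); last by rewrite addn0 ltnNge le.
  rewrite addn1 ltnS; case: N IH {le} eNv => // N IH eNv.
  by rewrite IH// (lt_trans _ eNv)// he.
have [eNv|_] := boolP (e N < v); last by rewrite addn0 IH.
rewrite addn1 ltnS (lt_trans _ eNv) ?he//.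
by apply: ltnW; rewrite IH// (lt_trans _ eNv)// he.
Qed.

Variables (lo hi : R).
Hypothesis lohi : lo < hi.

Let e n := grid lo hi n.
Let idx n := grid_cell lo hi n.

Lemma grid_step_gt0 n : 0 < grid_step lo hi n.
Proof. by rewrite divr_gt0 ?subr_gt0// ltr0n. Qed.

Lemma grid0 n : grid lo hi n 0 = lo.
Proof. by rewrite /grid mul0r addr0. Qed.

Lemma gridS n j : grid lo hi n j.+1 = grid lo hi n j + grid_step lo hi n.
Proof. by rewrite /grid -natr1 mulrDl mul1r addrA. Qed.

Lemma grid_last n : grid lo hi n n.+1 = hi.
Proof.
rewrite /grid /grid_step mulrC divfK ?pnatr_eq0//.
by rewrite addrC subrK.
Qed.

Lemma grid_lt n : {homo grid lo hi n : i j / (i < j)%N >-> i < j}.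
Proof.
by move=> i j ij; rewrite /grid ltrD2l ltr_pM2r ?grid_step_gt0// ltr_nat.
Qed.

Lemma grid_le n i j : (i <= j)%N -> grid lo hi n i <= grid lo hi n j.
Proof. by rewrite leq_eqVlt => /predU1P[->//|/(@grid_lt n)/ltW]. Qed.

Lemma grid_ge_lo n j : lo <= grid lo hi n j.
Proof. by have := grid_le n (leq0n j); rewrite grid0. Qed.

Lemma grid_le_hi n j : (j < n.+2)%N -> grid lo hi n j <= hi.
Proof. by rewrite ltnS => /(grid_le n); rewrite grid_last. Qed.

Lemma ltn_grid_cell n v i : (i < n.+2)%N ->
  (i < grid_cell lo hi n v)%N = (grid lo hi n i < v).
Proof. by apply: ltn_count_below; exact: grid_lt. Qed.

Lemma grid_cell_leq n v : (grid_cell lo hi n v <= n.+2)%N.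
Proof.
rewrite -[leqRHS](card_ord n.+2) -sum1_card; apply: leq_sum => j _.
exact: leq_b1.
Qed.

Lemma grid_cell_mono n : {homo grid_cell lo hi n : u v / u <= v >-> (u <= v)%N}.
Proof.
move=> u v uv; apply: leq_sum => j _.
by case: (boolP (grid lo hi n j < u)) => // ju; rewrite (lt_le_trans ju).
Qed.

Lemma grid_cell_lt n v : (grid_cell lo hi n v < n.+2)%N = (v <= hi).
Proof.
have := @ltn_grid_cell n v n.+1 (ltnSn _); rewrite grid_last => E.
by rewrite leNgt -E -leqNgt ltnS.
Qed.

Lemma grid_cell_ge n v : v <= hi -> v <= grid lo hi n (grid_cell lo hi n v).
Proof.
rewrite -(grid_cell_lt n) => vhi.
by rewrite leNgt -ltn_grid_cell// ltnn.
Qed.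

Lemma grid_cell_gt n v : lo <= v <= hi ->
  grid lo hi n (grid_cell lo hi n v).-1 <= v.
Proof.
(* In cell 0 the predecessor is again 0, and the bound is [lo] itself. *)
move=> /andP[lov vhi]; case E : (grid_cell lo hi n v) => [|j] /=.
  by rewrite grid0.
apply: ltW; rewrite -ltn_grid_cell ?E//.
have := vhi; rewrite -(grid_cell_lt n) E; exact: ltnW.
Qed.

Lemma grid_cell0 n v : (grid_cell lo hi n v == 0%N) = (v <= lo).
Proof.
have := @ltn_grid_cell n v 0 isT; rewrite grid0 => E.
by rewrite leNgt -E -eqn0Ngt.
Qed.

Lemma grid_cellS n v j : (j < n.+1)%N ->
  (grid_cell lo hi n v == j.+1) = (grid lo hi n j < v <= grid lo hi n j.+1).
Proof.
move=> jn; rewrite eqn_leq ltn_grid_cell; last exact: ltnW.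
by rewrite andbC; congr (_ && _); rewrite leNgt -ltn_grid_cell// -leqNgt.
Qed.

(** Ensures that, for n large, a user strictly farther than the nearest one is no longer in the cell
    of the latter. *)
Lemma grid_cell_separates n u v : lo <= u <= hi -> grid_step lo hi n < v - u ->
  (grid_cell lo hi n u < grid_cell lo hi n v)%N.
Proof.
move=> uhi uv; have [_ uh] := andP uhi.
rewrite ltn_grid_cell ?grid_cell_lt//.
apply: (@le_lt_trans _ _ (u + grid_step lo hi n)); last by rewrite -ltrBrDl.
have := grid_cell_gt n uhi; case: (grid_cell lo hi n u) => [|j] /=.
  by move=> g; rewrite (le_trans g)// lerDl ltW// grid_step_gt0.
by rewrite gridS lerD2r.
Qed.

Lemma cvg_grid_step : grid_step lo hi n @[n --> \oo] --> (0 : R).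
Proof.
rewrite -[X in _ --> X](mulr0 (hi - lo)); apply: cvgMl_tmp.
exact: cvg_harmonic.
Qed.

Lemma grid_cell_sandwich n v : lo <= v <= hi ->
  v <= grid lo hi n (grid_cell lo hi n v) <= v + grid_step lo hi n.
Proof.
move=> vlh; have [_ vh] := andP vlh; rewrite grid_cell_ge//=.
have := grid_cell_gt n vlh; case: (grid_cell lo hi n v) => [|j] /=.
  by move=> g; rewrite (le_trans g)// lerDl ltW// grid_step_gt0.
by rewrite gridS lerD2r.
Qed.

Lemma cvg_grid_cell v : lo <= v <= hi ->
  grid lo hi n (grid_cell lo hi n v) @[n --> \oo] --> v.
Proof.
move=> vlh; apply: (@squeeze_cvgr _ _ _ _ (cst v) (fun n => v + grid_step lo hi n)).
- by near=> n; exact: grid_cell_sandwich.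
- exact: cvg_cst.
- rewrite -[X in _ --> X]addr0; apply: cvgD; first exact: cvg_cst.
  exact: cvg_grid_step.
Unshelve. all: by end_near. Qed.

Lemma cvg_in_grid_cell (c : nat -> nat -> R) v : lo <= v <= hi ->
  (forall n j, (j < n.+2)%N -> grid lo hi n j.-1 <= c n j <= grid lo hi n j) ->
  c n (grid_cell lo hi n v) @[n --> \oo] --> v.
Proof.
move=> vlh cE.
have g0 : v - grid_step lo hi n @[n --> \oo] --> v.
  rewrite -[X in _ --> X]subr0; apply: cvgB; first exact: cvg_cst.
  exact: cvg_grid_step.
apply: (squeeze_cvgr _ g0 (cvg_grid_cell vlh)); near=> n.
have [_ vh] := andP vlh.
have /andP[c1 ->] := cE n (grid_cell lo hi n v) ltac:(by rewrite grid_cell_lt).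
rewrite andbT (le_trans _ c1)//.
have := grid_cell_ge n vh; case: (grid_cell lo hi n v) => [|j] /=.
  by move=> h; rewrite (le_trans _ h)// gerDl oppr_le0 ltW// grid_step_gt0.
by rewrite gridS lerBlDr.
Unshelve. all: by end_near. Qed.

Lemma grid_mean_points (h K : R -> R) n : 0 < lo ->
  (forall x, lo <= x <= hi -> is_derive x 1 K ((1 - h x) * x)) ->
  exists c : nat -> R, forall j, (j < n.+2)%N ->
    grid lo hi n j.-1 <= c j <= grid lo hi n j /\
    (grid lo hi n j ^+ 2 - grid lo hi n j.-1 ^+ 2) / 2 * (1 - h (c j)) =
    K (grid lo hi n j) - K (grid lo hi n j.-1).
Proof.
move=> lo0 dK.
suff /choice[c cP] : forall j, exists x, (j < n.+2)%N ->
    grid lo hi n j.-1 <= x <= grid lo hi n j /\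
    (grid lo hi n j ^+ 2 - grid lo hi n j.-1 ^+ 2) / 2 * (1 - h x) =
    K (grid lo hi n j) - K (grid lo hi n j.-1) by exists c.
case=> [|j].
  (* Cell 0 is degenerate, [0.-1] being 0: the identity reads 0 = 0 and [lo] is the only
     candidate. *)
  by exists lo => _ /=; rewrite grid0 lexx !subrr !mul0r.
have [jn|nj] := boolP (j.+1 < n.+2)%N; last by exists 0.
have [||x xab|c /andP[c1 c2] cE] := @radial_mean_value _ h K (grid lo hi n j) (grid lo hi n j.+1).
- by rewrite (lt_le_trans lo0)// grid_ge_lo.
- exact: grid_lt.
- apply: dK; move/andP : xab => [x1 x2]; apply/andP; split.
    by rewrite (le_trans _ x1)// grid_ge_lo.
  by rewrite (le_trans x2)// grid_le_hi.
by exists c => _; rewrite !ltW.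
Qed.
End uniform_grid.

(** * Continuity and bounds of the Laplace transform along the path loss *)

Section path_loss_laplace.
Context {R : realType} (b Omega : R) (m : nat).
Hypotheses (b0 : 0 < b) (Omega0 : 0 < Omega) (m0 : (0 < m)%N).

Lemma powR_continuous_gt0 (al v : R) : 0 < v -> {for v, continuous (fun x : R => x `^ al)}.
Proof.
move=> v0; apply/differentiable_continuous/derivable1_diffP.
by apply: derivable_powR; rewrite in_itv/= v0.
Qed.

Lemma sr_laplace_sum_continuous (y : R -> R) (v : R) :
  {for v, continuous y} -> 0 <= y v ->
  {for v, continuous (fun x : R => sr_laplace_sum b m Omega (y x))}.
Proof.
move=> cy y0; have dl0 := sr_rate_gt0 b0 Omega0 m0 y0.
rewrite /prop_for /continuous_at.
under eq_fun do rewrite sr_laplace_sumE//.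
rewrite sr_laplace_sumE//; apply: cvg_sumr => k _.
rewrite /sr_weight; apply: cvgMl_tmp; apply: cvgV.
  by rewrite expf_neq0// gt_eqF.
apply: (@continuous_comp _ _ _ (fun x => sr_beta b - sr_c b m Omega + y x)
  (fun x => x ^+ k.+1)); last exact: exprn_continuous.
by apply: cvgD; [exact: cvg_cst|exact: cy].
Qed.

Lemma path_loss_integrand_continuous (q al v : R) : 0 <= q -> 0 < v ->
  {for v, continuous (fun x : R =>
     (1 - sr_laplace_sum b m Omega (q * x `^ (- al))) * x : R)}.
Proof.
move=> q0 v0; apply: cvgM; last exact: cvg_id.
apply: cvgB; first exact: cvg_cst.
apply: (@sr_laplace_sum_continuous (fun x => q * x `^ (- al))).
  by apply: cvgMl_tmp; exact: powR_continuous_gt0.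
by rewrite mulr_ge0// powR_ge0.
Qed.

Context d (T : measurableType d) (P : probability T R) (H : T -> R).
Hypotheses (mH : measurable_fun [set: T] H)
  (lawH : shadowed_rician_power P H b m Omega).

(** Comes from the probabilistic meaning of the sum, the expectation of a variable that is at most
    1, and not from its closed form. *)
Lemma sr_laplace_sum_le1 a : 0 <= a -> sr_laplace_sum b m Omega a <= 1.
Proof.
move=> a0; rewrite -lee_fin -(laplace_shadowed_rician b0 Omega0 m0 mH lawH a0).
rewrite -(probability_setT P) -[leRHS]mul1e -(integral_cst P measurableT 1%:E).
apply: ge0_le_integral => //.
- apply/measurable_EFinP; apply: measurableT_comp => //.
  apply: measurableT_comp => //; apply: measurable_funM => //.
  apply: measurable_funX; apply: measurableT_comp => //.
  by apply: continuous_measurable_fun; exact: sqrt_continuous.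
- by move=> w _; rewrite lee_fin expR_le1 oppr_le0 mulr_ge0// sqr_ge0.
Qed.
End path_loss_laplace.

(** * Geometry of the visible cap *)

Section visible_geometry.
Context {R : realType} (Rs Ro theta : R).
Hypotheses (Rs0 : 0 < Rs) (RoRs : Ro < Rs) (theta0 : 0 < theta)
  (thetapi : theta < pi / 2) (vis : Rs * sin theta <= Ro).

Lemma sin_theta_gt0 : 0 < sin theta.
Proof.
apply: sin_gt0_pi; rewrite theta0 (lt_trans thetapi)//.
by rewrite ltr_pdivrMr// ltr_pMr ?pi_gt0// ltr1n.
Qed.

Lemma user_radius_gt0 : 0 < Ro.
Proof. by apply: lt_le_trans vis; rewrite mulr_gt0// sin_theta_gt0. Qed.

Lemma Rmin_gt0 : 0 < Rmin Rs Ro.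
Proof. by rewrite subr_gt0. Qed.

Lemma Rmax_le : Rmax Rs Ro theta <= Rs + Ro.
Proof.
rewrite /Rmax lerBlDr (@le_trans _ _ Rs)//; last first.
  by rewrite -addrA lerDl addr_ge0 ?sqrtr_ge0// ltW// user_radius_gt0.
by rewrite ler_piMr ?cos_le1// ltW.
Qed.

(** With x = Rs cos theta and y the square root, [Rmax] is x - y and x^2 - y^2 = Rs^2 - Ro^2. Since
    x < Rs and y < Ro, the factor x + y is below Rs + Ro, so x - y exceeds Rs - Ro. *)
Lemma Rmin_lt_Rmax : Rmin Rs Ro < Rmax Rs Ro theta.
Proof.
have Ro0 := user_radius_gt0; have s0 := sin_theta_gt0.
have c0 : 0 < cos theta.
  apply: cos_gt0_pihalf; rewrite thetapi andbT (lt_trans _ theta0)//.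
  by rewrite oppr_lt0 divr_gt0 ?pi_gt0.
rewrite /Rmin /Rmax; set y := Num.sqrt _; set x := Rs * cos theta.
have y2 : y ^+ 2 = Ro ^+ 2 - Rs ^+ 2 * sin theta ^+ 2.
  rewrite sqr_sqrtr// subr_ge0 -exprMn lerXn2r// nnegrE.
    by rewrite mulr_ge0// ltW.
  exact: ltW.
have x2 : x ^+ 2 = Rs ^+ 2 - Rs ^+ 2 * sin theta ^+ 2.
  have -> : x ^+ 2 = Rs ^+ 2 * (1 - sin theta ^+ 2).
    by rewrite exprMn -(cos2Dsin2 theta) addrK.
  by ring.
have x0 : 0 < x by rewrite mulr_gt0.
have y0 : 0 <= y by exact: sqrtr_ge0.
have rs : 0 < Rs ^+ 2 * sin theta ^+ 2 by rewrite mulr_gt0// exprn_gt0.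
have xRs : x < Rs by rewrite -ltr_sqr ?nnegrE ?ltW// x2; lra.
have yRo : y < Ro by rewrite -ltr_sqr ?nnegrE ?y0 ?(ltW Ro0)// y2; lra.
rewrite -(@ltr_pM2r _ (x + y)) ?ltr_pwDl//.
rewrite -subr_sqr x2 y2.
apply: (@lt_le_trans _ _ ((Rs - Ro) * (Rs + Ro))).
  by rewrite ltr_pM2l ?subr_gt0// ltrD.
by rewrite -subr_sqr; lra.
Qed.

Lemma sphere_dist_ge (x : R * R * R) : sphere3 Ro x ->
  Rmin Rs Ro <= dist3 x (typical_sat Rs).
Proof.
case: x => -[x1 x2] x3; rewrite /sphere3/= /dist3/= !subr0 => Rox.
have Ro0 := user_radius_gt0.
have Ro2 : x1 ^+ 2 + x2 ^+ 2 + x3 ^+ 2 = Ro ^+ 2.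
  by rewrite -Rox sqr_sqrtr// !addr_ge0// sqr_ge0.
have x3Ro : x3 <= Ro.
  rewrite leNgt; apply/negP => Rox3.
  have : Ro ^+ 2 < x3 ^+ 2 by rewrite ltr_sqr ?nnegrE ?ltW// (lt_trans Ro0).
  by have := sqr_ge0 x1; have := sqr_ge0 x2; lra.
rewrite -(ger0_norm (ltW Rmin_gt0)) -sqrtr_sqr ler_wsqrtr//.
have : Rs * x3 <= Rs * Ro by rewrite ler_pM2l.
by rewrite /Rmin !sqrrB; lra.
Qed.

Lemma visible_capE (x : R * R * R) : sphere3 Ro x ->
  (x \in visible_cap Rs Ro theta) =
  (dist3 x (typical_sat Rs) <= Rmax Rs Ro theta).
Proof.
by move=> Sx; apply/idP/idP => [/set_mem[]//|h]; apply/mem_set; split.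
Qed.
End visible_geometry.

(** * The nearest visible user *)

Section nearest_distance.
Context {R : realType} d (T : measurableType d).
Variables (Rs Ro theta : R) (Phi : T -> seq (R * R * R)).

Let V := visible_cap Rs Ro theta.
Let D := nearest_dist Rs Ro theta Phi.

Lemma nearest_dist_le_Rmax w : D w <= Rmax Rs Ro theta.
Proof.
rewrite /D /nearest_dist; elim: (Phi w) => [|x s IH]; first by rewrite big_nil.
by rewrite big_cons; case: ifP => // _; rewrite ge_min IH orbT.
Qed.

Lemma nearest_dist_le w x : x \in Phi w -> x \in V ->
  D w <= dist3 x (typical_sat Rs).
Proof.
rewrite /D /nearest_dist; elim: (Phi w) => [//|y s IH].
rewrite inE big_cons => /predU1P[<-|xs] xV; first by rewrite xV ge_min lexx.
by case: ifP => _; rewrite ?ge_min IH// orbT.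
Qed.

Lemma some_visibleE w :
  some_visible Rs Ro theta Phi w <-> exists2 x, x \in Phi w & x \in V.
Proof.
rewrite /some_visible/= /count_pts -has_count; split=> [/hasP[x xP /= xV]|[x xP xV]].
  by exists x.
by apply/hasP; exists x.
Qed.

Lemma nearest_dist_attained w : some_visible Rs Ro theta Phi w ->
  exists x, [/\ x \in Phi w, x \in V & D w = dist3 x (typical_sat Rs)].
Proof.
move=> /some_visibleE; rewrite /D /nearest_dist; elim: (Phi w) => [[] //|y s IH] [x].
rewrite big_cons inE.
have [yV|nyV] := boolP (y \in V); last first.
  move=> /predU1P[-> xV|xs xV]; first by rewrite xV in nyV.
  have [|z [zs zV ->]] := IH; first by exists x.
  by exists z; split=> //; rewrite inE zs orbT.
move=> _ _.
have [sV|nsV] := boolP (has [in V] s); last first.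
  exists y; split=> //; first by rewrite mem_head.
  rewrite -big_filter (_ : [seq i <- s | i \in V] = [::]) ?big_nil; last first.
    by apply/eqP; rewrite -size_eq0 size_filter -leqn0 leqNgt -has_count.
  (* A visible user is within [Rmax], the default of the empty minimum, so the default never beats
     it. *)
  by apply/min_idPl; have /set_mem[] := yV.
have [|z [zs zV zE]] := IH; first by have /hasP[x' x's x'V] := sV; exists x'.
rewrite minEle; case: ifP => _.
  by exists y; rewrite mem_head.
by exists z; rewrite inE zs orbT.
Qed.
End nearest_distance.

(** * Products over users regrouped by cell *)

Section counting_products.
Context {R : realType}.

(** Trades a product of random length over users for one over a fixed number of cells, with the
    counts as exponents. Users beyond the grid have an index not below [N] and must therefore be
    neutral. *)
Lemma prod_by_multiplicity (s : seq nat) N (F : nat -> R) :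
  (forall j, (N <= j)%N -> F j = 1) ->
  \prod_(j <- s) F j = \prod_(j < N) F j ^+ count_mem (j : nat) s.
Proof.
move=> F1; elim: s => [|x s IH].
  by rewrite big_nil big1// => j _; rewrite expr0.
rewrite big_cons IH; under [RHS]eq_bigr do rewrite /= exprD.
rewrite big_split/=; congr (_ * _).
have [xN|Nx] := ltnP x N; last first.
  rewrite F1// big1// => j _; case: eqVneq => [xj|_]; last by rewrite expr0.
  by have := ltn_ord j; rewrite -xj ltnNge Nx.
rewrite (bigD1 (Ordinal xN))//= eqxx expr1 big1 ?mulr1// => j jx.
rewrite (_ : (x == j) = false) ?expr0//; apply/negbTE.
by apply: contra jx => /eqP xj; apply/eqP/val_inj.
Qed.

(** Multiplied over all cells [j], with [k] the count of cell [j], these factors give the indicator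
    that [i] is the first occupied cell. The location of the nearest user thus becomes a product of
    functions of independent counts. *)
Definition first_cell_factor i j k : R :=
  (if (j < i)%N then k == 0%N else (j != i) || (0 < k)%N)%:R.

Lemma first_cell_factor01 i j k : 0 <= first_cell_factor i j k <= 1.
Proof. by rewrite /first_cell_factor; case: (if _ then _ else _); rewrite ?ler01 ?lexx. Qed.

Lemma prod_first_cell_factor i N (s : seq nat) : (i < N)%N ->
  \prod_(j < N) first_cell_factor i j (count_mem (j : nat) s) =
  ((i \in s) && all (leq i) s)%:R.
Proof.
move=> iN; have [/andP[si /allP sall]|] := boolP ((i \in s) && _).
  rewrite big1// => j _; rewrite /first_cell_factor; case: ltnP => [ji|ij].
    rewrite (_ : count_mem _ _ = 0%N)//; apply/count_memPn/negP => /sall.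
    by rewrite leqNgt ji.
  case: eqVneq => //= ->; rewrite -has_count has_pred1 si//.
rewrite negb_and => /orP[si|/allPn[j js]].
  rewrite (bigD1 (Ordinal iN))//= /first_cell_factor ltnn eqxx/=.
  by rewrite (count_memPn si) mul0r.
rewrite -ltnNge => ji.
rewrite (bigD1 (Ordinal (ltn_trans ji iN)))//= /first_cell_factor ji.
rewrite (_ : (count_mem j s == 0%N) = false) ?mul0r//.
by apply/negbTE; rewrite -lt0n -has_count has_pred1.
Qed.

Lemma sum_telescope_above (u : nat -> R) i N : (i < N)%N ->
  \sum_(j < N) (if (i < j)%N then u j - u j.-1 else 0) = u N.-1 - u i.
Proof.
elim: N => // N IH; rewrite ltnS leq_eqVlt big_ord_recr/= => /predU1P[->|iN].
  rewrite ltnn addr0 subrr big1// => j _.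
  by rewrite ltnNge ltnW.
rewrite IH// iN; case: N iN {IH} => // N _ /=; ring.
Qed.
End counting_products.

(** * Distance cells and their Poisson rates *)

Section distance_cells.
Context {R : realType} (Rs lo hi : R).

Definition distance_cell n (x : R * R * R) : nat :=
  grid_cell lo hi n (dist3 x (typical_sat Rs)).

Lemma measurable_dist3 (y : R * R * R) : measurable_fun [set: R * R * R] (dist3 ^~ y).
Proof.
have m1 : measurable_fun [set: R * R * R] (fun x : R * R * R => x.1.1).
  by apply: measurableT_comp => //; exact: measurable_fst.
have m2 : measurable_fun [set: R * R * R] (fun x : R * R * R => x.1.2).
  by apply: measurableT_comp; [exact: measurable_snd|exact: measurable_fst].
have mS : measurable_fun [set: R] (@Num.sqrt R).
  by apply: continuous_measurable_fun; exact: sqrt_continuous.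
apply: (measurableT_comp mS).
apply: measurable_funD; first apply: measurable_funD;
  by apply: measurable_funX; apply: measurable_funB.
Qed.

Lemma measurable_distance_cell n k : lo < hi ->
  measurable (distance_cell n @^-1` [set k]).
Proof.
move=> lohi; apply: measurable_nat_fibre => i.
have [iN|Ni] := ltnP i n.+2; last first.
  rewrite (_ : [set w | _] = set0)//; apply/seteqP; split=> // x /=.
  by rewrite ltnNge (leq_trans (grid_cell_leq _ _ _ _) Ni).
rewrite (_ : [set w | _] =
    (dist3 ^~ (typical_sat Rs)) @^-1` `]grid lo hi n i, +oo[%classic).
  by rewrite -[X in measurable X]setTI; exact: measurable_dist3.
by apply/seteqP; split=> x /=; rewrite in_itv/= andbT /distance_cell ltn_grid_cell.
Qed.

Lemma trivIset_distance_cell n :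
  trivIset setT (fun j => distance_cell n @^-1` [set j]).
Proof.
apply/trivIsetP => i j _ _ /eqP ij; apply/seteqP; split=> // x [/= xi xj].
by apply: ij; rewrite -xi -xj.
Qed.

Lemma count_distance_cell d (T : measurableType d) (Phi : T -> seq (R * R * R)) n j w :
  count_pts Phi (distance_cell n @^-1` [set j]) w =
  count_mem j (map (distance_cell n) (Phi w)).
Proof.
rewrite count_map; apply: eq_count => x /=.
by apply/idP/eqP => [/set_mem|h]; [|exact/mem_set].
Qed.
End distance_cells.

Section cell_area.
Context {R : realType} (Rs Ro theta : R).
Hypotheses (Rs0 : 0 < Rs) (RoRs : Ro < Rs) (theta0 : 0 < theta)
  (thetapi : theta < pi / 2) (vis : Rs * sin theta <= Ro).

Let lo := Rmin Rs Ro.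
Let hi := Rmax Rs Ro theta.
Let lohi : lo < hi. Proof. exact: Rmin_lt_Rmax. Qed.
Let Ro0 : 0 < Ro. Proof. exact: user_radius_gt0 vis. Qed.

Lemma sphere_area_distance_cell lam n j : (j < n.+2)%N ->
  lam * fine (sphere_area Ro (distance_cell Rs lo hi n @^-1` [set j])) =
  2 * pi * lam_tilde Rs Ro lam *
    ((grid lo hi n j ^+ 2 - grid lo hi n j.-1 ^+ 2) / 2).
Proof.
case: j => [_|j].
  (* Cell 0 meets the sphere only in the pole, and the right-hand side vanishes because [0.-1] is
     0. *)
  rewrite (_ : _ @^-1` _ = [set x | dist3 x (typical_sat Rs) <= lo]).
    by rewrite sphere_area_pole ?lexx ?(ltW (Rmin_gt0 _))//= subrr mul0r !mulr0.
  apply/seteqP; split=> x /=; rewrite /distance_cell.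
    by move=> /eqP; rewrite grid_cell0.
  by rewrite -(grid_cell0 lohi n) => /eqP.
rewrite ltnS => jn.
rewrite (_ : _ @^-1` _ = shell Rs (grid lo hi n j) (grid lo hi n j.+1)); last first.
  apply/seteqP; split=> x /=; rewrite /distance_cell /shell/=.
    by move=> /eqP; rewrite grid_cellS.
  by rewrite -(grid_cellS lohi)// => /eqP.
rewrite sphere_area_shell//.
- by rewrite /= /lam_tilde; field; rewrite gt_eqF.
- exact: grid_ge_lo.
- exact: grid_lt.
- by rewrite (le_trans (grid_le_hi _ _))//; exact: Rmax_le.
Qed.

Context d (T : measurableType d) (P : probability T R).
Variables (Phi : T -> seq (R * R * R)) (lam : R) (h K : R -> R) (n : nat) (c : nat -> R).
Hypotheses (ppp : poisson_process_on_sphere P Phi Ro lam)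
  (cP : forall j, (j < n.+2)%N ->
    (grid lo hi n j ^+ 2 - grid lo hi n j.-1 ^+ 2) / 2 * (1 - h (c j)) =
    K (grid lo hi n j) - K (grid lo hi n j.-1)).

Lemma pgf_distance_cell j : (j < n.+2)%N -> 0 <= h (c j) ->
  (\int[P]_w (h (c j) ^+
     count_pts Phi (distance_cell Rs lo hi n @^-1` [set j]) w)%:E =
   (expR (- (2 * pi * lam_tilde Rs Ro lam *
      (K (grid lo hi n j) - K (grid lo hi n j.-1)))))%:E)%E.
Proof.
move=> jn hc0.
have mC := measurable_distance_cell Rs n j lohi.
rewrite (@pgf_poisson _ _ _ P _
  (lam * fine (sphere_area Ro (distance_cell Rs lo hi n @^-1` [set j]))))//.
- by rewrite sphere_area_distance_cell// -mulrA cP.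
- by move=> k; apply: measurable_count_pts => //; exact: (ppp_measurable ppp).
- by move=> k; exact: (ppp_count_law _ ppp).
Qed.
End cell_area.

Section eq_integral_bounded_limits.
Context {R : realType} d (T : measurableType d) (P : probability T R).

Lemma eq_integral_bounded_limits (f_ g_ : nat -> T -> R) (f g : T -> R) :
  (forall n, measurable_fun [set: T] (f_ n)) ->
  (forall n, measurable_fun [set: T] (g_ n)) ->
  (forall n w, 0 <= f_ n w <= 1) -> (forall n w, 0 <= g_ n w <= 1) ->
  (forall w, f_ n w @[n --> \oo] --> f w) ->
  (forall w, g_ n w @[n --> \oo] --> g w) ->
  (forall n, \int[P]_w (f_ n w)%:E = \int[P]_w (g_ n w)%:E)%E ->
  (\int[P]_w (f w)%:E = \int[P]_w (g w)%:E)%E.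
Proof.
move=> mf mg f01 g01 fl gl E.
have L (h_ : nat -> T -> R) h : (forall n, measurable_fun [set: T] (h_ n)) ->
    (forall n w, 0 <= h_ n w <= 1) -> (forall w, h_ n w @[n --> \oo] --> h w) ->
    ((\int[P]_w (h_ n w)%:E)%E @[n --> \oo] --> (\int[P]_w (h w)%:E)%E).
  move=> mh h01 hl.
  apply: (@dominated_cvg _ _ _ P setT measurableT (fun n w => (h_ n w)%:E)
    (fun w => (h w)%:E) (cst 1%:E)) => //.
  - by move=> n; exact/measurable_EFinP.
  - by move=> w _; apply: cvg_EFin; [exact: nearW|exact: hl].
  - exact: finite_measure_integrable_cst.
  - by move=> n w _; have /andP[h0 h1] := h01 n w; rewrite /= lee_fin ger0_norm.
have := L f_ f mf f01 fl; rewrite (funext E) => Lf.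
exact: cvg_unique Lf (L g_ g mg g01 gl).
Qed.
End eq_integral_bounded_limits.

Section cells_of_users.
Context {R : realType} d (T : measurableType d).
Implicit Types (Phi : T -> seq (R * R * R)) (code : R * R * R -> nat).

(** Phrased by cell indices alone, so that its indicator is a function of the configuration, as
    [integral_fading] requires. *)
Definition nearest_in_cell code Phi i : set T :=
  [set w | (i \in map code (Phi w)) && all (leq i) (map code (Phi w))].

Lemma measurable_nearest_in_cell code Phi i :
  (forall E, label_events Phi E -> measurable E) ->
  (forall k, measurable (code @^-1` [set k])) ->
  measurable (nearest_in_cell code Phi i).
Proof.
move=> mPhi mcode.
have := @measurable_fun_fibres _ T _ (fun w => map code (Phi w)) _ bool
  (fun s => (i \in s) && all (leq i) s)
  (fun s => measurable_config s mPhi mcode) measurableT [set true] I.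
by rewrite setTI.
Qed.
End cells_of_users.

(* The fading coefficient of a user in cell [j], [c j] being the distance that
   represents the cell. *)
Definition cell_coeff {R : realType} (alpha q : R) (c : nat -> R)
    (inside : pred nat) j : R :=
  if inside j then q * c j `^ (- alpha) else 0.

Lemma cell_coeff_ge0 (R : realType) (alpha q : R) c inside j : 0 <= q ->
  0 <= cell_coeff alpha q c inside j.
Proof.
by move=> q0; rewrite /cell_coeff; case: ifP => // _; rewrite mulr_ge0// powR_ge0.
Qed.

(** Strict at [i]: users sharing the cell of the nearest one are dropped as well, which disappears
    in the limit. The bound [N] removes the users beyond [Rmax]. *)
Definition cells_above N i : pred nat := fun j => (i < j < N)%N.
Definition cells_below N : pred nat := fun j => (j < N)%N.

(** * The discretized network and its limit *)

Section discretized_network.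
Context {R : realType} d (T : measurableType d) (P : probability T R).
Variables (Rs Rus Rut theta lam_us lam_ut alpha q1 q2 b Omega : R) (m : nat).
Variables (Phi1 Phi2 : T -> seq (R * R * R)) (H1 H2 : nat -> {RV P >-> R}).
Hypotheses (Rs0 : 0 < Rs) (Rus_lt : Rus < Rs) (Rut_lt : Rut < Rs)
  (theta0 : 0 < theta) (thetapi : theta < pi / 2)
  (Rus_vis : Rs * sin theta <= Rus) (Rut_vis : Rs * sin theta <= Rut)
  (lam_us0 : 0 < lam_us) (lam_ut0 : 0 < lam_ut) (q10 : 0 <= q1) (q20 : 0 <= q2)
  (b0 : 0 < b) (m0 : (0 < m)%N) (Omega0 : 0 < Omega).
Hypotheses (ppp1 : poisson_process_on_sphere P Phi1 Rus lam_us)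
  (ppp2 : poisson_process_on_sphere P Phi2 Rut lam_ut)
  (indep12 : independent2 P <<s count_events Phi1 >> <<s count_events Phi2 >>)
  (lawH1 : forall l, shadowed_rician_power P (H1 l) b m Omega)
  (lawH2 : forall k, shadowed_rician_power P (H2 k) b m Omega)
  (fading_indep : mutually_independent P (network_sigma Phi1 Phi2 H1 H2)).

Local Notation psi := (sr_laplace_sum b m Omega).
Local Notation lo1 := (Rmin Rs Rus).
Local Notation hi1 := (Rmax Rs Rus theta).
Local Notation lo2 := (Rmin Rs Rut).
Local Notation hi2 := (Rmax Rs Rut theta).
Local Notation kap1 := (2 * pi * lam_tilde Rs Rus lam_us).
Local Notation kap2 := (2 * pi * lam_tilde Rs Rut lam_ut).

Let lohi1 : lo1 < hi1. Proof. exact: Rmin_lt_Rmax. Qed.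
Let lohi2 : lo2 < hi2. Proof. exact: Rmin_lt_Rmax. Qed.

(** Total mass of the fading law. Users with coefficient 0 hence contribute the factor 1. *)
Lemma sr_laplace_sum0 : psi 0 = 1.
Proof.
apply: EFin_inj.
rewrite -(laplace_shadowed_rician b0 Omega0 m0 (measurable_funP (H1 0)) (lawH1 0) (lexx 0)).
under eq_integral do rewrite mul0r oppr0 expR0.
exact: etrans (integral_cst P measurableT 1%:E) (etrans (mul1e _) (probability_setT P)).
Qed.

Let psi01 a : 0 <= a -> 0 <= psi a <= 1.
Proof.
move=> a0; rewrite sr_laplace_sum_ge0//=.
exact: (sr_laplace_sum_le1 b0 Omega0 m0 (measurable_funP (H1 0)) (lawH1 0)).
Qed.

Section fixed_grid.
Variables (K1 K2 : R -> R) (n : nat) (c1 c2 : nat -> R).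
Hypotheses (c1P : forall j, (j < n.+2)%N ->
    (grid lo1 hi1 n j ^+ 2 - grid lo1 hi1 n j.-1 ^+ 2) / 2 *
      (1 - psi (q1 * c1 j `^ (- alpha))) =
    K1 (grid lo1 hi1 n j) - K1 (grid lo1 hi1 n j.-1))
  (c2P : forall j, (j < n.+2)%N ->
    (grid lo2 hi2 n j ^+ 2 - grid lo2 hi2 n j.-1 ^+ 2) / 2 *
      (1 - psi (q2 * c2 j `^ (- alpha))) =
    K2 (grid lo2 hi2 n j) - K2 (grid lo2 hi2 n j.-1)).

Local Notation code1 := (distance_cell Rs lo1 hi1 n).
Local Notation code2 := (distance_cell Rs lo2 hi2 n).

Definition grid_transmittance (w : T) i : R :=
  \prod_(l < size (Phi1 w)) expR (- (cell_coeff alpha q1 c1 (cells_above n.+2 i)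
     (code1 (Phi1 w)`_l) * Num.sqrt (H1 l w) ^+ 2)) *
  \prod_(l < size (Phi2 w)) expR (- (cell_coeff alpha q2 c2 (cells_below n.+2)
     (code2 (Phi2 w)`_l) * Num.sqrt (H2 l w) ^+ 2)).

Let a1 i := cell_coeff alpha q1 c1 (cells_above n.+2 i).
Let a2 := cell_coeff alpha q2 c2 (cells_below n.+2).
Let mcode1 k : measurable (code1 @^-1` [set k]).
Proof. exact: measurable_distance_cell. Qed.
Let mcode2 k : measurable (code2 @^-1` [set k]).
Proof. exact: measurable_distance_cell. Qed.

Let prod_psi (Phi : T -> seq (R * R * R)) code (a : nat -> R) w :
  (forall j, (n.+2 <= j)%N -> a j = 0) ->
  (forall j, count_pts Phi (code @^-1` [set j]) w = count_mem j (map code (Phi w))) ->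
  \prod_(x <- Phi w) psi (a (code x)) =
  \prod_(j < n.+2) psi (a j) ^+ count_pts Phi (code @^-1` [set (j : nat)]) w.
Proof.
move=> aN cE; rewrite -(big_map code xpredT (fun j => psi (a j))).
rewrite (@prod_by_multiplicity _ _ n.+2); last first.
  by move=> j /aN ->; exact: sr_laplace_sum0.
by apply: eq_bigr => j _; rewrite cE.
Qed.

Let prod_gamma i w : (i < n.+2)%N ->
  \prod_(j < n.+2) (first_cell_factor i j (count_pts Phi1 (code1 @^-1` [set (j : nat)]) w) : R)
  = \1_(nearest_in_cell code1 Phi1 i) w.
Proof.
move=> iN; under eq_bigr do rewrite count_distance_cell.
rewrite prod_first_cell_factor// indicE; congr (nat_of_bool _)%:R.
by apply/idP/idP => [h|/set_mem//]; exact/mem_set.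
Qed.

Lemma measurable_grid_transmittance i :
  measurable_fun [set: T] (grid_transmittance ^~ i).
Proof.
apply: measurable_fading_prod => //.
- exact: ppp_measurable ppp1.
- exact: ppp_measurable ppp2.
Qed.

Lemma grid_transmittance01 w i : 0 <= grid_transmittance w i <= 1.
Proof.
have P01 (S : Type) (r : seq S) (x y : S -> R) : (forall l, 0 <= x l) ->
    0 <= \prod_(l <- r) expR (- (x l * Num.sqrt (y l) ^+ 2)) <= 1.
  move=> x0; elim: r => [|l r /andP[IH0 IH1]]; first by rewrite big_nil ler01 lexx.
  rewrite big_cons mulr_ge0 ?expR_ge0// mulr_ile1 ?expR_ge0//.
  by rewrite expR_le1 oppr_le0 mulr_ge0 ?sqr_ge0.
have /andP[p0 p1] := P01 _ (index_enum 'I_(size (Phi1 w)))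
  (fun l => cell_coeff alpha q1 c1 (cells_above n.+2 i) (code1 (Phi1 w)`_l))
  (fun l => H1 l w) (fun l => cell_coeff_ge0 _ _ _ _ q10).
have /andP[p2 p3] := P01 _ (index_enum 'I_(size (Phi2 w)))
  (fun l => cell_coeff alpha q2 c2 (cells_below n.+2) (code2 (Phi2 w)`_l))
  (fun l => H2 l w) (fun l => cell_coeff_ge0 _ _ _ _ q20).
by rewrite /grid_transmittance mulr_ge0// mulr_ile1.
Qed.

(** Each cell carries at most one nontrivial factor: an occupancy condition up to cell [i], a power
    of [psi] after it. Independence of the counts splits the integral into the probability of the
    event and generating functions whose exponents telescope. *)
Lemma integral_grid_transmittance i : (i < n.+2)%N ->
  (\int[P]_(w in nearest_in_cell code1 Phi1 i) (grid_transmittance w i)%:E =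
   P (nearest_in_cell code1 Phi1 i) *
     (expR (- (kap1 * (K1 hi1 - K1 (grid lo1 hi1 n i)))
            - kap2 * (K2 hi2 - K2 lo2)))%:E)%E.
Proof.
move=> iN.
have mPhi1 := ppp_measurable ppp1.
have mPhi2 := ppp_measurable ppp2.
have a1N j : (n.+2 <= j)%N -> a1 i j = 0.
  by move=> nj; rewrite /a1 /cell_coeff /cells_above (ltnNge j) nj andbF.
have a2N j : (n.+2 <= j)%N -> a2 j = 0.
  by move=> nj; rewrite /a2 /cell_coeff /cells_below (ltnNge j) nj.
have a10 j : 0 <= a1 i j by exact: cell_coeff_ge0.
have a20 j : 0 <= a2 j by exact: cell_coeff_ge0.
pose N1 j w := count_pts Phi1 (code1 @^-1` [set j]) w.
pose N2 j w := count_pts Phi2 (code2 @^-1` [set j]) w.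
pose phi (o : nat + nat) k : R := match o with
  | inl j => first_cell_factor i j k * psi (a1 i j) ^+ k
  | inr j => psi (a2 j) ^+ k end.
have phi01 o k : 0 <= phi o k <= 1.
  case: o => j /=; last first.
    have /andP[p0 p1] := psi01 (a20 j).
    by rewrite exprn_ge0// exprn_ile1.
  have /andP[p0 p1] := psi01 (a10 j).
  have /andP[f0 f1] := @first_cell_factor01 R i j k.
  by rewrite mulr_ge0 ?exprn_ge0// mulr_ile1 ?exprn_ge0// exprn_ile1.
rewrite -integral_indicM.
pose g (s : seq nat * seq nat) : R := ((i \in s.1) && all (leq i) s.1)%:R.
transitivity (\int[P]_w (g (map code1 (Phi1 w), map code2 (Phi2 w)) *
   grid_transmittance w i)%:E)%E.
  apply: eq_integral => w _; rewrite mulrC; congr (_ * _)%:E; rewrite indicE /g/=.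
  by congr (nat_of_bool _)%:R; apply/idP/idP => [/set_mem//|h]; exact/mem_set.
rewrite (integral_fading b0 Omega0 m0 lawH1 lawH2 fading_indep mPhi1 mPhi2
  mcode1 mcode2 _ a10 a20)//.
transitivity (\int[P]_w (\prod_(j < n.+2) phi (inl (j : nat)) (N1 j w) *
   \prod_(j < n.+2) phi (inr (j : nat)) (N2 j w))%:E)%E.
  apply: eq_integral => w _; rewrite mulrA; congr (_ * _)%:E.
    rewrite /= big_split/= prod_gamma// -/(a1 i) prod_psi//.
      congr (_ * _); rewrite indicE /g/=.
      by congr (nat_of_bool _)%:R; apply/idP/idP => [h|/set_mem//]; exact/mem_set.
    by move=> j; rewrite count_distance_cell.
  by apply: prod_psi => // j; rewrite count_distance_cell.
rewrite (integral_prod_counts ppp1 ppp2 indep12 mcode1 mcode2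
  (@trivIset_distance_cell _ _ _ _ n) (@trivIset_distance_cell _ _ _ _ n)
  n.+2 n.+2 phi01).
(* The integral of the product splits for a trivial reason: for [j <= i] the coefficient is 0 and
   [psi 0 = 1], for [j > i] the occupancy factor is 1. *)
have E1 (j : 'I_n.+2) : (\int[P]_w (phi (inl (j : nat)) (N1 j w))%:E =
   \int[P]_w (first_cell_factor i j (N1 j w))%:E *
   (expR (- (kap1 * (if (i < j)%N then
       K1 (grid lo1 hi1 n j) - K1 (grid lo1 hi1 n j.-1) else 0))))%:E)%E.
  have [ij|ji] := ltnP i j; last first.
    rewrite mulr0 oppr0 expR0 mule1; apply: eq_integral => w _ /=.
    by rewrite /a1 /cell_coeff /cells_above ltnNge ji/= sr_laplace_sum0 expr1n mulr1.
  have F1 k : first_cell_factor i j k = 1 :> R.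
    by rewrite /first_cell_factor ltnNge (ltnW ij)/= gtn_eqF.
  under [X in (X * _)%E]eq_integral do rewrite F1.
  rewrite (etrans (integral_cst P measurableT 1%:E) (etrans (mul1e _) (probability_setT P))).
  rewrite mul1e.
  rewrite -(pgf_distance_cell Rs0 Rus_lt theta0 thetapi Rus_vis
     (h := fun v => psi (q1 * v `^ (- alpha))) ppp1 c1P (ltn_ord j)); last first.
    by have /andP[] := psi01 (a10 j); rewrite /a1 /cell_coeff /cells_above ij ltn_ord.
  apply: eq_integral => w _ /=; rewrite F1 mul1r /a1 /cell_coeff /cells_above.
  by rewrite ij ltn_ord.
have E2 (j : 'I_n.+2) : (\int[P]_w (phi (inr (j : nat)) (N2 j w))%:E =
   (expR (- (kap2 * (K2 (grid lo2 hi2 n j) - K2 (grid lo2 hi2 n j.-1)))))%:E)%E.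
  rewrite -(pgf_distance_cell Rs0 Rut_lt theta0 thetapi Rut_vis
     (h := fun v => psi (q2 * v `^ (- alpha))) ppp2 c2P (ltn_ord j)); last first.
    by have /andP[] := psi01 (a20 j); rewrite /a2 /cell_coeff /cells_below ltn_ord.
  apply: eq_integral => w _ /=; rewrite /a2 /cell_coeff /cells_below.
  by rewrite ltn_ord.
under eq_bigr do rewrite E1.
under [X in (_ * X)%E]eq_bigr do rewrite E2.
rewrite big_split/= !prodEFin -muleA -EFinM; congr (_ * _)%E.
  (* The occupancy factors are reassembled: independence read backwards, with no cell of the second
     process, turns the product of their integrals into the probability of the event. *)
  pose phi' (o : nat + nat) k : R := match o with
    | inl j => first_cell_factor i j k | inr j => 1 end.
  have phi'01 o k : 0 <= phi' o k <= 1.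
    by case: o => j; [exact: first_cell_factor01|rewrite ler01 lexx].
  have := integral_prod_counts ppp1 ppp2 indep12 mcode1 mcode2
    (@trivIset_distance_cell _ _ _ _ n) (@trivIset_distance_cell _ _ _ _ n)
    n.+2 0 phi'01.
  rewrite big_ord0 mule1 => <-.
  transitivity (\int[P]_w (\1_(nearest_in_cell code1 Phi1 i) w)%:E)%E; last first.
    by rewrite integral_indic ?setIT//; apply: measurable_nearest_in_cell.
  apply: eq_integral => w _; rewrite big_ord0 mulr1.
  by rewrite /phi'/= prod_gamma.
congr EFin; rewrite -!expR_sum -expRD; congr expR.
rewrite !sumrN -!mulr_sumr; congr (- (_ * _) - _ * _).
  by rewrite (sum_telescope_above (fun j => K1 (grid lo1 hi1 n j)))//= grid_last.
rewrite big_ord_recl/= subrr add0r.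
have := @telescope_sumr _ 0 n.+1 (fun j => K2 (grid lo2 hi2 n j)) isT.
by rewrite big_mkord grid0 grid_last => ->.
Qed.
End fixed_grid.

Section grid_limit.
Variables (K1 K2 : R -> R) (c1 c2 : nat -> nat -> R).
Hypotheses (c1P : forall n j, (j < n.+2)%N ->
    grid lo1 hi1 n j.-1 <= c1 n j <= grid lo1 hi1 n j /\
    (grid lo1 hi1 n j ^+ 2 - grid lo1 hi1 n j.-1 ^+ 2) / 2 *
      (1 - psi (q1 * c1 n j `^ (- alpha))) =
    K1 (grid lo1 hi1 n j) - K1 (grid lo1 hi1 n j.-1))
  (c2P : forall n j, (j < n.+2)%N ->
    grid lo2 hi2 n j.-1 <= c2 n j <= grid lo2 hi2 n j /\
    (grid lo2 hi2 n j ^+ 2 - grid lo2 hi2 n j.-1 ^+ 2) / 2 *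
      (1 - psi (q2 * c2 n j `^ (- alpha))) =
    K2 (grid lo2 hi2 n j) - K2 (grid lo2 hi2 n j.-1))
  (cK1 : forall x, lo1 <= x <= hi1 -> {for x, continuous K1})
  (K1le : forall x, lo1 <= x <= hi1 -> K1 x <= K1 hi1)
  (K2le : K2 lo2 <= K2 hi2).

Local Notation D := (nearest_dist Rs Rus theta Phi1).
Local Notation A := (some_visible Rs Rus theta Phi1).
Local Notation dist := (fun x => dist3 x (typical_sat Rs)).

Let lo1_gt0 : 0 < lo1. Proof. exact: Rmin_gt0. Qed.
Let lo2_gt0 : 0 < lo2. Proof. exact: Rmin_gt0. Qed.

Lemma nearest_dist_itv w : A w -> lo1 <= D w <= hi1.
Proof.
move=> /nearest_dist_attained[x [xP /set_mem[Sx xhi] ->]].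
by rewrite (sphere_dist_ge Rs0 Rus_lt theta0 thetapi Rus_vis Sx).
Qed.

(** Invisible users lie beyond [Rmax], which bounds [D]. They have to be covered because the lists
    of cell indices contain all users. *)
Lemma nearest_dist_le_all w x : A w -> x \in Phi1 w -> D w <= dist x.
Proof.
move=> Aw xP; have [xV|] := boolP (x \in visible_cap Rs Rus theta).
  exact: nearest_dist_le.
rewrite (@visible_capE _ Rs Rus theta x (ppp_on_sphere ppp1 xP)) -ltNge => /ltW.
by apply: le_trans; exact: nearest_dist_le_Rmax.
Qed.

(** The cell index is monotone in the distance, so the least cell is the cell of the least distance;
    [i < n.+2] forces a user in it to be visible. *)
Lemma nearest_in_cellE n i : (i < n.+2)%N ->
  nearest_in_cell (distance_cell Rs lo1 hi1 n) Phi1 i =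
  A `&` [set w | grid_cell lo1 hi1 n (D w) = i].
Proof.
move=> iN; apply/seteqP; split=> w /=.
  move=> /andP[/mapP[x xP xi] /allP sall].
  have xhi : dist x <= hi1 by rewrite -(grid_cell_lt lohi1 n) -/(distance_cell _ _ _ _ _) -xi.
  have Aw : A w.
    by apply/some_visibleE; exists x => //; rewrite (@visible_capE _ Rs Rus theta x (ppp_on_sphere ppp1 xP)).
  split=> //; apply/eqP; rewrite eqn_leq; apply/andP; split.
    by rewrite xi; apply: grid_cell_mono; exact: nearest_dist_le_all.
  have [y [yP _ ->]] := nearest_dist_attained Aw.
  by apply: sall; apply/mapP; exists y.
move=> [Aw Di]; apply/andP; split.
  by have [y [yP _ Dy]] := nearest_dist_attained Aw; apply/mapP; exists y; rewrite // -Di Dy.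
apply/allP => _ /mapP[x xP ->]; rewrite -Di.
by apply: grid_cell_mono; exact: nearest_dist_le_all.
Qed.

Lemma nearest_dist_cell_lt n w : (grid_cell lo1 hi1 n (D w) < n.+2)%N.
Proof. by rewrite grid_cell_lt// nearest_dist_le_Rmax. Qed.

Lemma measurable_some_visible : measurable A.
Proof.
rewrite (_ : A = ~` (count_pts Phi1 (visible_cap Rs Rus theta) @^-1` [set 0%N])).
  apply: measurableC; apply: measurable_count_pts; first exact: ppp_measurable ppp1.
  rewrite (_ : visible_cap _ _ _ = (dist3 ^~ (0, 0, 0)) @^-1` [set Rus] `&`
    (dist3 ^~ (typical_sat Rs)) @^-1` `]-oo, hi1]%classic).
    by apply: measurableI; rewrite -[X in measurable X]setTI; exact: measurable_dist3.
  by apply/seteqP; split=> x /=; rewrite /visible_cap /cap/= in_itv.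
by apply/seteqP; split=> w /=; rewrite /some_visible/= lt0n => /eqP.
Qed.

Definition user_coeff (q : R) (inside : bool) v : R :=
  if inside then q * v `^ (- alpha) else 0.

(** The exponential of the interference without noise. The fading is a parameter because it is taken
    both as [H] and as the square of [Num.sqrt H]. *)
Definition transmittance (F1 F2 : nat -> T -> R) w : R :=
  \prod_(l < size (Phi1 w))
    expR (- (user_coeff q1 (D w < dist (Phi1 w)`_l <= hi1) (dist (Phi1 w)`_l)
             * F1 l w)) *
  \prod_(l < size (Phi2 w))
    expR (- (user_coeff q2 (dist (Phi2 w)`_l <= hi2) (dist (Phi2 w)`_l)
             * F2 l w)).

Definition conditional_transmittance r : R :=
  expR (- (kap1 * (K1 hi1 - K1 r)) - kap2 * (K2 hi2 - K2 lo2)).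

Lemma cvg_prodr (I S : Type) (F : set_system S) (r : seq I) (Q : pred I)
    (f : I -> S -> R) (l : I -> R) : Filter F ->
  (forall i, Q i -> f i x @[x --> F] --> l i) ->
  \prod_(i <- r | Q i) f i x @[x --> F] --> \prod_(i <- r | Q i) l i.
Proof. by move=> FF; apply: cvg_big; exact: mul_continuous. Qed.

Let cvg_cell_coeff q (c : nat -> nat -> R) (lo hi v : R) : 0 < lo -> lo < hi -> lo <= v <= hi ->
  (forall n j, (j < n.+2)%N -> grid lo hi n j.-1 <= c n j <= grid lo hi n j) ->
  q * c n (grid_cell lo hi n v) `^ (- alpha) @[n --> \oo] --> q * v `^ (- alpha).
Proof.
move=> lo0 lohi vlh cP; apply: cvgMl_tmp.
have v0 : 0 < v by case/andP: vlh => lov _; exact: lt_le_trans lov.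
exact: cvg_comp (cvg_in_grid_cell lohi vlh cP) (powR_continuous_gt0 v0).
Qed.

Lemma cvg_grid_transmittance w : A w ->
  grid_transmittance n (c1 n) (c2 n) w (grid_cell lo1 hi1 n (D w)) @[n --> \oo]
  --> transmittance (fun l w => Num.sqrt (H1 l w) ^+ 2) (fun l w => Num.sqrt (H2 l w) ^+ 2) w.
Proof.
move=> Aw; have Dlh := nearest_dist_itv Aw.
have E (a : nat -> R) (l y : R) : a n @[n --> \oo] --> l ->
    expR (- (a n * Num.sqrt y ^+ 2)) @[n --> \oo] --> expR (- (l * Num.sqrt y ^+ 2)).
  move=> al; have al' : - (a n * Num.sqrt y ^+ 2) @[n --> \oo] --> - (l * Num.sqrt y ^+ 2).
    by apply: cvgN; apply: cvgMr_tmp.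
  exact: cvg_comp al' (@continuous_expR R _).
apply: cvgM; apply: cvg_prodr => l _; apply: E.
- set x := (Phi1 w)`_l; have xP : x \in Phi1 w by rewrite mem_nth.
  have Dx := nearest_dist_le_all Aw xP.
  rewrite /user_coeff /cell_coeff /cells_above /distance_cell.
  have [xhi|hix] := leP (dist x) hi1; last first.
    under eq_fun do rewrite grid_cell_lt// leNgt hix andbF.
    by rewrite andbF; exact: cvg_cst.
  (* A user exactly as far as the nearest one shares its cell for every n, and its coefficient is 0
     before and in the limit. *)
  rewrite andbT; move: Dx; rewrite le_eqVlt => /predU1P[<-|Dx].
    by rewrite ltxx; under eq_fun do rewrite ltnn; exact: cvg_cst.
  rewrite Dx.
  have xlh : lo1 <= dist x <= hi1.
    by rewrite xhi andbT (le_trans _ (ltW Dx))//; case/andP: Dlh.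
  have := @cvg_cell_coeff q1 c1 _ _ _ lo1_gt0 lohi1 xlh (fun n j jn => (c1P jn).1).
  apply: cvg_trans; apply: near_eq_cvg.
  have : \forall n \near \oo, grid_step lo1 hi1 n < dist x - D w.
    by apply: (cvgr_lt (0 : R)); [exact: cvg_grid_step|rewrite subr_gt0].
  apply: filterS => n nx.
  by rewrite grid_cell_separates// grid_cell_lt// xhi.
- set x := (Phi2 w)`_l; have xP : x \in Phi2 w by rewrite mem_nth.
  rewrite /user_coeff /cell_coeff /cells_below /distance_cell.
  under eq_fun do rewrite grid_cell_lt//.
  case: ifPn => xhi; last exact: cvg_cst.
  apply: (@cvg_cell_coeff q2 c2 _ _ _ lo2_gt0 lohi2 _ (fun n j jn => (c2P jn).1)).
  by rewrite xhi andbT; exact: (sphere_dist_ge Rs0 Rut_lt theta0 thetapi Rut_vis (ppp_on_sphere ppp2 xP)).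
Qed.

Lemma conditional_transmittance01 r : lo1 <= r <= hi1 ->
  0 <= conditional_transmittance r <= 1.
Proof.
move=> rlh; rewrite /conditional_transmittance expR_ge0/= expR_le1.
have k0 Ro lam : 0 < Ro -> 0 < lam -> 0 <= 2 * pi * lam_tilde Rs Ro lam.
  by move=> Ro0 l0; rewrite /lam_tilde !mulr_ge0 ?pi_ge0 ?invr_ge0 ?(ltW Ro0) ?(ltW l0) ?(ltW Rs0).
rewrite subr_le0 (@le_trans _ _ 0)//.
  rewrite oppr_le0 mulr_ge0 ?subr_ge0 ?K1le// k0//; exact: user_radius_gt0 Rus_vis.
by rewrite mulr_ge0 ?subr_ge0// k0//; exact: user_radius_gt0 Rut_vis.
Qed.

(** The shift by one reserves 0 for the absence of a visible user, so that a single countable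
    partition covers the whole space. *)
Let cell_or_none n w : nat := if w \in A then (grid_cell lo1 hi1 n (D w)).+1 else 0.

Let cell_or_none0 n : cell_or_none n @^-1` [set 0%N] = ~` A.
Proof.
apply/seteqP; split=> w /=; rewrite /cell_or_none.
  by case: ifPn => // /negP h _ Aw; apply: h; exact/mem_set.
by move=> nA; rewrite memNset.
Qed.

Let cell_or_noneS n k : cell_or_none n @^-1` [set k.+1] =
  if (k < n.+2)%N then nearest_in_cell (distance_cell Rs lo1 hi1 n) Phi1 k else set0.
Proof.
case: ifPn => [kn|nk].
  rewrite nearest_in_cellE//; apply/seteqP; split=> w /=; rewrite /cell_or_none.
    by case: ifPn => // /set_mem Aw [].
  by move=> [Aw ->]; rewrite mem_set.
apply/seteqP; split=> // w /=; rewrite /cell_or_none; case: ifPn => // _ [] kE.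
by move: nk; rewrite -kE nearest_dist_cell_lt.
Qed.

Let measurable_cell_or_none n k : measurable (cell_or_none n @^-1` [set k]).
Proof.
case: k => [|k].
  by rewrite cell_or_none0; apply: measurableC; exact: measurable_some_visible.
rewrite cell_or_noneS; case: ifP => // _.
apply: measurable_nearest_in_cell; first exact: ppp_measurable ppp1.
by move=> j; exact: measurable_distance_cell.
Qed.

Lemma integral_transmittance_below t :
  (\int[P]_w (\1_A w * (D w < t)%R%:R * transmittance (fun l w => Num.sqrt (H1 l w) ^+ 2)
     (fun l w => Num.sqrt (H2 l w) ^+ 2) w)%:E =
   \int[P]_w (\1_A w * (D w < t)%R%:R * conditional_transmittance (D w))%:E)%E.
Proof.
(* The upper end of the cell: constant on the event of a cell and never below [D w]. Hence the
   indicator of [G n w < t] converges to that of [D w < t] even where [D w = t], and nothing about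
   atoms of the law of [D] is needed. *)
pose G n w := grid lo1 hi1 n (grid_cell lo1 hi1 n (D w)).
pose f_ n w := \1_A w * (G n w < t)%R%:R *
  grid_transmittance n (c1 n) (c2 n) w (grid_cell lo1 hi1 n (D w)).
pose g_ n w := \1_A w * (G n w < t)%R%:R * conditional_transmittance (G n w).
have Glh n w : lo1 <= G n w <= hi1.
  by rewrite /G grid_ge_lo// grid_le_hi// nearest_dist_cell_lt.
have cellP n w : A w -> cell_or_none n w = (grid_cell lo1 hi1 n (D w)).+1.
  by move=> Aw; rewrite /cell_or_none mem_set.
have on_cell n k : cell_or_none n @^-1` [set k.+1] `<=`
    [set w | A w /\ grid_cell lo1 hi1 n (D w) = k].
  by move=> w /=; rewrite /cell_or_none; case: ifPn => // /set_mem Aw [].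
have on_none n w : (cell_or_none n @^-1` [set 0%N]) w -> \1_A w = 0 :> R.
  by rewrite cell_or_none0 => nA; rewrite indicE memNset.
have mt n k : measurable_fun [set: T] (fun w => grid_transmittance n (c1 n) (c2 n) w k).
  exact: measurable_grid_transmittance.
have mf n : measurable_fun [set: T] (f_ n).
  apply: (measurable_fun_on_fibres (@measurable_cell_or_none n)) => -[|k].
    apply: (eq_measurable_fun (fun _ : T => 0 : R)); last exact: measurable_cst.
    by move=> w /set_mem /on_none w0; rewrite /f_ w0 !mul0r.
  apply: (eq_measurable_fun (fun w => (grid lo1 hi1 n k < t)%R%:R *
    grid_transmittance n (c1 n) (c2 n) w k)).
    move=> w /set_mem /on_cell[Aw Dk].
    by rewrite /f_ /G Dk indicE mem_set// mul1r.
  by apply: measurable_funTS; exact: measurable_funM.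
have mg n : measurable_fun [set: T] (g_ n).
  apply: (measurable_fun_on_fibres (@measurable_cell_or_none n)) => -[|k].
    apply: (eq_measurable_fun (fun _ : T => 0 : R)); last exact: measurable_cst.
    by move=> w /set_mem /on_none w0; rewrite /g_ w0 !mul0r.
  apply: (eq_measurable_fun (fun _ : T => ((grid lo1 hi1 n k < t)%R%:R *
    conditional_transmittance (grid lo1 hi1 n k)))); last exact: measurable_cst.
  move=> w /set_mem /on_cell[Aw Dk].
  by rewrite /g_ /G Dk indicE mem_set// mul1r.
have GD w : A w -> G n w @[n --> \oo] --> D w.
  by move=> Aw; apply: cvg_grid_cell => //; exact: nearest_dist_itv.
have Gt w : A w -> (\1_A w * (G n w < t)%R%:R : R) @[n --> \oo] -->
    (\1_A w * (D w < t)%R%:R : R).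
  move=> Aw; apply: cvgMl_tmp; have [Dt|tD] := ltP (D w) t.
    apply: (@cvg_trans _ ((1 : R) @[n --> \oo])); last exact: cvg_cst.
    apply: near_eq_cvg; have : \forall n \near \oo, G n w < t.
      by apply: (cvgr_lt (D w)) => //; exact: GD.
    by apply: filterS => n ->.
  under eq_fun => n.
    rewrite ltNge (le_trans tD)/=; last first.
      by apply: grid_cell_ge => //; exact: nearest_dist_le_Rmax.
    over.
  exact: cvg_cst.
have b01 (x y : bool) (z : R) : 0 <= z <= 1 -> 0 <= x%:R * y%:R * z <= 1.
  by move=> z01; case: x; case: y; rewrite ?mul1r ?mul0r ?lexx ?ler01.
have t01 n w k : 0 <= grid_transmittance n (c1 n) (c2 n) w k <= 1.
  exact: grid_transmittance01.
apply: (@eq_integral_bounded_limits _ _ _ P f_ g_) => //.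
- by move=> n w; rewrite /f_ indicE; exact: b01.
- by move=> n w; rewrite /g_ indicE; apply/b01/conditional_transmittance01.
- move=> w; rewrite /f_; have [Aw|nA] := pselect (A w); last first.
    rewrite indicE memNset// !mul0r; under eq_fun do rewrite !mul0r.
    exact: cvg_cst.
  by apply: cvgM; [exact: Gt|exact: cvg_grid_transmittance].
- move=> w; rewrite /g_; have [Aw|nA] := pselect (A w); last first.
    rewrite indicE memNset// !mul0r; under eq_fun do rewrite !mul0r.
    exact: cvg_cst.
  apply: cvgM; first exact: Gt.
  suff cE : - (kap1 * (K1 hi1 - K1 (G n w))) - kap2 * (K2 hi2 - K2 lo2) @[n --> \oo]
      --> - (kap1 * (K1 hi1 - K1 (D w))) - kap2 * (K2 hi2 - K2 lo2).
    exact: cvg_comp cE (@continuous_expR R _).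
  apply: cvgB; last exact: cvg_cst.
  apply: cvgN; apply: cvgMl_tmp; apply: cvgB; first exact: cvg_cst.
  exact: cvg_comp (GD w Aw) (cK1 (nearest_dist_itv Aw)).
- move=> n; apply: (eq_integral_fibres (c := cell_or_none n)) => //.
  + exact/measurable_EFinP.
  + exact/measurable_EFinP.
  + by move=> w; rewrite lee_fin /f_ indicE; case/andP: (b01 (w \in A) (G n w < t) _ (t01 n w (grid_cell lo1 hi1 n (D w)))).
  + by move=> w; rewrite lee_fin /g_ indicE; case/andP: (b01 (w \in A) (G n w < t) _ (conditional_transmittance01 (Glh n w))).
  + case=> [|k].
      by apply: eq_integral => w /set_mem /on_none w0; rewrite /f_ /g_ w0 !mul0r.
    have /= := @cell_or_noneS n k; case: ifPn => [kn|_] fibE; last first.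
      by rewrite fibE !integral_set0.
    have inN w : nearest_in_cell (distance_cell Rs lo1 hi1 n) Phi1 k w ->
        A w /\ grid_cell lo1 hi1 n (D w) = k.
      by rewrite nearest_in_cellE// => -[].
    rewrite fibE.
    have mN : measurable (nearest_in_cell (distance_cell Rs lo1 hi1 n) Phi1 k).
      by rewrite -fibE; exact: measurable_cell_or_none.
    set N := nearest_in_cell _ _ _ in inN mN *.
    pose e : R := (grid lo1 hi1 n k < t)%R%:R.
    transitivity (\int[P]_(w in N) (e%:E *
        (grid_transmittance n (c1 n) (c2 n) w k)%:E))%E.
      apply: eq_integral => w /set_mem /inN[Aw Dk].
      by rewrite /f_ /G Dk indicE mem_set// mul1r EFinM.
    rewrite ge0_integralZl//; last 3 first.
    + by apply: measurable_funTS; apply/measurable_EFinP; exact: mt.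
    + by move=> w _; rewrite lee_fin; case/andP: (t01 n w k).
    + by rewrite lee_fin.
    rewrite (integral_grid_transmittance (fun j jn => (c1P jn).2) (fun j jn => (c2P jn).2))//.
    transitivity (\int[P]_(w in N) cst (e * conditional_transmittance (grid lo1 hi1 n k))%:E w)%E.
      by rewrite integral_cst// EFinM muleA muleAC.
    apply: eq_integral => w /set_mem /inN[Aw Dk].
    by rewrite /g_ /G Dk indicE mem_set// mul1r.
Qed.
End grid_limit.

End discretized_network.

(** * From half-lines to conditional expectations *)

Section conditioning.
Context {R : realType} d (T : measurableType d) (P : probability T R).
Variables (A : set T) (D : T -> R).
Hypotheses (mA : measurable A) (mD : measurable_fun [set: T] D).

Let mAD B : measurable B -> measurable (A `&` D @^-1` B).
Proof.
by move=> mB; apply: measurableI => //; rewrite -[X in measurable X]setTI; exact: mD.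
Qed.

Lemma unit_integral_le (f : T -> R) E : measurable E -> measurable_fun E f ->
  (forall w, E w -> 0 <= f w <= 1) -> (\int[P]_(w in E) (f w)%:E \is a fin_num)%E.
Proof.
move=> mE mf f01; rewrite ge0_fin_numE; last first.
  by apply: integral_ge0 => w /f01/andP[]; rewrite lee_fin.
apply: (@le_lt_trans _ _ (\int[P]_(w in E) (cst 1%:E w))%E).
  apply: ge0_le_integral => //.
  - by move=> w /f01/andP[]; rewrite lee_fin.
  - exact/measurable_EFinP.
  - by move=> w /f01/andP[]; rewrite lee_fin.
rewrite integral_cst// mul1e; apply: (le_lt_trans (probability_le1 P mE)).
exact: ltry.
Qed.

(** Equality over [A] starts the Dynkin class and, by subtraction, yields complements; integrals of
    functions with values in [0, 1] are finite, which makes the subtraction legitimate. *)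
Lemma eq_integral_preimage (f g : T -> R) :
  measurable_fun A f -> measurable_fun A g ->
  (forall w, A w -> 0 <= f w <= 1) -> (forall w, A w -> 0 <= g w <= 1) ->
  (\int[P]_(w in A) (f w)%:E = \int[P]_(w in A) (g w)%:E)%E ->
  (forall t, \int[P]_(w in A `&` D @^-1` `]-oo, t[) (f w)%:E =
             \int[P]_(w in A `&` D @^-1` `]-oo, t[) (g w)%:E)%E ->
  forall B, measurable B -> (\int[P]_(w in A `&` D @^-1` B) (f w)%:E =
                             \int[P]_(w in A `&` D @^-1` B) (g w)%:E)%E.
Proof.
move=> mf mg f01 g01 EA Et B mB.
have mfE (h : T -> R) (mh : measurable_fun A h) S :
    measurable_fun (A `&` S) (fun w => (h w)%:E).
  by apply/measurable_EFinP; apply: measurable_funS mh => // w [].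
have splitC (h : T -> R) S : measurable_fun A h -> (forall w, A w -> 0 <= h w <= 1) ->
    measurable S -> (\int[P]_(w in A) (h w)%:E =
      \int[P]_(w in A `&` D @^-1` S) (h w)%:E +
      \int[P]_(w in A `&` D @^-1` (~` S)) (h w)%:E)%E.
  move=> mh h01 mS; rewrite -ge0_integral_setU//.
  - by rewrite preimage_setC -setIUr setUv setIT.
  - exact: mAD.
  - by apply: mAD; exact: measurableC.
  - by rewrite preimage_setC -setIUr setUv setIT; exact/measurable_EFinP.
  - by move=> w; rewrite preimage_setC -setIUr setUv setIT => /h01/andP[]; rewrite lee_fin.
  - by apply/disj_setPS => w [[_ DS] [_ nDS]]; exact: nDS.
apply: (@dynkin_induction _ (measurableTypeR R) (@RGenInftyO.G R) (fun B =>
  \int[P]_(w in A `&` D @^-1` B) (f w)%:E =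
  \int[P]_(w in A `&` D @^-1` B) (g w)%:E)%E).
- exact: RGenInftyO.measurableE.
- move=> _ _ [x ->] [y ->]; exists (Num.min x y); apply/seteqP; split=> z /=.
    by rewrite !in_itv/= lt_min => -[-> ->].
  by rewrite !in_itv/= lt_min => /andP[].
- by rewrite preimage_setT setIT.
- by move=> _ [x ->]; exact: Et.
- move=> S mS ES.
  have := EA; rewrite (splitC f S mf f01 mS) (splitC g S mg g01 mS) ES.
  have fin : (\int[P]_(w in A `&` D @^-1` S) (g w)%:E \is a fin_num)%E.
    apply: unit_integral_le; [exact: mAD| |by move=> w [/g01]].
    by apply: measurable_funS mg => // w [].
  by move=> /(congr1 (fun x => x - \int[P]_(w in A `&` D @^-1` S) (g w)%:E)%E);
    rewrite !(addeC (\int[P]_(w in A `&` D @^-1` S) (g w)%:E)%E) !addeK.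
- move=> F mF tF EF.
  have U (h : T -> R) : measurable_fun A h -> (forall w, A w -> 0 <= h w <= 1) ->
      (\int[P]_(w in A `&` D @^-1` (\bigcup_k F k)) (h w)%:E =
       \sum_(k <oo) \int[P]_(w in A `&` D @^-1` (F k)) (h w)%:E)%E.
    move=> mh h01; rewrite preimage_bigcup setI_bigcupr ge0_integral_bigcup//.
    - by move=> k; apply: mAD; exact: mF.
    - by rewrite -setI_bigcupr; exact: mfE.
    - by move=> w [k _ [/h01/andP[]]]; rewrite lee_fin.
    - apply/trivIsetP => i j _ _ ij; apply/seteqP; split=> // w [[_ Fi] [_ Fj]].
      by move/trivIsetP : tF => /(_ i j I I ij); rewrite -subset0; apply; split; [exact: Fi|exact: Fj].
  by rewrite !U//; apply: eq_eseriesr => k _; exact: EF.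
- suff : (RGenInftyO.G (R:=R)).-sigma.-measurable B by [].
  by rewrite -RGenInftyO.measurableE; exact: mB.
Qed.

(** Where |D - r| <= e the version is within eps of [g r], hence so is its average. Continuity is
    asked of [g'], which agrees with [g] on [[lo, hi]], so that end points need no one-sided
    limits. *)
Lemma cond_expectation_at_version (X : R -> T -> R) (lo hi r : R) (g g' : R -> R) :
  cond_expectation_version P A D X `[lo, hi] g ->
  (forall w, A w -> lo <= D w <= hi) -> lo <= r <= hi ->
  (forall x, lo <= x <= hi -> 0 <= g x <= 1) ->
  (forall x, lo <= x <= hi -> g x = g' x) -> {for r, continuous g'} ->
  (forall e, 0 < e -> (0 < P (A `&` [set w | (`|D w - r| <= e)%R]))%E) ->
  cond_expectation_at P A D X r (g r).
Proof.
move=> [_ mg gE] AD rlh g01 gg' cg' P0; split=> //.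
(* The version only speaks of subsets of [[lo, hi]]; on [A] the intersection changes nothing. *)
pose B (e : R) : set R := `[lo, hi] `&` [set x | `|x - r| <= e].
have EB e : A `&` [set w | `|D w - r| <= e] = A `&` D @^-1` (B e).
  apply/seteqP; split=> w [Aw Dw]; split=> //; last by case: Dw.
  by split=> //=; rewrite in_itv/= AD.
have mB e : measurable (B e).
  apply: measurableI => //; rewrite (_ : [set x | _] = `[r - e, r + e]%classic)//.
  by apply/seteqP; split=> x /=; rewrite in_itv/= ler_distl.
apply/cvgrPdist_le => eps eps0.
have /cvgrPdist_le/(_ eps eps0) := cg'; rewrite -nbhs_nearE => /nbhs_ballP[dl /= dl0 dlP].
near=> e.
have e0 : 0 < e by near: e; exact: nbhs_right_gt.
have edl : e < dl by near: e; exact: nbhs_right_lt.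
set E := A `&` [set w | `|D w - r| <= e].
have mE : measurable E by rewrite /E EB; exact: mAD.
have gr0 : 0 <= g r by case/andP: (g01 r rlh).
have Eg w : E w -> `|g r - g (D w)| <= eps.
  move=> [Aw Dw]; rewrite !gg' ?AD//; apply: dlP.
  by rewrite /ball/= distrC (le_lt_trans Dw).
have mgD : measurable_fun E (fun w => g (D w)).
  apply: (@measurable_comp _ _ _ _ _ _ `[lo, hi]%classic g) => //.
  + by move=> _ [w [Aw _] <-] /=; rewrite in_itv/= AD.
  + by apply: measurable_funS mD.
have mgDe : measurable_fun E (fun w => (g (D w))%:E) by exact/measurable_EFinP.
have gD01 w : E w -> 0 <= g (D w) <= 1 by move=> [Aw _]; apply/g01/AD.
have finI := unit_integral_le mE mgD gD01.
have finP : P E \is a fin_num by exact: fin_num_measure.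
rewrite /Rintegral {1}/E EB gE//; last by move=> x [].
rewrite -EB -/E.
set i := fine (\int[P]_(w in E) (g (D w))%:E)%E; set p := fine (P E).
have iE : (\int[P]_(w in E) (g (D w))%:E = i%:E)%E by rewrite fineK.
have pE : P E = p%:E by rewrite fineK.
have p0 : 0 < p by rewrite -lte_fin -pE P0.
have cstE (c : R) : (\int[P]_(w in E) (cst c%:E w) = (c * p)%:E)%E.
  by rewrite integral_cst// [X in (_ * X)%E]pE EFinM.
have up : i <= (g r + eps) * p.
  rewrite -lee_fin -iE -cstE; apply: ge0_le_integral => //.
  - by move=> w /gD01/andP[]; rewrite lee_fin.
  - by move=> w /Eg; rewrite lee_fin ler_distl => /andP[]; lra.
(* Written without the constant [g r - eps], which may be negative, so that only nonnegative
   functions are integrated. *)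
have low : g r * p <= i + eps * p.
  rewrite -lee_fin EFinD -iE -!cstE -ge0_integralD//; last 2 first.
  - by move=> w /gD01/andP[]; rewrite lee_fin.
  - by move=> w _; rewrite /= lee_fin ltW.
  apply: ge0_le_integral => //.
  - exact: emeasurable_funD.
  - by move=> w /Eg; rewrite lee_fin ler_distl => /andP[]; lra.
rewrite ler_distl; apply/andP; split.
  by rewrite lerBlDr ler_pdivrMr//; lra.
by rewrite -lerBlDr ler_pdivlMr//; lra.
Unshelve. all: by end_near. Qed.
End conditioning.

(** * Measurability of quantities depending on the users *)

Section user_measurability.
Context {R : realType} d (T : measurableType d).
Implicit Types (Phi : T -> seq (R * R * R)).

Lemma measurable_size_fibre Phi n : (forall E, label_events Phi E -> measurable E) ->
  measurable ((fun w => size (Phi w)) @^-1` [set n]).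
Proof.
move=> mPhi; apply: measurable_nat_fibre => i; apply: mPhi; exists i, setT; split=> //.
by apply/seteqP; split=> [w /= ?|w /= []].
Qed.

Lemma measurable_user Phi l : (forall E, label_events Phi E -> measurable E) ->
  measurable_fun [set: T] (fun w => (Phi w)`_l).
Proof.
move=> mPhi _ B mB; rewrite setTI.
have msz : measurable [set w | (l < size (Phi w))%N].
  by apply: mPhi; exists l, setT; split=> //; apply/seteqP; split=> [w /= ?|w /= []].
(* Beyond the end of the list the entry is the default 0, so a second piece appears exactly when [B]
   contains 0. *)
rewrite (_ : _ @^-1` _ = [set w | (l < size (Phi w))%N /\ B (Phi w)`_l] `|`
   (~` [set w | (l < size (Phi w))%N] `&` [set _ | B 0])).
  apply: measurableU; first by apply: mPhi; exists l, B.
  apply: measurableI; first exact: measurableC.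
  have [B0|nB0] := pselect (B 0).
    by rewrite (_ : [set _ | _] = setT)//; apply/seteqP; split.
  by rewrite (_ : [set _ | _] = set0)//; apply/seteqP; split.
apply/seteqP; split=> w /=.
  have [lsz|/negP lsz] := boolP (l < size (Phi w))%N; first by left.
  move=> Bw; right; split=> //; move: Bw; rewrite nth_default//.
  by rewrite leqNgt; exact/negP.
by move=> [[]//|[/negP lsz B0]]; rewrite nth_default// leqNgt.
Qed.

Lemma measurable_visible_cap (Rs Ro theta : R) : measurable (visible_cap Rs Ro theta).
Proof.
rewrite (_ : visible_cap _ _ _ = (dist3 ^~ (0, 0, 0)) @^-1` [set Ro] `&`
    (dist3 ^~ (typical_sat Rs)) @^-1` `]-oo, (Rmax Rs Ro theta)]%classic).
  by apply: measurableI; rewrite -[X in measurable X]setTI; exact: measurable_dist3.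
by apply/seteqP; split=> x /=; rewrite /visible_cap /cap/= in_itv.
Qed.

Lemma measurable_nearest_dist (Rs Ro theta : R) Phi :
  (forall E, label_events Phi E -> measurable E) ->
  measurable_fun [set: T] (nearest_dist Rs Ro theta Phi).
Proof.
move=> mPhi; apply: (measurable_fun_on_fibres (c := fun w => size (Phi w))) => n.
  exact: measurable_size_fibre.
apply: (eq_measurable_fun (fun w => \big[Num.min/Rmax Rs Ro theta]_(l <- iota 0 n |
    (Phi w)`_l \in visible_cap Rs Ro theta) dist3 (Phi w)`_l (typical_sat Rs))).
  move=> w /set_mem/= <-; by rewrite /nearest_dist [RHS](big_nth 0) /index_iota subn0.
apply: measurable_funTS; elim: (iota 0 n) => [|l s IH].
  by under eq_fun do rewrite big_nil; exact: measurable_cst.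
under eq_fun do rewrite big_cons.
have mY := measurable_user l mPhi.
apply: measurable_fun_ifT => //.
- apply: (measurable_fun_bool true).
  rewrite setTI (_ : _ @^-1` _ = (fun w => (Phi w)`_l) @^-1` visible_cap Rs Ro theta).
    by rewrite -[X in measurable X]setTI; apply: mY => //; exact: measurable_visible_cap.
  by apply/seteqP; split=> w /=; [exact: set_mem|exact: mem_set].
- apply: measurable_minr => //.
  exact: (measurableT_comp (measurable_dist3 _) mY).
Qed.

Lemma measurable_transmittance (Rs Rus Rut theta alpha q1 q2 : R) Phi1 Phi2
    (F1 F2 : nat -> T -> R) :
  (forall E, label_events Phi1 E -> measurable E) ->
  (forall E, label_events Phi2 E -> measurable E) ->
  (forall l, measurable_fun [set: T] (F1 l)) ->
  (forall l, measurable_fun [set: T] (F2 l)) ->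
  measurable_fun [set: T] (transmittance Rs Rus Rut theta alpha q1 q2 Phi1 Phi2 F1 F2).
Proof.
move=> mPhi1 mPhi2 mF1 mF2.
have mcoeff q (b : T -> bool) (v h : T -> R) : measurable_fun [set: T] b ->
    measurable_fun [set: T] v -> measurable_fun [set: T] h ->
    measurable_fun [set: T] (fun w => expR (- (user_coeff alpha q (b w) (v w) * h w))).
  move=> mb mv mh; apply: measurableT_comp => //; apply: measurableT_comp => //.
  apply: measurable_funM => //; apply: measurable_fun_ifT => //.
  apply: measurable_funM => //.
  exact: (measurableT_comp (measurable_powR (- alpha)) mv).
have mprod Phi (b : T -> R * R * R -> bool) (F : nat -> T -> R) q :
    (forall E, label_events Phi E -> measurable E) ->
    (forall l, measurable_fun [set: T] (F l)) ->
    (forall l, measurable_fun [set: T] (fun w => b w (Phi w)`_l)) ->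
    measurable_fun [set: T] (fun w => \prod_(l < size (Phi w))
      expR (- (user_coeff alpha q (b w (Phi w)`_l)
        (dist3 (Phi w)`_l (typical_sat Rs)) * F l w))).
  move=> mPhi mF mb.
  apply: (measurable_fun_on_fibres (c := fun w => size (Phi w))) => n.
    exact: measurable_size_fibre.
  apply: (eq_measurable_fun (fun w => \prod_(l < n)
      expR (- (user_coeff alpha q (b w (Phi w)`_l)
        (dist3 (Phi w)`_l (typical_sat Rs)) * F l w)))).
    by move=> w /set_mem/= <-.
  apply: measurable_funTS; apply: measurable_prod => l _; apply: mcoeff => //.
  exact: (measurableT_comp (measurable_dist3 _) (measurable_user l mPhi)).
apply: measurable_funM.
- apply: (@mprod Phi1 (fun w x => nearest_dist Rs Rus theta Phi1 w <
    dist3 x (typical_sat Rs) <= Rmax Rs Rus theta) F1 q1) => // l.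
  have md := measurableT_comp (measurable_dist3 (typical_sat Rs)) (measurable_user l mPhi1).
  apply: measurable_and; last exact: measurable_fun_ler.
  by apply: measurable_fun_ltr => //; exact: measurable_nearest_dist.
- apply: (@mprod Phi2 (fun w x => dist3 x (typical_sat Rs) <= Rmax Rs Rut theta) F2 q2) => // l.
  have md := measurableT_comp (measurable_dist3 (typical_sat Rs)) (measurable_user l mPhi2).
  exact: measurable_fun_ler.
Qed.
End user_measurability.

(** * Positive probability of nearest distances close to a given one *)

Section positivity.
Context {R : realType} d (T : measurableType d) (P : probability T R).
Variables (Rs Ro theta lam : R) (Phi : T -> seq (R * R * R)).
Hypotheses (Rs0 : 0 < Rs) (RoRs : Ro < Rs) (theta0 : 0 < theta)
  (thetapi : theta < pi / 2) (vis : Rs * sin theta <= Ro) (lam0 : 0 < lam)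
  (ppp : poisson_process_on_sphere P Phi Ro lam).

Local Notation D := (nearest_dist Rs Ro theta Phi).
Local Notation A := (some_visible Rs Ro theta Phi).

(* It suffices that there is no user at distance at most [u] and exactly one at
   distance in ]u, v]. *)
Lemma nearest_dist_positive_probability u v : Rmin Rs Ro <= u -> u < v ->
  v <= Rmax Rs Ro theta -> (0 < P (A `&` [set w | (u < D w <= v)%R]))%E.
Proof.
move=> lou uv vhi.
have Ro0 := user_radius_gt0 Rs0 theta0 thetapi vis.
have mPhi := ppp_measurable ppp.
pose B (j : 'I_2) : set (R * R * R) := if j == ord0
  then [set x | dist3 x (typical_sat Rs) <= u] else shell Rs u v.
have mitv (i : interval R) : measurable ((dist3 ^~ (typical_sat Rs)) @^-1` [set` i]).
  by rewrite -[X in measurable X]setTI; exact: measurable_dist3.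
have mB j : measurable (B j).
  rewrite /B; case: ifP => _.
    exact: (mitv `]-oo, u]).
  exact: (mitv `]u, v]).
have tB : trivIset setT B.
  apply/trivIsetP => i j _ _.
  have B0 (k : 'I_2) : k != ord0 -> B k = shell Rs u v by rewrite /B => /negbTE ->.
  have disj : B ord0 `&` shell Rs u v = set0.
    by apply/seteqP; split=> // x; rewrite /B eqxx /shell/= => -[/le_lt_trans h /andP[/h]]; rewrite ltxx.
  have [->|i0] := eqVneq i ord0; have [->|j0] := eqVneq j ord0.
  - by [].
  - by rewrite (B0 j).
  - by rewrite (B0 i)// setIC.
  - move=> ij; exfalso; move: ij i0 j0; clear.
    by case: i => -[|[|//]] p; case: j => -[|[|//]] q.
(* The count prescribed in [B j] is [j] itself: none up to distance [u], one in the shell. *)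
have := @ppp_law _ _ _ _ _ _ _ ppp 2 B (fun j => nat_of_ord j) mB tB.
set E := [set w | forall j, _] => PE.
apply: (@lt_le_trans _ _ (P E)).
  rewrite PE lte_fin; apply: prodr_gt0 => j _; rewrite /poisson_weight.
  rewrite mulr_gt0 ?expR_gt0// divr_gt0 ?ltr0n ?fact_gt0//.
  (* For count 0 the weight is positive whatever the area, a zeroth power being 1; for the shell the
     area has to be positive. *)
  case: (eqVneq j ord0) => [->|j0]; first by rewrite expr0.
  rewrite exprn_gt0// mulr_gt0// /B (negbTE j0) sphere_area_shell//; last first.
    by rewrite (le_trans vhi)//; exact: Rmax_le Rs0 theta0 thetapi vis.
  rewrite /= mulr_gt0//; first by rewrite mulr_gt0 ?pi_gt0// divr_gt0.
  have u0 : 0 < u by rewrite (lt_le_trans (Rmin_gt0 RoRs)).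
  by rewrite subr_gt0 ltr_sqr ?nnegrE ?ltW// (lt_trans u0).
have mD : measurable [set w | u < D w <= v].
  rewrite (_ : [set w | _] = D @^-1` `]u, v]%classic).
    by rewrite -[X in measurable X]setTI; exact: measurable_nearest_dist.
  by apply/seteqP; split=> w /=; rewrite in_itv.
apply: le_measure; [apply/mem_set|apply/mem_set|].
- rewrite /E (_ : [set w | _] = \big[setI/setT]_(j < 2)
     (count_pts Phi (B j) @^-1` [set nat_of_ord j])).
    by apply: bigsetI_measurable => j _; exact: measurable_count_pts.
  rewrite big_ord_recl big_ord1; apply/seteqP; split=> w /=.
    by move=> h; split; exact: h.
  move=> [h0 h1] j; case: (unliftP ord0 j) => [k ->|->//].
  by rewrite (ord1 k).
- by apply: measurableI => //; exact: measurable_some_visible ppp.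
- move=> w Ew.
  have := Ew ord0; have := Ew (lift ord0 ord0); rewrite /count_pts/= => c1 c0.
  have [x xP xB] : exists2 x, x \in Phi w & shell Rs u v x.
    have : has [in B (lift ord0 ord0)] (Phi w) by rewrite has_count c1.
    by move=> /hasP[x xP /= /set_mem xB]; exists x.
  have far y : y \in Phi w -> u < dist3 y (typical_sat Rs).
    move=> yP; rewrite ltNge; apply/negP => yu.
    have : has [in B ord0] (Phi w) by apply/hasP; exists y => //; apply/mem_set.
    by rewrite has_count c0.
  have /andP[xu xv] := xB.
  have xV : x \in visible_cap Rs Ro theta.
    by rewrite (visible_capE Rs theta (ppp_on_sphere ppp xP)) (le_trans xv).
  have Aw : A w by apply/some_visibleE; exists x.
  split=> //=; apply/andP; split.
    by have [y [yP _ ->]] := nearest_dist_attained Aw; exact: far.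
  by apply: le_trans xv; exact: nearest_dist_le.
Qed.

Lemma nearest_dist_near_positive_probability r e : 0 < e ->
  Rmin Rs Ro <= r <= Rmax Rs Ro theta ->
  (0 < P (A `&` [set w | (`|D w - r| <= e)%R]))%E.
Proof.
move=> e0 /andP[lor rhi].
have lohi := Rmin_lt_Rmax Rs0 RoRs theta0 thetapi vis.
(* The interval extends to the right of [r], or to the left when [r] is the maximal distance. *)
have [u [v [lou uv vhi ru rv]]] : exists u v, [/\ Rmin Rs Ro <= u, u < v,
    v <= Rmax Rs Ro theta, r - e <= u & v <= r + e].
  have [rh|hr] := ltP r (Rmax Rs Ro theta).
    exists r, (Num.min (Rmax Rs Ro theta) (r + e)); split=> //.
    - by rewrite lt_min rh ltrDl.
    - by rewrite ge_min lexx.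
    - by rewrite lerBlDr lerDl ltW.
    - by rewrite ge_min lexx orbT.
  have rE : r = Rmax Rs Ro theta by apply/eqP; rewrite eq_le rhi.
  exists (Num.max (Rmin Rs Ro) (r - e)), r; split=> //.
  - by rewrite le_max lexx.
  - by rewrite gt_max; apply/andP; split; [rewrite rE|rewrite ltrBlDr ltrDl].
  - by rewrite le_max lexx orbT.
  - by rewrite lerDl ltW.
apply: lt_le_trans (nearest_dist_positive_probability lou uv vhi) _.
have mPhi := ppp_measurable ppp.
have mD (i : interval R) : measurable (D @^-1` [set` i]).
  by rewrite -[X in measurable X]setTI; exact: measurable_nearest_dist.
have mA := measurable_some_visible Rs theta ppp.
apply: le_measure; [apply/mem_set|apply/mem_set|].
- by apply: measurableI => //; exact: (mD `]u, v]).
- apply: measurableI => //; rewrite (_ : [set w | _] = D @^-1` [set` `[r - e, r + e]])//.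
  by apply/seteqP; split=> w /=; rewrite in_itv/= ler_distl.
- move=> w [Aw /= /andP[uD Dv]]; split=> //=; rewrite ler_distl.
  by rewrite (le_trans ru (ltW uD)) (le_trans Dv rv).
Qed.
End positivity.

(** * Received power as a product over users *)

Section received.
Context {R : realType} d (T : measurableType d).

(** Users outside the region keep a factor with coefficient 0, so the product runs over all labels.
    [inside] has to match [S] only at actual users, where membership in the sphere is known. *)
Lemma expR_received_power (Rs alpha G p s : R) (Phi : T -> seq (R * R * R))
    (H : nat -> T -> R) (S : set (R * R * R)) (inside : R * R * R -> bool) w :
  (forall x, x \in Phi w -> (x \in S) = inside x) ->
  expR (- s * received_power Rs alpha G p Phi H S w) =
  \prod_(l < size (Phi w)) expR (- (user_coeff alpha (s * G * p) (inside (Phi w)`_l)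
    (dist3 (Phi w)`_l (typical_sat Rs)) * H l w)).
Proof.
move=> SE; rewrite -expR_sum; congr expR.
rewrite /received_power big_mkcond/= mulr_sumr; apply: eq_bigr => l _.
rewrite SE ?mem_nth// /user_coeff; case: ifP => _; last by rewrite mul0r oppr0 mulr0.
by ring.
Qed.

Lemma cvg_on_itv_measurable (lo hi : R) (f : R -> R) :
  (forall x, lo <= x <= hi -> {for x, continuous f}) -> measurable_fun `[lo, hi] f.
Proof.
move=> cf; apply: subspace_continuous_measurable_fun => //.
by apply: continuous_in_subspaceT => x /set_mem/=; rewrite in_itv/=; exact: cf.
Qed.
End received.

(** * The conditional Laplace transform *)

Section conditional_laplace_transform.
Context {R : realType} d (T : measurableType d) (P : probability T R).
Variables (Rs Rus Rut theta lam_us lam_ut alpha q1 q2 b Omega : R) (m : nat).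
Variables (Phi1 Phi2 : T -> seq (R * R * R)) (H1 H2 : nat -> {RV P >-> R}).
Hypotheses (Rs0 : 0 < Rs) (Rus_lt : Rus < Rs) (Rut_lt : Rut < Rs)
  (theta0 : 0 < theta) (thetapi : theta < pi / 2)
  (Rus_vis : Rs * sin theta <= Rus) (Rut_vis : Rs * sin theta <= Rut)
  (lam_us0 : 0 < lam_us) (lam_ut0 : 0 < lam_ut) (q10 : 0 <= q1) (q20 : 0 <= q2)
  (b0 : 0 < b) (m0 : (0 < m)%N) (Omega0 : 0 < Omega).
Hypotheses (ppp1 : poisson_process_on_sphere P Phi1 Rus lam_us)
  (ppp2 : poisson_process_on_sphere P Phi2 Rut lam_ut)
  (indep12 : independent2 P <<s count_events Phi1 >> <<s count_events Phi2 >>)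
  (lawH1 : forall l, shadowed_rician_power P (H1 l) b m Omega)
  (lawH2 : forall k, shadowed_rician_power P (H2 k) b m Omega)
  (fading_indep : mutually_independent P (network_sigma Phi1 Phi2 H1 H2)).

Local Notation psi := (sr_laplace_sum b m Omega).
Local Notation lo1 := (Rmin Rs Rus).
Local Notation hi1 := (Rmax Rs Rus theta).
Local Notation lo2 := (Rmin Rs Rut).
Local Notation hi2 := (Rmax Rs Rut theta).
Local Notation D := (nearest_dist Rs Rus theta Phi1).
Local Notation A := (some_visible Rs Rus theta Phi1).
Local Notation trans := (transmittance Rs Rus Rut theta alpha q1 q2 Phi1 Phi2).

Definition deficit (q v : R) : R := (1 - psi (q * v `^ (- alpha))) * v.

Lemma deficit_ge0 q v : 0 <= q -> 0 <= v -> 0 <= deficit q v.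
Proof.
move=> q0 v0; rewrite mulr_ge0// subr_ge0.
apply: (sr_laplace_sum_le1 b0 Omega0 m0 (measurable_funP (H1 0)) (lawH1 0)).
by rewrite mulr_ge0// powR_ge0.
Qed.

(** Collects what the grid limit asks of one network. The bound [K x <= K hi], from the sign of
    [deficit], keeps [conditional_transmittance] at most 1. *)
Lemma deficit_antiderivative q lo hi : 0 <= q -> 0 < lo -> lo < hi ->
  exists (K : R -> R) (c : nat -> nat -> R),
  [/\ forall n j, (j < n.+2)%N ->
        grid lo hi n j.-1 <= c n j <= grid lo hi n j /\
        (grid lo hi n j ^+ 2 - grid lo hi n j.-1 ^+ 2) / 2 *
          (1 - psi (q * c n j `^ (- alpha))) =
        K (grid lo hi n j) - K (grid lo hi n j.-1),
      forall x, lo <= x <= hi -> {for x, continuous K},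
      forall x, lo <= x <= hi -> K x <= K hi &
      forall x, lo <= x <= hi ->
        \int[lebesgue_measure]_(v in `[x, hi]) deficit q v = K hi - K x].
Proof.
move=> q0 lo0 lohi.
have [K [dK intK]] : exists K : R -> R,
    (forall x, lo <= x <= hi -> is_derive x 1 K (deficit q x)) /\
    forall a, lo <= a <= hi ->
      \int[lebesgue_measure]_(x in `[a, hi]) deficit q x = K hi - K a.
  apply: antiderivative_exists => // x x0; rewrite /deficit.
  exact: (path_loss_integrand_continuous b0 Omega0 m0 q0 x0).
have /choice[c cP] : forall n, exists c : nat -> R, forall j, (j < n.+2)%N ->
    grid lo hi n j.-1 <= c j <= grid lo hi n j /\
    (grid lo hi n j ^+ 2 - grid lo hi n j.-1 ^+ 2) / 2 *
      (1 - psi (q * c j `^ (- alpha))) =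
    K (grid lo hi n j) - K (grid lo hi n j.-1).
  by move=> n; apply: (@grid_mean_points _ lo hi lohi (fun v => psi (q * v `^ (- alpha)))).
exists K, c; split=> //.
- move=> x xlh; apply/differentiable_continuous/derivable1_diffP.
  by have [] := dK x xlh.
- move=> x xlh; rewrite -subr_ge0 -intK//; apply: Rintegral_ge0 => v /=.
  rewrite in_itv/= => /andP[xv _]; apply: deficit_ge0 => //.
  by case/andP: xlh => lox _; rewrite (le_trans (ltW lo0))// (le_trans lox).
Qed.

(** Every fading power is positive almost surely, hence all of them at once, there being countably
    many labels. *)
Lemma transmittance_ae :
  {ae P, forall w, trans H1 H2 w =
    trans (fun l w => Num.sqrt (H1 l w) ^+ 2) (fun l w => Num.sqrt (H2 l w) ^+ 2) w}.
Proof.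
have pos (H : nat -> {RV P >-> R}) : (forall l, shadowed_rician_power P (H l) b m Omega) ->
    {ae P, forall w, forall l, 0 < H l w}.
  move=> lawH; apply: ae_foralln => l.
  exact: (shadowed_rician_ae_gt0 (measurable_funP (H l)) (lawH l)).
have := pos H1 lawH1; have := pos H2 lawH2.
apply: filterS2 => w p2 p1; rewrite /transmittance; congr (_ * _);
  by apply: eq_bigr => l _; rewrite sqr_sqrtr// ltW.
Qed.

Lemma transmittance01 w :
  0 <= trans (fun l w => Num.sqrt (H1 l w) ^+ 2) (fun l w => Num.sqrt (H2 l w) ^+ 2) w <= 1.
Proof.
have P01 (S : Type) (r : seq S) (x : S -> R) : (forall l, 0 <= x l) ->
    0 <= \prod_(l <- r) expR (- x l) <= 1.
  move=> x0; elim: r => [|l r /andP[IH0 IH1]]; first by rewrite big_nil ler01 lexx.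
  rewrite big_cons mulr_ge0 ?expR_ge0// mulr_ile1 ?expR_ge0//.
  by rewrite expR_le1 oppr_le0.
have c0 q c v y : 0 <= q -> 0 <= user_coeff alpha q c v * Num.sqrt y ^+ 2.
  move=> q0; rewrite mulr_ge0 ?sqr_ge0// /user_coeff; case: ifP => // _.
  by rewrite mulr_ge0 ?powR_ge0.
have /andP[p0 p1] := P01 _ (index_enum 'I_(size (Phi1 w))) (fun l => user_coeff alpha q1
  (D w < dist3 (Phi1 w)`_l (typical_sat Rs) <= hi1) (dist3 (Phi1 w)`_l (typical_sat Rs)) *
  Num.sqrt (H1 l w) ^+ 2) (fun l => c0 _ _ _ _ q10).
have /andP[p2 p3] := P01 _ (index_enum 'I_(size (Phi2 w))) (fun l => user_coeff alpha q2
  (dist3 (Phi2 w)`_l (typical_sat Rs) <= hi2) (dist3 (Phi2 w)`_l (typical_sat Rs)) *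
  Num.sqrt (H2 l w) ^+ 2) (fun l => c0 _ _ _ _ q20).
by rewrite /transmittance mulr_ge0// mulr_ile1.
Qed.

Variables (sigma : R) (X : R -> T -> R) (L : R -> R).
Hypotheses (sigma0 : 0 <= sigma)
  (XE : forall w, X (D w) w = expR (- sigma) * trans H1 H2 w)
  (LE : forall r, lo1 <= r <= hi1 -> L r = expR (- sigma -
    2 * pi * lam_tilde Rs Rus lam_us *
      \int[lebesgue_measure]_(v in `[r, hi1]) deficit q1 v -
    2 * pi * lam_tilde Rs Rut lam_ut *
      \int[lebesgue_measure]_(v in `[lo2, hi2]) deficit q2 v)).

Lemma conditional_laplace_transform :
  cond_expectation_version P A D X `[lo1, hi1] L /\
  forall r, lo1 <= r <= hi1 -> cond_expectation_at P A D X r (L r).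
Proof.
have lohi1 : lo1 < hi1 := Rmin_lt_Rmax Rs0 Rus_lt theta0 thetapi Rus_vis.
have lohi2 : lo2 < hi2 := Rmin_lt_Rmax Rs0 Rut_lt theta0 thetapi Rut_vis.
have [K1 [c1 [c1P cK1 K1le intK1]]] :=
  deficit_antiderivative q10 (Rmin_gt0 Rus_lt) lohi1.
have [K2 [c2 [c2P _ K2le intK2]]] :=
  deficit_antiderivative q20 (Rmin_gt0 Rut_lt) lohi2.
have lo2lh : lo2 <= lo2 <= hi2 by rewrite lexx ltW.
have below := integral_transmittance_below Rs0 Rus_lt Rut_lt theta0 thetapi Rus_vis
  Rut_vis lam_us0 lam_ut0 q10 q20 b0 m0 Omega0 ppp1 ppp2 indep12 lawH1 lawH2
  fading_indep c1P c2P cK1 K1le (K2le _ lo2lh).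
pose e := expR (- sigma).
have e0 : 0 <= e by exact: expR_ge0.
have e1 : e <= 1 by rewrite expR_le1 oppr_le0.
pose CT := conditional_transmittance Rs Rus Rut theta lam_us lam_ut K1 K2.
have LCT r : lo1 <= r <= hi1 -> L r = e * CT r.
  move=> rlh; rewrite LE// intK1// intK2// /e /CT /conditional_transmittance -expRD.
  by congr expR; ring.
have CT01 r : lo1 <= r <= hi1 -> 0 <= CT r <= 1.
  exact: (conditional_transmittance01 Rs0 theta0 thetapi Rus_vis Rut_vis lam_us0
    lam_ut0 K1le (K2le _ lo2lh)).
have cCT r : lo1 <= r <= hi1 -> {for r, continuous (fun x => e * CT x)}.
  move=> rlh; apply: cvgMl_tmp.
  pose E x := - (2 * pi * lam_tilde Rs Rus lam_us * (K1 hi1 - K1 x)) -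
    2 * pi * lam_tilde Rs Rut lam_ut * (K2 hi2 - K2 lo2).
  suff cE : E x @[x --> r] --> E r by exact: cvg_comp cE (@continuous_expR R _).
  apply: cvgB; last exact: cvg_cst.
  apply: cvgN; apply: cvgMl_tmp; apply: cvgB; first exact: cvg_cst.
  exact: cK1.
have L01 r : lo1 <= r <= hi1 -> 0 <= L r <= 1.
  move=> rlh; have /andP[C0 C1] := CT01 r rlh.
  by rewrite LCT// mulr_ge0//= mulr_ile1.
have mL : measurable_fun `[lo1, hi1] L.
  apply: (eq_measurable_fun (fun x => e * CT x)).
    by move=> x /set_mem/=; rewrite in_itv/= => /LCT ->.
  exact: cvg_on_itv_measurable.
have mPhi1 := ppp_measurable ppp1.
have mPhi2 := ppp_measurable ppp2.
have mA := measurable_some_visible Rs theta ppp1.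
have mD : measurable_fun [set: T] D by exact: measurable_nearest_dist.
have AD w : A w -> lo1 <= D w <= hi1.
  exact: (nearest_dist_itv Rs0 Rus_lt theta0 thetapi Rus_vis).
(* Unlike the factor with [H1] and [H2], which may exceed 1 on the null set where a power is
   negative, [X0] has values in [0, 1] everywhere. *)
pose X0 := trans (fun l w => Num.sqrt (H1 l w) ^+ 2) (fun l w => Num.sqrt (H2 l w) ^+ 2).
have X001 w : 0 <= X0 w <= 1 by exact: transmittance01.
have mX0 : measurable_fun [set: T] X0.
  by apply: measurable_transmittance => // l; apply: measurable_funX;
    apply: measurableT_comp => //; apply: continuous_measurable_fun; exact: sqrt_continuous.
have eX001 w : 0 <= e * X0 w <= 1.
  by have /andP[x0 x1] := X001 w; rewrite mulr_ge0//= mulr_ile1.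
have meX0 : measurable_fun [set: T] (fun w => e * X0 w) by exact: measurable_funM.
have X_ge0 w : 0 <= X (D w) w.
  rewrite XE mulr_ge0// /transmittance mulr_ge0//; apply: prodr_ge0 => l _; exact: expR_ge0.
have mX : measurable_fun [set: T] (fun w => X (D w) w).
  under eq_fun do rewrite XE; apply: measurable_funM => //.
  exact: measurable_transmittance.
have X_ae (E : set T) : measurable E ->
    (\int[P]_(w in E) (X (D w) w)%:E = \int[P]_(w in E) (e * X0 w)%:E)%E.
  move=> mE; apply: ge0_ae_eq_integral => //.
  - by apply: measurable_funTS; exact/measurable_EFinP.
  - by apply: measurable_funTS; exact/measurable_EFinP.
  - by move=> w _; rewrite lee_fin.
  - by move=> w _; rewrite lee_fin; case/andP: (eX001 w).
  - by apply: filterS transmittance_ae => w E' _; rewrite XE E'.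
have mgD : measurable_fun A (fun w => L (D w)).
  apply: (@measurable_comp _ _ _ _ _ _ `[lo1, hi1]%classic L) => //.
  + by move=> _ [w Aw <-] /=; rewrite in_itv/= AD.
  + by apply: measurable_funS mD.
have eq_below t : (\int[P]_(w in A `&` D @^-1` `]-oo, t[) (e * X0 w)%:E =
    \int[P]_(w in A `&` D @^-1` `]-oo, t[) (L (D w))%:E)%E.
  have E (h : T -> R) : measurable_fun A h -> (forall w, A w -> 0 <= h w) ->
      (\int[P]_(w in A `&` D @^-1` `]-oo, t[) (e * h w)%:E =
       e%:E * \int[P]_w (\1_A w * (D w < t)%R%:R * h w)%:E)%E.
    move=> mh h0.
    have mAD : measurable (A `&` D @^-1` `]-oo, t[).
      by apply: measurableI => //; rewrite -[X in measurable X]setTI; exact: mD.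
    under eq_integral do rewrite EFinM.
    rewrite ge0_integralZl//; last 2 first.
    - by apply/measurable_EFinP; apply: measurable_funS mh => // w [].
    - by move=> w [Aw _]; rewrite lee_fin h0.
    congr (_ * _)%E; rewrite integral_mkcond; apply: eq_integral => w _.
    rewrite patchE in_setI indicE; case: (w \in A) => /=; last by rewrite !mul0r.
    have -> : (w \in D @^-1` `]-oo, t[) = (D w < t).
      apply/idP/idP => [/set_mem/=|Dt]; first by rewrite in_itv.
      by apply/mem_set; rewrite /= in_itv.
    by case: (D w < t); rewrite ?mul1r// !(mulr0, mul0r).
  rewrite E//; last 2 first.
  - exact: measurable_funTS.
  - by move=> w _; case/andP: (X001 w).
  rewrite below -(E (fun w => CT (D w))).
  - apply: eq_integral => w /set_mem[Aw _]; rewrite LCT//; exact: AD.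
  - apply: (@measurable_comp _ _ _ _ _ _ `[lo1, hi1]%classic CT) => //.
    + by move=> _ [w Aw <-] /=; rewrite in_itv/= AD.
    + apply: (eq_measurable_fun (fun x => e^-1 * L x)).
        move=> x /set_mem/=; rewrite in_itv/= => xlh.
        by rewrite LCT// mulrA mulVf ?mul1r// gt_eqF// expR_gt0.
      exact: measurable_funM.
    + by apply: measurable_funS mD.
  - by move=> w Aw; case/andP: (CT01 _ (AD w Aw)).
have version : cond_expectation_version P A D X `[lo1, hi1] L.
  split=> //.
  - apply/integrableP; split; first by apply: measurable_funTS; exact/measurable_EFinP.
    under eq_integral do rewrite gee0_abs ?lee_fin//.
    rewrite X_ae// -ge0_fin_numE; last first.
      by apply: integral_ge0 => w _; rewrite lee_fin; case/andP: (eX001 w).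
    apply: unit_integral_le => //.
    exact: measurable_funTS.
  - move=> B mB _.
    have mAB : measurable (A `&` D @^-1` B).
      by apply: measurableI => //; rewrite -[X in measurable X]setTI; exact: mD.
    rewrite X_ae//; apply: eq_integral_preimage => //.
    + exact: measurable_funTS.
    + by move=> w /AD /L01.
    (* On [A] the nearest distance is at most [hi1], so this half-line gives the equality over all
       of [A]. *)
    + have := eq_below (hi1 + 1); rewrite (_ : A `&` _ = A)//.
      apply/seteqP; split=> [w []//|w Aw]; split=> //=; rewrite in_itv/=.
      by case/andP: (AD w Aw) => _ /le_lt_trans; apply; rewrite ltrDl.
split=> // r rlh.
apply: (cond_expectation_at_version mA mD version AD rlh L01 LCT (cCT r rlh)) => eps eps0.
exact: (nearest_dist_near_positive_probability Rs0 Rus_lt theta0 thetapi Rus_vis lam_us0 ppp1).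
Qed.
End conditional_laplace_transform.

Unset Implicit Arguments.

Theorem lemma4 (R : realType) (d : measure_display) (T : measurableType d)
  (P : probability T R)
  (Rs Rus Rut theta lam_us lam_ut : R)
  (fc c0 Gs_side Gus_side Gut_side : R)
  (b : R) (m : nat) (Omega : R)
  (Pus Put sigma2 alpha : R)
  (Phi_us Phi_ut : T -> seq (R * R * R))
  (Hs Ht : nat -> {RV P >-> R})
  (Rs_gt0 : 0 < Rs)
  (Rus_lt : Rus < Rs) (Rut_lt : Rut < Rs)
  (theta_gt0 : 0 < theta) (theta_lt : theta < pi / 2)
  (Rus_visible : Rs * sin theta <= Rus) (Rut_visible : Rs * sin theta <= Rut)
  (lam_us_gt0 : 0 < lam_us) (lam_ut_gt0 : 0 < lam_ut)
  (fc_gt0 : 0 < fc) (c0_gt0 : 0 < c0)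
  (Gs_side_gt0 : 0 < Gs_side) (Gus_side_gt0 : 0 < Gus_side)
  (Gut_side_gt0 : 0 < Gut_side)
  (b_gt0 : 0 < b) (m_gt0 : (0 < m)%N) (Omega_gt0 : 0 < Omega)
  (Pus_gt0 : 0 < Pus) (Put_gt0 : 0 < Put)
  (sigma2_gt0 : 0 < sigma2) (alpha_gt0 : 0 < alpha)
  (Phi_us_ppp : poisson_process_on_sphere P Phi_us Rus lam_us)
  (Phi_ut_ppp : poisson_process_on_sphere P Phi_ut Rut lam_ut)
  (Phi_indep : independent2 P <<s count_events Phi_us >>
                              <<s count_events Phi_ut >>)
  (Hs_law : forall l, shadowed_rician_power P (Hs l) b m Omega)
  (Ht_law : forall k, shadowed_rician_power P (Ht k) b m Omega)
  (fading_indep : mutually_independent P (network_sigma Phi_us Phi_ut Hs Ht))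
  (s : R) (s_ge0 : 0 <= s) :
  let Gus := side_gain Gs_side Gus_side c0 fc in
  let Gut := side_gain Gs_side Gut_side c0 fc in
  let I := I_up_up Rs Rus Rut theta alpha sigma2 Gus Gut Pus Put
             Phi_us Phi_ut Hs Ht in
  let X := fun (r : R) (w : T) => expR (- s * I r w) in
  let D := nearest_dist Rs Rus theta Phi_us in
  let A := some_visible Rs Rus theta Phi_us in
  let L := laplace_formula Rs Rus Rut theta lam_us lam_ut
             alpha sigma2 Gus Gut Pus Put b m Omega s in
  cond_expectation_version P A D X `[Rmin Rs Rus, Rmax Rs Rus theta] L /\
  forall r : R, Rmin Rs Rus <= r <= Rmax Rs Rus theta ->
    cond_expectation_at P A D X r (L r).
Proof.
move=> Gus Gut I X D A L.
have Gus0 : 0 <= Gus.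
  by rewrite /Gus /side_gain mulr_ge0 ?sqr_ge0// mulr_ge0// ltW.
have Gut0 : 0 <= Gut.
  by rewrite /Gut /side_gain mulr_ge0 ?sqr_ge0// mulr_ge0// ltW.
have q10 : 0 <= s * Gus * Pus by apply: mulr_ge0; [exact: mulr_ge0|exact: ltW].
have q20 : 0 <= s * Gut * Put by apply: mulr_ge0; [exact: mulr_ge0|exact: ltW].
apply: (conditional_laplace_transform (alpha := alpha) (sigma := s * sigma2) Rs_gt0 Rus_lt Rut_lt
  theta_gt0 theta_lt Rus_visible Rut_visible lam_us_gt0 lam_ut_gt0 q10 q20 b_gt0 m_gt0
  Omega_gt0 Phi_us_ppp Phi_ut_ppp Phi_indep Hs_law Ht_law fading_indep).
- by rewrite mulr_ge0// ltW.
- move=> w; rewrite /X /I /I_up_up !mulrDr !expRD [LHS]mulrC /transmittance.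
  congr (_ * (_ * _)); first by rewrite mulNr.
    apply: (@expR_received_power _ _ _ _ _ _ _ _ _ _ _ (fun x => D w < dist3 x (typical_sat Rs) <=
      Rmax Rs Rus theta)) => x xP.
    have Sx := ppp_on_sphere Phi_us_ppp xP.
    rewrite in_setD (visible_capE Rs theta Sx) andbC; congr (_ && _).
    (* Outside the closed cap of radius [D w] means strictly farther than the nearest user, so that
       user drops out whatever its label. *)
    rewrite ltNge; congr (~~ _); apply/idP/idP => [/set_mem[]//|xD].
    exact/mem_set.
  apply: (@expR_received_power _ _ _ _ _ _ _ _ _ _ _ (fun x => dist3 x (typical_sat Rs) <=
    Rmax Rs Rut theta)) => x xP.
  exact: (visible_capE Rs theta (ppp_on_sphere Phi_ut_ppp xP)).
(* [laplace_formula] unfolds to the required exponent, with [deficit] as integrand. *)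
- by [].
Qed.
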